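(* Let $\mathbf{Z},\mathbf{Z}_1,\mathbf{Z}_2,\dots$ be i.i.d. $\mathbb{R}^d$-valued random vectors with $\mathbf{Z}\in\mathrm{RV}(\alpha,\mu)$ for some $\alpha>0$. Let $\mathbf{S}_0=\mathbf{0}$, $\mathbf{S}_n=\mathbf{Z}_1+\cdots+\mathbf{Z}_n$ for $n\ge1$, and let $\mathbf{S}^n=(\mathbf{S}_{[nt]})_{t\in[0,1]}$. Let $(\lambda_n)$ be a sequence of positive numbers with $\lambda_n\uparrow\infty$ such that - if $\alpha<2$: $\lambda_n^{-1}\mathbf{S}_n\to\mathbf{0}$ in probability; - if $\alpha=2$: $\lambda_n^{-1}\mathbf{S}_n\to\mathbf{0}$ in probability and $\lambda_n/\sqrt{n^{1+\gamma}}\to\infty$ for some $\gamma>0$; - if $\alpha>2$: $\lambda_n^{-1}\mathbf{S}_n\to\mathbf{0}$ in probability and $\lambda_n/\sqrt{n\log n}\to\infty$. Then $(\mathbf{S}^n)\in\mathrm{LD}(((\gamma_n,\lambda_n)),m,\overline{\mathbb{D}}_0)$, where $\gamma_n=[n\mathrm{P}(|\mathbf{Z}|>\lambda_n)]^{-1}$. That is, $0<\gamma_n,\lambda_n\uparrow\infty$ and $m$ is a nonnull boundedly finite measure on $\mathcal{B}(\overline{\mathbb{D}}_0)$ with $m(\overline{\mathbb{D}}_0\setminus\mathbb{D})=0$ such that $$\gamma_n\mathrm{P}(\lambda_n^{-1}\mathbf{S}^n\in\cdot)\stackrel{\hat w}{\to}m(\cdot)\quad\text{on }\mathcal{B}(\overline{\mathbb{D}}_0)\quad\text{as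 }n\to\infty.$$ Moreover, the measure $m$ satisfies $m(\mathcal{V}_0^c)=0$, and its one-dimensional restrictions satisfy $m_t=t\mu$ for $t\in[0,1]$.
   Context: $|\cdot|$ is the (Euclidean) norm on $\mathbb{R}^d$, $[x]$ is the integer part of $x$, and $\overline{\mathbb{R}}=\mathbb{R}\cup\{-\infty,\infty\}$. Vague convergence. The space $\overline{\mathbb{R}}^d\setminus\{\mathbf{0}\}$ is topologized so that its Borel sets coincide with those of $\mathbb{R}^d$ on $\mathbb{R}^d\setminus\{\mathbf{0}\}$ and so that a Borel set $B$ is relatively compact iff $B\cap\mathbb{R}^d$ is bounded away from $\mathbf{0}$ (i.e. $\mathbf{0}\notin\overline{B\cap\mathbb{R}^d}$). Vague convergence $\mu_n\xrightarrow{v}\mu$ of Radon measures on it means $\mu_n(B)\to\mu(B)$ for every relatively compact Borel $B$ with $\mu(\partial B)=0$. Regular variation. $\mathbf{Z}\in\mathrm{RV}(\alpha,\mu)$ means: $\mu$ is a nonnull Radon measure on $\mathcal{B}(\overline{\mathbb{R}}^d\setminus\{\mathbf{0}\})$ with $\mu(\overline{\mathbb{R}}^d\setminus\mathbb{R}^d)=0$; there is a sequence $0<a_n\uparrow\infty$, chosen so that $n\mathrm{P}(|\mathbf{Z}|>a_n)\to1$, with $n\mathrm{P}(a_n^{-1}\mathbf{Z}\in\cdot)\xrightarrow{v}\mu(\cdot)$; and $\mu(uB)=u^{-\alpha}\mu(B)$ for all $u>0$ and Borel $B$. With this normalization, $\mathrm{P}(\mathbf{Z}\in u\,\cdot)/\mathrm{P}(|\mathbf{Z}|>u)\xrightarrow{v}\mu(\cdot)$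 as $u\to\infty$. Path space. $\mathbb{D}=\mathbb{D}([0,1],\mathbb{R}^d)$ is the space of càdlàg functions $[0,1]\to\mathbb{R}^d$ with the $J_1$-topology, metrized by the complete Skorokhod (Billingsley) metric $d_0$. Let $|\mathbf{x}|_\infty=\sup_{t\in[0,1]}|\mathbf{x}_t|$ and $\mathbb{S}_{\mathbb{D}}=\{\mathbf{x}\in\mathbb{D}:|\mathbf{x}|_\infty=1\}$ with the relative topology. Define $\overline{\mathbb{D}}_0=(0,\infty]\times\mathbb{S}_{\mathbb{D}}$ with the complete separable metric $\max\{|1/x^*-1/y^*|,d_0(\tilde{\mathbf{x}},\tilde{\mathbf{y}})\}$ for $\mathbf{x}=(x^*,\tilde{\mathbf{x}})$, $\mathbf{y}=(y^*,\tilde{\mathbf{y}})$ (with $1/\infty=0$). The set $\mathbb{D}\setminus\{\mathbf{0}\}$ is identified with $(0,\infty)\times\mathbb{S}_{\mathbb{D}}$ through the homeomorphism $\mathbf{x}\mapsto(|\mathbf{x}|_\infty,\mathbf{x}/|\mathbf{x}|_\infty)$, so $\overline{\mathbb{D}}_0\setminus\mathbb{D}=\{\infty\}\times\mathbb{S}_{\mathbb{D}}$. A measure on $\overline{\mathbb{D}}_0$ is boundedly finite if it is finite on bounded Borel sets. For boundedly finite measures, $m_n\stackrel{\hat w}{\to}m$ means $m_n(B)\to m(B)$ for every bounded Borel set $B\subset\overline{\mathbb{D}}_0$ with $m(\partial B)=0$. $\mathcal{V}_0=\{\mathbf{x}\in\mathbb{D}:\mathbf{x}=\mathbf{y}\mathbb{1}_{[v,1]},\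 v\in[0,1),\ \mathbf{y}\in\mathbb{R}^d\setminus\{\mathbf{0}\}\}$, and $\mathcal{V}_0^c$ is its complement in $\overline{\mathbb{D}}_0$. The one-dimensional restriction $m_t$ is the measure on $\mathcal{B}(\overline{\mathbb{R}}^d\setminus\{\mathbf{0}\})$ given by $m_t(B)=m(\{\mathbf{x}\in\mathbb{D}:\mathbf{x}_t\in B\cap\mathbb{R}^d\})$.
   Formalization: In the conclusion, ''γ_n ↑ ∞'' is proved only as γ_n > 0 and γ_n → ∞; monotonicity of γ_n is dropped because it can fail (e.g. P(|Z|>x)=x^{-1/2}, λ_n=16^k for 2^k ≤ n < 2^{k+1} gives γ_n=4^k/n). *)

(* Defs.v *)
From HB Require Import structures.
From mathcomp Require Import all_boot all_order all_algebra finmap.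
From mathcomp Require Import ring lra.
From mathcomp Require Import all_classical all_reals all_analysis.

Set Implicit Arguments.
Unset Strict Implicit.
Unset Printing Implicit Defensive.

Import Order.TTheory GRing.Theory Num.Def Num.Theory.
Import numFieldNormedType.Exports.

Local Open Scope classical_set_scope.
Local Open Scope ring_scope.

Section euclidean_norm.
Context {R : realType} {d : nat}.
Implicit Types x y : 'rV[R]_d.

(* The library's norm on 'rV[R]_d is the sup norm; it induces the same
   topology. *)
Definition enorm x : R := Num.sqrt (\sum_i x ord0 i ^+ 2).

Lemma enorm_ge0 x : 0 <= enorm x.
Proof. exact: sqrtr_ge0. Qed.

Lemma enorm_sq x : enorm x ^+ 2 = \sum_i x ord0 i ^+ 2.
Proof. by rewrite sqr_sqrtr// sumr_ge0// => i _; exact: sqr_ge0. Qed.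

Lemma enorm_eq0 x : enorm x = 0 -> x = 0.
Proof.
move=> x0; apply/matrixP => i j; rewrite (ord1 i) mxE.
have /eqP := enorm_sq x; rewrite x0 expr0n/= eq_sym psumr_eq0; last first.
  by move=> k _; exact: sqr_ge0.
by move=> /allP/(_ j (mem_index_enum _))/=; rewrite sqrf_eq0 => /eqP.
Qed.

Lemma enorm0 : enorm 0 = 0.
Proof. by rewrite /enorm big1 ?sqrtr0// => i _; rewrite mxE expr0n. Qed.

Lemma enormN x : enorm (- x) = enorm x.
Proof.
by rewrite /enorm; congr Num.sqrt; apply: eq_bigr => i _; rewrite mxE sqrrN.
Qed.

Lemma enormB x y : enorm (x - y) = enorm (y - x).
Proof. by rewrite -enormN opprB. Qed.

Lemma dot_le_enorm x y :
  \sum_i x ord0 i * y ord0 i <= enorm x * enorm y.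
Proof.
have [x0|x0] := eqVneq (enorm x) 0.
  rewrite x0 mul0r (enorm_eq0 x0) big1// => i _; by rewrite mxE mul0r.
have [y0|y0] := eqVneq (enorm y) 0.
  rewrite y0 mulr0 (enorm_eq0 y0) big1// => i _; by rewrite mxE mulr0.
have xy0 : 0 < enorm x * enorm y.
  by rewrite mulr_gt0// lt_neqAle eq_sym ?x0 ?y0 enorm_ge0.
rewrite -(ler_pM2l (mulr_gt0 (ltr0n R 2) xy0)) mulr_sumr.
apply: (@le_trans _ _ (\sum_i ((enorm y * x ord0 i) ^+ 2 +
                              (enorm x * y ord0 i) ^+ 2))).
  apply: ler_sum => i _; rewrite -subr_ge0.
  have -> : (enorm y * x ord0 i) ^+ 2 + (enorm x * y ord0 i) ^+ 2 -
    2 * (enorm x * enorm y) * (x ord0 i * y ord0 i) =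
    (enorm y * x ord0 i - enorm x * y ord0 i) ^+ 2 by ring.
  exact: sqr_ge0.
rewrite big_split/=.
under eq_bigr do rewrite exprMn.
under [X in _ + X <= _]eq_bigr do rewrite exprMn.
rewrite -!mulr_sumr -!enorm_sq le_eqVlt; apply/orP; left; apply/eqP; ring.
Qed.

Lemma enorm_triangle x y : enorm (x + y) <= enorm x + enorm y.
Proof.
rewrite -(@ler_pXn2r _ 2)// ?nnegrE ?addr_ge0 ?enorm_ge0//.
rewrite sqrrD !enorm_sq.
under eq_bigr do rewrite mxE sqrrD.
rewrite !big_split/= -addrA -[leRHS]addrA lerD2l lerD2r.
by rewrite mulr2n lerD ?dot_le_enorm.
Qed.

Lemma enorm_distD y x z : enorm (x - z) <= enorm (x - y) + enorm (y - z).
Proof. by rewrite -[x - z](subrKA y); exact: enorm_triangle. Qed.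

Lemma coord_le_norm x i : `|x ord0 i| <= `|x|.
Proof.
rewrite [leRHS]/normr/= mx_normrE.
by apply/bigmax_geP; right => /=; exists (ord0, i).
Qed.

Lemma enorm_le_norm x : enorm x <= Num.sqrt d%:R * `|x|.
Proof.
rewrite -(@ler_pXn2r _ 2)// ?nnegrE ?mulr_ge0 ?sqrtr_ge0 ?enorm_ge0//.
rewrite exprMn enorm_sq sqr_sqrtr ?ler0n//.
apply: (@le_trans _ _ (\sum_(i < d) `|x| ^+ 2)).
  apply: ler_sum => i _; rewrite -real_normK ?num_real//.
  by rewrite ler_pXn2r ?nnegrE//; exact: coord_le_norm.
by rewrite sumr_const card_ord mulr_natl.
Qed.

Lemma cvg_enorm {T : Type} {F : set_system T} {FF : Filter F} (f : T -> 'rV[R]_d)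
    (l : 'rV[R]_d) (e : R) :
  f @ F --> l -> 0 < e -> \forall s \near F, enorm (f s - l) < e.
Proof.
move=> /cvgr_distC_lt fl e0.
pose c := Num.sqrt (d%:R : R) + 1.
have c0 : 0 < c by rewrite ltr_wpDl// sqrtr_ge0.
have := fl (e / c) (divr_gt0 e0 c0).
apply: filterS => s fse; apply: le_lt_trans (enorm_le_norm _) _.
apply: (@le_lt_trans _ _ (c * `|f s - l|)).
  by rewrite ler_wpM2r// lerDl.
by rewrite mulrC -ltr_pdivlMr.
Qed.

End euclidean_norm.

Definition unit_itv (R : realType) : Type := set_type `[0:R, 1].
HB.instance Definition _ (R : realType) := PseudoMetric.on (unit_itv R).
HB.instance Definition _ (R : realType) := SubType.on (unit_itv R).

Section unit_interval.
Context {R : realType}.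
Implicit Types s t : unit_itv R.

Lemma unit_itvP t : 0 <= \val t <= 1.
Proof. by have := valP t; rewrite inE/= in_itv. Qed.

Lemma unit_itv_subproof (x : R) : 0 <= x <= 1 -> x \in `[0:R, 1]%classic.
Proof. by move=> x01; rewrite inE/= in_itv. Qed.

Definition mk_unit_itv (x : R) (x01 : 0 <= x <= 1) : unit_itv R :=
  exist _ x (unit_itv_subproof x01).

Lemma nbhs_unit_itvP t (A : set (unit_itv R)) :
  nbhs t A <-> exists2 e : R, 0 < e & forall s, `|\val s - \val t| < e -> A s.
Proof.
split=> [/nbhs_ballP[e e0 eA]|[e e0 eA]].
  exists e => // s st; apply: eA.
  by change (`|\val t - \val s| < e); rewrite distrC.
apply/nbhs_ballP; exists e => // s.
by change (`|\val t - \val s| < e -> A s); rewrite distrC => /eA.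
Qed.

Definition right_nbhs t := within [set s | \val t <= \val s] (nbhs t).

Definition left_nbhs t := within [set s | \val s < \val t] (nbhs t).

#[global] Instance right_nbhs_filter t : Filter (right_nbhs t).
Proof. exact: within_filter. Qed.

#[global] Instance left_nbhs_filter t : Filter (left_nbhs t).
Proof. exact: within_filter. Qed.

Lemma right_nbhsP t (A : set (unit_itv R)) : right_nbhs t A <->
  exists2 e : R, 0 < e & forall s, \val t <= \val s < \val t + e -> A s.
Proof.
apply: (iff_trans (nbhs_unit_itvP _ _)); split=> -[e e0 eA]; exists e => // s.
  move=> /andP[ts se]; apply: eA => //.
  by rewrite ger0_norm ?subr_ge0// ltrBlDl.
by move=> se ts; apply: eA; rewrite ts -ltrBlDl -(ger0_norm (_ : 0 <= _ - _)) ?subr_ge0.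
Qed.

Lemma left_nbhsP t (A : set (unit_itv R)) : left_nbhs t A <->
  exists2 e : R, 0 < e & forall s, \val t - e < \val s < \val t -> A s.
Proof.
apply: (iff_trans (nbhs_unit_itvP _ _)); split=> -[e e0 eA]; exists e => // s.
  move=> /andP[es st]; apply: eA => //.
  by rewrite ltr0_norm ?subr_lt0// opprB ltrBlDl -ltrBlDr.
move=> se st; apply: eA; rewrite st andbT ltrBlDl -ltrBlDr.
by rewrite -opprB -(ltr0_norm (_ : _ - _ < 0)) ?subr_lt0.
Qed.

(* Such a map is automatically a homeomorphism of the unit interval fixing 0
   and 1. *)
Definition time_change (l : unit_itv R -> unit_itv R) :=
  (forall s t, \val s < \val t -> \val (l s) < \val (l t)) /\
  (forall t, exists s, l s = t).

Definition log_slope_le (l : unit_itv R -> unit_itv R) (e : R) :=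
  forall s t, \val s < \val t ->
    `|ln ((\val (l t) - \val (l s)) / (\val t - \val s))| <= e.

Lemma time_change_id : time_change id.
Proof. by split=> // t; exists t. Qed.

Lemma time_change_comp l1 l2 :
  time_change l1 -> time_change l2 -> time_change (l2 \o l1).
Proof.
move=> [i1 s1] [i2 s2]; split=> [s t /i1/i2//|t].
by have [s <-] := s2 t; have [r <-] := s1 s; exists r.
Qed.

Lemma time_change_lt l s t : time_change l ->
  (\val (l s) < \val (l t)) = (\val s < \val t).
Proof.
move=> [il _]; apply/idP/idP => [|/il//]; apply: contraTT.
rewrite -!leNgt le_eqVlt => /orP[/eqP/val_inj ->//|/il/ltW//].
Qed.

Lemma time_change_inv l : time_change l ->
  exists2 k, time_change k & cancel l k /\ cancel k l.
Proof.
move=> cl; have [il sl] := cl.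
pose k t := projT1 (cid (sl t)).
have kl : cancel k l by move=> t; rewrite /k; case: cid.
have inj : injective l.
  move=> s t st; apply: val_inj; apply/eqP; rewrite eq_le !leNgt.
  by rewrite -(time_change_lt s t cl) -(time_change_lt t s cl) st ltxx.
have lk : cancel l k by move=> t; apply: inj; rewrite kl.
exists k => //; split=> [s t st|t]; last by exists (l t); rewrite lk.
by rewrite -(time_change_lt (k s) (k t) cl) !kl.
Qed.

Lemma log_slope_inv l k e : time_change l -> cancel l k -> cancel k l ->
  log_slope_le l e -> log_slope_le k e.
Proof.
move=> cl lk kl le s t st.
have ks_kt : \val (k s) < \val (k t) by rewrite -(time_change_lt (k s) (k t) cl) !kl.
rewrite -invf_div lnV ?posrE ?divr_gt0 ?subr_gt0// normrN.
by have := le _ _ ks_kt; rewrite !kl.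
Qed.

Lemma log_slope_comp l1 l2 e1 e2 : time_change l1 -> time_change l2 ->
  log_slope_le l1 e1 -> log_slope_le l2 e2 ->
  log_slope_le (l2 \o l1) (e1 + e2).
Proof.
move=> [i1 _] [i2 _] h1 h2 s t st /=.
have l1st := i1 _ _ st; have l2st := i2 _ _ l1st.
have := h1 _ _ st; have := h2 _ _ l1st.
move: st l1st l2st; rewrite -subr_gt0 -[in X in _ -> X]subr_gt0.
rewrite -[in X in _ -> _ -> X -> _]subr_gt0.
move: (\val t - _) (\val (l1 t) - _) (\val (l2 _) - _) => a b c a0 b0 c0 cb ba.
have -> : c / a = c / b * (b / a) by rewrite mulrA divfK// gt_eqF.
rewrite lnM ?posrE ?divr_gt0// [e1 + e2]addrC.
by apply: le_trans (ler_normD _ _) _; exact: lerD.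
Qed.


Lemma time_change_le l s t : time_change l ->
  (\val (l s) <= \val (l t)) = (\val s <= \val t).
Proof. by move=> cl; rewrite !leNgt time_change_lt. Qed.

Lemma time_change0 l t : time_change l -> \val t = 0 -> \val (l t) = 0.
Proof.
move=> cl t0; have [s ls] := cl.2 t.
have : \val (l t) <= \val (l s).
  by rewrite time_change_le// t0; have /andP[] := unit_itvP s.
have /andP[lt0 _] := unit_itvP (l t); rewrite ls t0 => lt0'.
by apply/eqP; rewrite eq_le lt0' lt0.
Qed.

Lemma time_change1 l t : time_change l -> \val t = 1 -> \val (l t) = 1.
Proof.
move=> cl t1; have [s ls] := cl.2 t.
have : \val (l s) <= \val (l t).
  by rewrite time_change_le// t1; have /andP[] := unit_itvP s.
have /andP[_ lt1] := unit_itvP (l t); rewrite ls t1 => lt1'.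
by apply/eqP; rewrite eq_le lt1 lt1'.
Qed.

Lemma log_slope_dist l e t : time_change l -> log_slope_le l e -> 0 <= e < 1 ->
  \val t * (1 - e) <= \val (l t) /\ \val (l t) * (1 - e) <= \val t.
Proof.
move=> cl le /andP[e0 e1].
have [t0|t0] := eqVneq (\val t) 0.
  by rewrite time_change0// t0 mul0r.
have {}t0 : 0 < \val t by rewrite lt_neqAle eq_sym t0; case/andP: (unit_itvP t).
have z01 : 0 <= (0 : R) <= 1 by rewrite lexx ler01.
pose z := mk_unit_itv z01.
have zt : \val z < \val t by [].
have lt0 : 0 < \val (l t).
  have : \val (l z) < \val (l t) by rewrite time_change_lt.
  by rewrite (time_change0 (t := z) cl erefl).
have lz : \val (l z) = 0 by exact: (time_change0 (t := z) cl erefl).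
have := le _ _ zt; rewrite lz (subr0 (\val t)) subr0.
set r := \val (l t) / \val t => hr.
have r0 : 0 < r by rewrite divr_gt0.
have rE : expR (ln r) = r by rewrite lnK.
move: hr; rewrite ler_norml => /andP[h1 h2]; split.
  rewrite mulrC -ler_pdivlMr// -/r -rE.
  by apply: le_trans (expR_ge1Dx _); rewrite lerD2l.
rewrite mulrC -ler_pdivlMr//.
have -> : \val t / \val (l t) = expR (- ln r).
  by rewrite expRN rE /r invf_div.
by apply: le_trans (expR_ge1Dx _); rewrite lerD2l lerN2.
Qed.

End unit_interval.

Section cadlag.
Context {R : realType} {d : nat}.
Local Notation I := (unit_itv R).

Definition cadlag (x : I -> 'rV[R]_d) := forall t : I,
  x @ right_nbhs t --> x t /\ exists l : 'rV[R]_d, x @ left_nbhs t --> l.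

Lemma cvg_right (x : I -> 'rV[R]_d) (l : 'rV[R]_d) t (e : R) :
  x @ right_nbhs t --> l -> 0 < e ->
  exists2 a : R, 0 < a &
    forall s, \val t <= \val s < \val t + a -> enorm (x s - l) < e.
Proof. by move=> xl e0; exact: ((right_nbhsP _ _).1 (cvg_enorm xl e0)). Qed.

Lemma cvg_left (x : I -> 'rV[R]_d) (l : 'rV[R]_d) t (e : R) :
  x @ left_nbhs t --> l -> 0 < e ->
  exists2 a : R, 0 < a &
    forall s, \val t - a < \val s < \val t -> enorm (x s - l) < e.
Proof. by move=> xl e0; exact: ((left_nbhsP _ _).1 (cvg_enorm xl e0)). Qed.

Lemma cadlag_bounded x : cadlag x -> exists M, forall t, enorm (x t) <= M.
Proof.
move=> cx.
have /compact_near_coveringP cpt := @segment_compact R 0 1.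
pose P (M u : R) : Prop := forall t : I, \val t = u -> enorm (x t) <= M.
have cov : \forall M \near +oo, `[0:R, 1]%classic `<=` P M.
  apply: cpt => u; rewrite /= in_itv/= => u01.
  pose t := mk_unit_itv u01; have [rt [l lt]] := cx t.
  have [e e0 he] := cvg_right rt ltr01.
  have [e' e'0 he'] := cvg_left lt ltr01.
  exists ([set v | u - e' < v /\ v < u + e],
          [set M | 1 + enorm (x t) <= M /\ 1 + enorm l <= M]) => /=.
    split.
      by apply: filterI; [apply: lt_nbhsr; rewrite gtrBl|
                          apply: lt_nbhsl; rewrite ltrDl].
    by apply: filterI; apply: nbhs_pinfty_ge; exact: num_real.
  move=> [v M]/= [[ev ve] [rM lM]] s sv.
  have [ts|st] := leP (\val t) (\val s).
    apply: le_trans rM; rewrite -[x s](subrK (x t)).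
    apply: le_trans (enorm_triangle _ _) _.
    by rewrite lerD2r ltW// he// ts sv ve.
  apply: le_trans lM; rewrite -[x s](subrK l).
  apply: le_trans (enorm_triangle _ _) _.
  by rewrite lerD2r ltW// he'// st andbT sv ev.
have [M HM] := filter_ex cov.
exists M => t; apply: HM (erefl _).
by have := valP t; rewrite inE.
Qed.

Lemma cadlagZ a (x : I -> 'rV[R]_d) :
  cadlag x -> cadlag (fun t => a *: x t).
Proof.
move=> cx t; have [xr [l xl]] := cx t; split; first exact: cvgZl_tmp.
by exists (a *: l); exact: cvgZl_tmp.
Qed.

Lemma cadlag_cst (a : 'rV[R]_d) : cadlag (fun=> a).
Proof. by move=> t; split; [exact: cvg_cst|exists a; exact: cvg_cst]. Qed.

Lemma cadlag_step (n : nat) (f : nat -> 'rV[R]_d) :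
  cadlag (fun t => f (Num.truncn (n%:R * \val t))).
Proof.
have [->|n0] := posnP n.
  by under eq_fun do rewrite mul0r truncn0; exact: cadlag_cst.
have nR0 : 0 < n%:R :> R by rewrite ltr0n.
move=> t; have /andP[t0 t1] := unit_itvP t.
split.
  have /andP[kt tk] := truncn_itv (mulr_ge0 (ltW nR0) t0).
  set k := Num.truncn _ in kt tk *.
  apply: cvg_near_cst; apply/right_nbhsP.
  exists (k.+1%:R / n%:R - \val t).
    by rewrite subr_gt0 ltr_pdivlMr// mulrC.
  move=> s /andP[ts sk]; congr f; apply/truncn_def.
  rewrite addrC subrK ltr_pdivlMr// mulrC in sk.
  by rewrite sk andbT (le_trans kt)// ler_pM2l.
have {t0}[t0|tN0] := eqVneq (\val t) 0.
  exists 0; apply: cvg_near_cst; apply/left_nbhsP; exists 1 => // s.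
  by rewrite t0 => /andP[_]; rewrite ltNge; case/andP: (unit_itvP s) => ->.
have {}t0 : 0 < \val t by rewrite lt_neqAle eq_sym tN0; case/andP: (unit_itvP t).
have [k /andP[kt tk]] : exists k : nat, k%:R < n%:R * \val t <= k.+1%:R.
  have nt0 : 0 < n%:R * \val t by rewrite mulr_gt0.
  have /andP[+ /ltW] := truncn_itv (ltW nt0).
  rewrite le_eqVlt => /orP[/eqP|]; last first.
    by move=> kt tk; exists (Num.truncn (n%:R * \val t)); rewrite kt.
  case: (Num.truncn _) => [|k] kt _; first by rewrite -kt ltxx in nt0.
  by exists k; rewrite -kt ltr_nat leqnn lexx.
exists (f k); apply: cvg_near_cst; apply/left_nbhsP.
exists (\val t - k%:R / n%:R); first by rewrite subr_gt0 ltr_pdivrMr// mulrC.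
move=> s /andP[ks st]; congr f; apply/truncn_def.
rewrite opprB addrC subrK ltr_pdivrMr// mulrC in ks.
by rewrite (ltW ks)/= (lt_le_trans _ tk)// ltr_pM2l.
Qed.

End cadlag.

Section skorokhod.
Context {R : realType} {d : nat}.

Record skorokhod := Skorokhod {
  trajectory :> unit_itv R -> 'rV[R]_d;
  path_cadlag : cadlag trajectory }.

HB.instance Definition _ := gen_eqMixin skorokhod.
HB.instance Definition _ := gen_choiceMixin skorokhod.

Implicit Types x y z : skorokhod.

Lemma skorokhod_eqP x y : x = y <-> forall t, x t = y t.
Proof.
split=> [->//|]; case: x y => x cx [y cy]/= /funext xy.
by move: cx cy; rewrite xy => cx cy; congr Skorokhod; exact: Prop_irrelevance.
Qed.

Definition supnorm x : R := sup [set enorm (x t) | t in [set: unit_itv R]].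

(* Billingsley's metric d_0, complete and inducing the J_1 topology. *)
Definition skdist_set x y : set R :=
  [set e | exists l, [/\ time_change l, log_slope_le l e &
                         forall t, enorm (x t - y (l t)) <= e]].

Definition skdist x y : R := inf (skdist_set x y).

Let zero_itv : unit_itv R := @mk_unit_itv R 0 (introT andP (conj (lexx 0) ler01)).

Lemma skdist_set_ge0 x y e : skdist_set x y e -> 0 <= e.
Proof. by move=> [l [_ _ /(_ zero_itv)]]; apply: le_trans; exact: enorm_ge0. Qed.

Lemma log_slope_id e : 0 <= e -> log_slope_le (@id (unit_itv R)) e.
Proof.
by move=> e0 s t st; rewrite divff ?ln1 ?normr0// subr_eq0 gt_eqF.
Qed.

Lemma has_inf_skdist_set x y : has_inf (skdist_set x y).
Proof.
split; last by exists 0 => e /skdist_set_ge0.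
have [M HM] := cadlag_bounded (path_cadlag x).
have [N HN] := cadlag_bounded (path_cadlag y).
have MN0 : 0 <= M + N.
  by rewrite addr_ge0// (le_trans (enorm_ge0 _) (HM zero_itv), le_trans (enorm_ge0 _) (HN zero_itv)).
exists (M + N), id; split; [exact: time_change_id|exact: log_slope_id|].
move=> t; apply: le_trans (enorm_triangle _ _) _.
by rewrite enormN lerD.
Qed.

Lemma skdist_le x y e : skdist_set x y e -> skdist x y <= e.
Proof. by move=> xye; apply: ge_inf => //; case: (has_inf_skdist_set x y). Qed.

Lemma skdist_ge0 x y : 0 <= skdist x y.
Proof.
apply: lb_le_inf; first by case: (has_inf_skdist_set x y).
by move=> e /skdist_set_ge0.
Qed.

Lemma skdistxx x : skdist x x = 0.
Proof.
apply/eqP; rewrite eq_le skdist_ge0 andbT; apply: skdist_le.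
exists id; split; [exact: time_change_id|exact: log_slope_id|].
by move=> t; rewrite subrr enorm0.
Qed.

Lemma skdist_setC x y : skdist_set x y `<=` skdist_set y x.
Proof.
move=> e [l [cl le xy]]; have [k ck [lk kl]] := time_change_inv cl.
exists k; split => //; first exact: log_slope_inv le.
by move=> t; rewrite enormB -{2}(kl t).
Qed.

Lemma skdist_sym x y : skdist x y = skdist y x.
Proof. by congr inf; apply/seteqP; split; exact: skdist_setC. Qed.

Lemma skdist_triangle y x z : skdist x z <= skdist x y + skdist y z.
Proof.
apply/ler_addgt0Pl => e e0.
have e20 : 0 < e / 2 by rewrite divr_gt0.
have [a [l [cl la xy]] ha] := inf_adherent e20 (has_inf_skdist_set x y).
have [b [k [ck kb yz]] hb] := inf_adherent e20 (has_inf_skdist_set y z).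
apply: (@le_trans _ _ (a + b)).
  apply: skdist_le; exists (k \o l); split.
  - exact: time_change_comp.
  - exact: log_slope_comp.
  - by move=> t; apply: le_trans (enorm_distD (y (l t)) _ _) _; rewrite lerD.
move: (ltW ha) (ltW hb); rewrite -/(skdist x y) -/(skdist y z); lra.
Qed.

Lemma skdist_eq0 x y : skdist x y = 0 -> x = y.
Proof.
move=> xy0; apply/skorokhod_eqP => t.
have adh (e : R) : 0 < e -> exists l, [/\ time_change l, log_slope_le l e &
    forall t, enorm (x t - y (l t)) <= e].
  move=> e0; have [a [l [cl la xy]]] := inf_adherent e0 (has_inf_skdist_set x y).
  rewrite -/(skdist x y) xy0 add0r => /ltW ae; exists l; split => //.
    by move=> s u su; apply: le_trans ae; exact: la.
  by move=> s; apply: le_trans ae.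
have /andP[t0 t1] := unit_itvP t.
apply/eqP; rewrite -subr_eq0; apply/eqP; apply: enorm_eq0.
apply/eqP; rewrite eq_le enorm_ge0 andbT; apply/ler_addgt0Pl => e e0.
rewrite addr0.
have [tE|tN] := eqVneq (\val t) 1.
  have [l [cl _ xy]] := adh _ e0.
  by have := xy t; rewrite (_ : l t = t)//; apply: val_inj; rewrite time_change1.
have {}t1 : \val t < 1 by rewrite lt_neqAle tN.
have e30 : 0 < e / 3 by rewrite divr_gt0.
have [a a0 xa] := cvg_right (path_cadlag x t).1 e30.
have [b b0 yb] := cvg_right (path_cadlag y t).1 e30.
pose c := Num.min (Num.min a b) (1 - \val t).
have c0 : 0 < c by rewrite !lt_min a0 b0 subr_gt0.
have [ca cb c1] : [/\ c <= a, c <= b & c <= 1 - \val t].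
  by rewrite /c !ge_min !lexx !orbT.
have s01 : 0 <= \val t + c / 2 <= 1 by apply/andP; split; move: t0 c0 c1 t1; clear; lra.
pose s := mk_unit_itv s01.
have vs : \val s = \val t + c / 2 by [].
pose h := Num.min (e / 3) (c / 8).
have h0 : 0 < h by rewrite lt_min e30 divr_gt0.
have [l [cl lh xy]] := adh _ h0.
have [he hc] : h <= e / 3 /\ h <= c / 8 by rewrite /h !ge_min !lexx orbT.
have h1 : 0 <= h < 1 by move: h0 c0 hc c1 t0; clear; move=> *; apply/andP; split; lra.
have [l1 l2] := log_slope_dist s cl lh h1.
have ts : \val t <= \val s < \val t + a.
  by rewrite vs; move: c0 ca; clear; move=> *; apply/andP; split; lra.
have /andP[ls0 ls1] := unit_itvP (l s).
have tls : \val t <= \val (l s) < \val t + b.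
  move: h1 hc c0 cb c1 t0 ls0 ls1 l1 l2; rewrite vs; clear => *.
  apply/andP; split; nra.
have := xy s; have := xa s ts; have := yb _ tls.
have := enorm_distD (x s) (x t) (y t).
have := enorm_distD (y (l s)) (x s) (y t).
rewrite (enormB (x t) (x s)); move: he; clear; lra.
Qed.

HB.instance Definition _ := @isMetric.Build R skorokhod skdist skdistxx
  skdist_eq0 skdist_sym skdist_triangle.

End skorokhod.

Section polar_space.
Context {R : realType} {d : nat}.
Local Notation D := (@skorokhod R d).

Definition path_scale (a : R) (x : D) : D :=
  Skorokhod (cadlagZ a (path_cadlag x)).

Record polar := Polar {
  radius : \bar R;
  direction : D;
  radius_gt0 : (0 < radius)%E;
  direction_norm1 : supnorm direction = 1 }.

HB.instance Definition _ := gen_eqMixin polar.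
HB.instance Definition _ := gen_choiceMixin polar.

Implicit Types z w : polar.

(* [inve] sends +oo to 0. *)
Definition inv_radius z : R := fine (radius z)^-1%E.

Definition polar_dist z w : R :=
  Num.max `|inv_radius z - inv_radius w| (mdist (direction z) (direction w)).

Lemma polar_distxx z : polar_dist z z = 0.
Proof. by rewrite /polar_dist subrr normr0 mdistxx maxxx. Qed.

Lemma polar_dist_sym z w : polar_dist z w = polar_dist w z.
Proof. by rewrite /polar_dist distrC metric_sym. Qed.

Lemma polar_dist_triangle w z v :
  polar_dist z v <= polar_dist z w + polar_dist w v.
Proof.
rewrite /polar_dist ge_max; apply/andP; split.
  by apply: le_trans (ler_distD (inv_radius w) _ _) _; rewrite lerD// le_max lexx.
apply: le_trans (metric_triangle _ (direction w) _) _.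
by rewrite lerD// le_max lexx orbT.
Qed.

Lemma inv_radius_inj z w : inv_radius z = inv_radius w -> radius z = radius w.
Proof.
rewrite /inv_radius; case: z w => [r x r0 _] [s y s0 _]/=.
case: r r0 => [r||]// r0; case: s s0 => [s||]// s0; rewrite ?lte_fin in r0 s0.
- by rewrite /inve !gt_eqF//= => /invr_inj ->.
- by rewrite /inve gt_eqF//= => /eqP; rewrite invr_eq0 gt_eqF.
- by rewrite /inve gt_eqF//= => /esym/eqP; rewrite invr_eq0 gt_eqF.
Qed.

Lemma polar_dist_eq0 z w : polar_dist z w = 0 -> z = w.
Proof.
move=> zw0.
have : `|inv_radius z - inv_radius w| <= 0 by rewrite -zw0 le_max lexx.
rewrite normr_le0 subr_eq0 => /eqP/inv_radius_inj.
have : mdist (direction z) (direction w) <= 0 by rewrite -zw0 le_max lexx orbT.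
move=> h; have /mdist_positivity : mdist (direction z) (direction w) = 0.
  by apply/eqP; rewrite eq_le h mdist_ge0.
case: z w {zw0 h} => [r x r0 x1] [s y s0 y1]/= xy rs.
by subst; congr Polar; exact: Prop_irrelevance.
Qed.

HB.instance Definition _ := @isMetric.Build R polar polar_dist polar_distxx
  polar_dist_eq0 polar_dist_sym polar_dist_triangle.

(* Restricted to finite radii, the inverse of the identification of D minus 0
   with ]0, +oo[ x sphere. *)
Definition cartesian z : D := path_scale (fine (radius z)) (direction z).

Definition infinite_radius : set polar := [set z | radius z = +oo%E].

(* The part of a set of paths that lies in D minus 0, as a set of polar
   points. *)
Definition polar_set (A : set D) : set polar :=
  [set z | ~ infinite_radius z /\ A (cartesian z)].

(* The finite part of a set of polar points, as a set of paths. *)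
Definition path_set (B : set polar) : set D :=
  [set x | exists2 z, B z /\ ~ infinite_radius z & x = cartesian z].

Definition single_jump : set D :=
  [set x | exists v y, [/\ 0 <= v < 1, y != 0 &
     forall t, x t = if v <= \val t then y else 0]].

End polar_space.
Arguments polar : clear implicits.
Arguments infinite_radius {R d}.
Arguments single_jump {R d}.

(* [measurableType] demands a point, which the polar space and the punctured
   space only have in positive dimension: hence the dimension d.+1 from here
   on. *)
Section pointed_polar.
Context {R : realType} {d : nat}.

Let x0 : @skorokhod R d.+1 := Skorokhod (cadlag_cst (delta_mx ord0 ord0)).

Let supnorm_x0 : supnorm x0 = 1.
Proof.
have x0E t : enorm (x0 t) = 1.
  rewrite /enorm (bigD1 ord0)//= big1 ?mxE ?eqxx ?expr1n ?addr0 ?sqrtr1//.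
  by move=> i /negPf i0; rewrite mxE eqxx i0 expr0n.
rewrite /supnorm (_ : [set _ | _ in _] = [set 1]) ?sup1//.
apply/seteqP; split=> [_ [t _ <-]//|_ ->].
by exists (mk_unit_itv (introT andP (conj (lexx 0) ler01))).
Qed.

HB.instance Definition _ := isPointed.Build (polar R d.+1)
  (@Polar R d.+1 +oo%E x0 (ltry 0) supnorm_x0).

End pointed_polar.

Notation borel X := (g_sigma_algebraType (@open X)).

Section convergence_of_measures.
Context {R : realType}.

Definition boundary {X : topologicalType} (B : set X) : set X :=
  closure B `\` interior B.

(* [C] is the class of sets playing the role of bounded sets. *)
Definition cvg_measures {X : topologicalType} (C : set (set X))
    (mu_ : nat -> set X -> \bar R) (mu : set X -> \bar R) :=
  forall B : set X, <<s open >> B -> C B -> mu (boundary B) = 0%E ->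
    mu_ n B @[n --> \oo] --> mu B.

Definition vague_cvg {X : topologicalType} := @cvg_measures X precompact.

Definition radon {X : topologicalType} (mu : set X -> \bar R) :=
  forall K : set X, compact K -> (mu K < +oo)%E.

Definition metric_bounded {X : metricType R} (B : set X) :=
  exists r : R, forall x y, B x -> B y -> mdist x y <= r.

Definition hat_cvg {X : metricType R} := @cvg_measures X metric_bounded.

Definition boundedly_finite {X : metricType R} (mu : set X -> \bar R) :=
  forall B : set X, <<s open >> B -> metric_bounded B -> (mu B < +oo)%E.

End convergence_of_measures.

Section regular_variation.
Context {R : realType} {d : nat}.

(* [-oo, +oo]^d.+1 minus the origin, with the trace of the product topology. *)
Definition punctured_space : Type :=
  set_type [set x : 'rV[\bar R]_d.+1 | x != const_mx 0%E].
HB.instance Definition _ := Topological.on punctured_space.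
HB.instance Definition _ := SubType.on punctured_space.

Let punctured_subproof : \row_(i < d.+1) (+oo : \bar R)%E \in
  [set x : 'rV[\bar R]_d.+1 | x != const_mx 0%E].
Proof. by rewrite inE/=; apply/eqP => /matrixP/(_ ord0 ord0); rewrite !mxE. Qed.

HB.instance Definition _ := isPointed.Build punctured_space
  (exist (fun x => x \in [set x : 'rV[\bar R]_d.+1 | x != const_mx 0%E]) _
    punctured_subproof).

Definition coords (y : punctured_space) : 'rV[\bar R]_d.+1 := \val y.

Definition finite_part (B : set punctured_space) : set 'rV[R]_d.+1 :=
  [set x | exists2 y, B y & coords y = map_mx EFin x].

Definition infinite_points : set punctured_space :=
  [set y | exists i, coords y ord0 i \isn't a fin_num].

Definition dilate (u : R) (B : set punctured_space) : set punctured_space :=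
  [set y | exists2 x, B x & coords y = map_mx (mule u%:E) (coords x)].

Definition tail_prob {dT} {T : measurableType dT} (P : probability T R)
  (Z : T -> 'rV[R]_d.+1) (u : R) : \bar R := P [set w | u < enorm (Z w)].

Definition regularly_varying {dT} {T : measurableType dT}
    (P : probability T R) (Z : T -> 'rV[R]_d.+1) (alpha : R)
    (mu : {measure set (borel punctured_space) -> \bar R}) :=
  [/\ mu setT != 0%E,
      radon mu,
      mu infinite_points = 0%E,
      (exists a : nat -> R,
        [/\ forall n, (0 < n)%N -> 0 < a n,
            forall m n, (0 < m <= n)%N -> a m <= a n,
            a @ \oo --> +oo,
            (n%:R%:E * tail_prob P Z (a n))%E @[n --> \oo] --> 1%:E &
            vague_cvg (fun n B =>
              (n%:R%:E * P [set w | finite_part B ((a n)^-1 *: Z w)%R])%E) mu]) &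
      forall (u : R) (B : set punctured_space), 0 < u -> <<s open >> B ->
        mu (dilate u B) = ((u `^ (- alpha))%:E * mu B)%E].

End regular_variation.
Arguments punctured_space : clear implicits.

Section random_sequences.
Context {R : realType} {dT} {T : measurableType dT} (P : probability T R).

Definition independent_family {dE} {E : measurableType dE}
    (X : nat -> T -> E) :=
  forall (J : {fset nat}) (B : nat -> set E), (forall i, measurable (B i)) ->
    P (\bigcap_(i in [set` J]) X i @^-1` B i) =
    (\prod_(i <- J) P (X i @^-1` B i))%E.

Definition identically_distributed {dE} {E : measurableType dE}
    (X : nat -> T -> E) :=
  forall i j (B : set E), measurable B -> P (X i @^-1` B) = P (X j @^-1` B).

Definition cvg_probability0 {d} (X : nat -> T -> 'rV[R]_d.+1) :=
  forall e : R, 0 < e -> P [set w | e < enorm (X n w)] @[n --> \oo] --> 0%E.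

End random_sequences.

Section random_walk.
Context {R : realType} {d : nat}.
Local Notation D := (@skorokhod R d.+1).

Definition walk {T : Type} (X : nat -> T -> 'rV[R]_d.+1) (n : nat) (w : T) :
  'rV[R]_d.+1 := \sum_(1 <= k < n.+1) X k w.

(* [Num.truncn] is the integer part. *)
Definition walk_path {T : Type} (X : nat -> T -> 'rV[R]_d.+1) (n : nat) (w : T) :
  D := Skorokhod (cadlag_step n (fun k => walk X k w)).

(* The normalization gam is only required to tend to +oo: in the intended use,
   gam n = [n P(|Z| > lam n)]^-1, which need not be monotone in n, even for
   monotone lam (e.g. when lam is nearly constant on long blocks). *)
Definition large_deviations {dT} {T : measurableType dT} (P : probability T R)
    (X : nat -> T -> D) (gam lam : nat -> R)
    (m : {measure set (borel (polar R d.+1)) -> \bar R}) :=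
  [/\ (forall n, (0 < n)%N -> 0 < gam n) /\ gam @ \oo --> +oo,
      [/\ forall n, (0 < n)%N -> 0 < lam n,
          forall k n, (0 < k <= n)%N -> lam k <= lam n &
          lam @ \oo --> +oo],
      [/\ m setT != 0%E, boundedly_finite m & m infinite_radius = 0%E] &
      hat_cvg (fun n B => ((gam n)%:E *
        P [set w | path_set B (path_scale (lam n)^-1%R (X n w))])%E) m].

Definition marginal (m : set (polar R d.+1) -> \bar R) (t : unit_itv R)
    (B : set (punctured_space R d)) : \bar R :=
  m (polar_set [set x | finite_part B (x t)]).

End random_walk.

(* Main.v *)
(* A large deviation of the walk comes from a single large step. The limit
   measure m is the image of Leb(0, 1) x mu under (v, y) |-> y 1_[v, 1]; its
   support, its mass at infinity and its marginals are read off this formula.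
   Writing tau_n = n P(|Z| > lam_n), which tends to 0, convergence on
   m-continuity sets bounded away from 0 follows from two estimates.

   Lower bound, liminf P(path in U) / tau_n >= m(U) for U open: for each k, ask
   that Z_k / lam_n lie where the path with the single jump Z_k / lam_n at time
   k / n is well inside U, and that the walk without its k-th step be small. The
   two conditions are independent, the second has probability tending to 1, and
   the events for different k are disjoint. Sum over k = [n v] + 1 and apply
   Fatou's lemma in v.

   Upper bound, limsup P(max_k |S_k| > r lam_n) / tau_n <= r^-alpha: the
   contribution of the walks with no step beyond eta lam_n is o(tau_n), by
   Ottaviani's inequality and Chernoff's bound with parameter
   A (- ln tau_n) / lam_n. The truncated moments that this needs are controlled
   by regular variation and, if alpha >= 2, by the growth of lam_n. *)
Require Import Defs.
From HB Require Import structures.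
From mathcomp Require Import all_boot all_order all_algebra finmap.
From mathcomp Require Import ring lra.
From mathcomp Require Import all_classical all_reals all_analysis.
From mathcomp Require Import measurable_realfun.

Set Implicit Arguments.
Unset Strict Implicit.
Unset Printing Implicit Defensive.

Import Order.TTheory GRing.Theory Num.Def Num.Theory.
Import numFieldNormedType.Exports.

Local Open Scope classical_set_scope.
Local Open Scope ring_scope.

(** * Borel structure of row vectors *)

Section borel_matrices.
Context {R : realType}.

Lemma approx_rat (x e : R) : 0 < e -> exists q : rat, `|x - ratr q| < e.
Proof.
move=> e0; have [q] := rat_in_itvoo (ltr_pwDr e0 (lexx (x)) : x < x + e).
rewrite in_itv/= => /andP[xq qx]; exists q.
by rewrite ltr0_norm ?subr_lt0// opprB ltrBlDl.
Qed.

Lemma measurable_mx_open {dT} {T : measurableType dT} m n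
    (f : T -> 'M[R]_(m, n)) (U : set 'M[R]_(m, n)) :
  (forall i j, measurable_fun setT (fun w => f w i j)) -> open U ->
  measurable (f @^-1` U).
Proof.
move=> mf oU.
pose V (Qk : 'M[rat]_(m, n) * nat) : set 'M[R]_(m, n) :=
  [set M | forall i j, `|M i j - ratr (Qk.1 i j)| < Qk.2.+1%:R^-1].
pose V' Qk := if `[< V Qk `<=` U >] then f @^-1` V Qk else set0.
rewrite (_ : f @^-1` U = \bigcup_Qk V' Qk); last first.
  apply/seteqP; split=> [w UM|w [Qk _]]; last first.
    by rewrite /V'; case: asboolP => // + ?; exact.
  set M := f w.
  have /nbhs_ballP[e /= e0 eU] := open_nbhs_nbhs (conj oU UM : open_nbhs M U).
  have [k ke] : exists k : nat, k.+1%:R^-1 < e / 2.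
    exists (Num.truncn (2 / e)).
    rewrite -[e / 2]invrK ltf_pV2 ?posrE ?invr_gt0 ?divr_gt0// invf_div.
    exact: truncnS_gt.
  have k0 : 0 < (k.+1%:R : R)^-1 by rewrite invr_gt0 ltr0n.
  exists (\matrix_(i, j) projT1 (cid (approx_rat (M i j) k0)), k) => //.
  rewrite /V' asboolT.
    by rewrite /V /= => i j; rewrite mxE; case: cid.
  move=> N hN; apply: eU; split=> // i j; have := hN i j; rewrite /= mxE.
  case: cid => /= r hr hN'; change (`|M i j - N i j| < e).
  apply: le_lt_trans (ler_distD (ratr r) _ _) _.
  rewrite (distrC (ratr r)); move: hr hN' ke; move: (k.+1%:R^-1) => a; clear; lra.
apply: countable_bigcupT_measurable; first exact: countableP.
move=> [Q k]; rewrite /V'; case: ifP => // _.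
rewrite (_ : _ @^-1` _ = \big[setI/setT]_i \big[setI/setT]_j
    (setT `&` (fun w => f w i j) @^-1` [set x | `|x - ratr (Q i j)| < k.+1%:R^-1])).
  apply: bigsetI_measurable => i _; apply: bigsetI_measurable => j _.
  apply: mf => //; apply: open_measurable.
  rewrite (_ : [set _ | _] = ball (ratr (Q i j) : R) k.+1%:R^-1); first exact: ball_open.
  by apply/seteqP; split=> x /=; rewrite /ball/= distrC.
rewrite -bigcap_seq; apply/seteqP; split=> w /= hw.
  by move=> i _; rewrite -bigcap_seq => j _; split => //; exact: hw.
move=> i j; have := hw i; rewrite /= -bigcap_seq mem_index_enum.
by move=> /(_ isT j); rewrite /= mem_index_enum => /(_ isT)[].
Qed.

Lemma measurable_mx_borel {dT} {T : measurableType dT} m n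
    (f : T -> 'M[R]_(m, n)) :
  (forall i j, measurable_fun setT (fun w => f w i j)) ->
  measurable_fun setT (f : T -> borel 'M[R]_(m, n)).
Proof.
move=> mf; apply: (@measurability _ _ T (borel 'M[R]_(m, n)) setT f (@open 'M[R]_(m, n))) => //.
by move=> _ [U oU <-]; rewrite setTI; exact: measurable_mx_open.
Qed.


End borel_matrices.

Lemma borel_open (X : ptopologicalType) (U : set X) :
  open U -> measurable (U : set (borel X)).
Proof. by move=> oU; exact: sub_sigma_algebra. Qed.

Lemma borel_closed (X : ptopologicalType) (U : set X) :
  closed U -> measurable (U : set (borel X)).
Proof.
by move=> cU; rewrite -(setCK U); apply: measurableC; apply: borel_open;
  exact: closed_openC.
Qed.

Lemma measurable_borel {dT} {T : measurableType dT} (X : ptopologicalType)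
    (f : T -> X) :
  (forall U, open U -> measurable (f @^-1` U)) ->
  measurable_fun setT (f : T -> borel X).
Proof.
move=> mf; apply: (@measurability _ _ T (borel X) setT f (@open X)) => //.
by move=> _ [U oU <-]; rewrite setTI; exact: mf.
Qed.

Lemma continuous_borel_real {R : realType} (X : ptopologicalType) (f : X -> R) :
  continuous f -> measurable_fun setT (f : borel X -> R).
Proof.
move=> /continuousP cf.
apply: (measurability _ (RGenOpens.measurableE R)) => _ [_ [a [b ->]] <-].
rewrite setTI; apply: borel_open; apply: cf; exact: interval_open.
Qed.

Section euclidean_topology.
Context {R : realType} {d : nat}.
Implicit Types x y : 'rV[R]_d.

Lemma enormZ a x : enorm (a *: x) = `|a| * enorm x.
Proof.
rewrite /enorm -sqrtr_sqr -sqrtrM ?sqr_ge0// mulr_sumr.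
by congr Num.sqrt; apply: eq_bigr => i _; rewrite mxE exprMn.
Qed.

Lemma coord_le_enorm x i : `|x ord0 i| <= enorm x.
Proof.
rewrite -(@ler_pXn2r _ 2)// ?nnegrE ?enorm_ge0//.
rewrite enorm_sq real_normK ?num_real// (bigD1 i)//= lerDl.
by apply: sumr_ge0 => j _; exact: sqr_ge0.
Qed.

Lemma norm_le_enorm x : `|x| <= enorm x.
Proof.
rewrite [leLHS]/normr/= mx_normrE; apply/bigmax_leP; split=> [|[i j] _/=].
  exact: enorm_ge0.
by rewrite (ord1 i); exact: coord_le_enorm.
Qed.

Lemma enorm_dist_abs x y : `|enorm x - enorm y| <= enorm (x - y).
Proof.
rewrite ler_norml; apply/andP; split.
  rewrite lerNl opprB lerBlDr -(enormB y).
  by apply: le_trans (enorm_triangle _ _); rewrite subrK.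
by rewrite lerBlDr; apply: le_trans (enorm_triangle _ _); rewrite subrK.
Qed.

Lemma nbhs_enormP x (A : set 'rV[R]_d) : nbhs x A <->
  exists2 e : R, 0 < e & forall y, enorm (y - x) < e -> A y.
Proof.
split=> [/nbhs_ballP[e /= e0 eA]|[e e0 eA]].
  exists e => // y xy; apply: eA; rewrite -ball_normE /=.
  by apply: le_lt_trans xy; rewrite distrC; exact: norm_le_enorm.
have xx : id @ nbhs x --> x by exact: cvg_id.
by apply: filterS (cvg_enorm xx e0) => y; exact: eA.
Qed.

Lemma enorm_continuous : continuous (@enorm R d).
Proof.
move=> x A /nbhs_ballP[e /= e0 eA]; apply/nbhs_enormP; exists e => // y xy.
apply: eA; rewrite -ball_normE /=.
by apply: le_lt_trans (enorm_dist_abs _ _) _; rewrite enormB.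
Qed.

Lemma open_enorm_gt r : open [set x : 'rV[R]_d | r < enorm x].
Proof.
rewrite (_ : mkset _ = (@enorm R d) @^-1` [set y | r < y])//.
by move/continuousP: enorm_continuous; apply; exact: open_gt.
Qed.

Lemma enorm_gt0 x : x != 0 -> 0 < enorm x.
Proof.
move=> x0; rewrite lt_neqAle enorm_ge0 andbT eq_sym.
by apply: contra_neq x0 => /enorm_eq0.
Qed.

Lemma open_neq0 : open [set x : 'rV[R]_d | x != 0].
Proof.
rewrite (_ : mkset _ = [set x | 0 < enorm x]); first exact: open_enorm_gt.
apply/seteqP; split=> x /=; first exact: enorm_gt0.
by apply: contraTneq => ->; rewrite enorm0 ltxx.
Qed.

Lemma closed_enorm_ge r : closed [set x : 'rV[R]_d | r <= enorm x].
Proof.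
rewrite (_ : mkset _ = (@enorm R d) @^-1` [set y | r <= y])//.
by move/continuous_closedP: enorm_continuous; apply; exact: closed_ge.
Qed.

End euclidean_topology.

Section borel_vectors.
Context {R : realType}.

Lemma measurable_coord m n i j :
  measurable_fun setT (fun M : borel 'M[R]_(m, n) => (M : 'M[R]_(m, n)) i j).
Proof. apply: continuous_borel_real; exact: coord_continuous. Qed.

Lemma measurable_enorm d :
  measurable_fun setT (@enorm R d : borel 'rV[R]_d -> R).
Proof. by apply: continuous_borel_real; exact: enorm_continuous. Qed.

Context {dT} {T : measurableType dT} {d : nat}.
Implicit Types f g : T -> 'rV[R]_d.

Lemma measurable_coordE f : measurable_fun setT (f : T -> borel 'rV[R]_d) ->
  forall i j, measurable_fun setT (fun w => f w i j).
Proof.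
move=> mf i j.
exact: (measurableT_comp (measurable_coord i j) mf).
Qed.

Lemma measurable_vecD f g :
  measurable_fun setT (f : T -> borel 'rV[R]_d) ->
  measurable_fun setT (g : T -> borel 'rV[R]_d) ->
  measurable_fun setT ((fun w => f w + g w) : T -> borel 'rV[R]_d).
Proof.
move=> mf mg; apply: measurable_mx_borel => i j.
under eq_fun do rewrite mxE.
by apply: measurable_funD; exact: measurable_coordE.
Qed.

Lemma measurable_vecZ f a :
  measurable_fun setT (f : T -> borel 'rV[R]_d) ->
  measurable_fun setT ((fun w => a *: f w) : T -> borel 'rV[R]_d).
Proof.
move=> mf; apply: measurable_mx_borel => i j.
under eq_fun do rewrite mxE.
apply: measurable_funM; [exact: measurable_cst|exact: measurable_coordE].
Qed.

Lemma measurable_vec_sum (F : nat -> T -> 'rV[R]_d) (Q : pred nat) (s : seq nat) :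
  (forall k, Q k -> measurable_fun setT (F k : T -> borel 'rV[R]_d)) ->
  measurable_fun setT
    ((fun w => \sum_(k <- s | Q k) F k w) : T -> borel 'rV[R]_d).
Proof.
move=> mF; elim: s => [|a s ih].
  by under eq_fun do rewrite big_nil; exact: measurable_cst.
under eq_fun do rewrite big_cons.
by case: (boolP (Q a)) => // Qa; apply: measurable_vecD => //; exact: mF.
Qed.

End borel_vectors.

(** * Independence *)

Section independence.
Context {R : realType} {dT} {T : measurableType dT} (P : probability T R).
Context {dE} {E : measurableType dE} (X : nat -> T -> E).
Hypothesis mX : forall k, measurable_fun setT (X k).

Definition cylinders (N : nat) (J : pred nat) : set (set T) :=
  [set A | exists B : nat -> set E, [/\ forall i, measurable (B i),
    forall i, ~~ J i -> B i = setT &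
    A = \bigcap_(i in `I_N) X i @^-1` B i]].

Lemma measurable_preimage k (B : set E) : measurable B -> measurable (X k @^-1` B).
Proof. by move=> mB; rewrite -[_ @^-1` _]setTI; exact: mX. Qed.

Lemma cylinders_measurable N J A : cylinders N J A -> measurable A.
Proof.
move=> [B [mB _ ->]]; case: N => [|N]; first by rewrite II0 bigcap_set0.
by apply: bigcap_measurable => [|i _]; [exists 0|exact: measurable_preimage].
Qed.

Lemma setI_closed_cylinders N J : setI_closed (cylinders N J).
Proof.
move=> _ _ [B [mB JB ->]] [C [mC JC ->]]; exists (fun i => B i `&` C i).
split=> [i|i Ji|]; first exact: measurableI.
  by rewrite JB// JC// setIT.
by rewrite -bigcapI; apply: eq_bigcapr => i _; rewrite preimage_setI.
Qed.

Definition sub_space N J : Type := g_sigma_algebraType (cylinders N J).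
HB.instance Definition _ N J := Measurable.on (sub_space N J).

Lemma sub_spaceW N J (A : set (sub_space N J)) :
  measurable A -> measurable (A : set T).
Proof.
apply: smallest_sub; first exact: sigma_algebra_measurable.
exact: cylinders_measurable.
Qed.

Lemma measurable_sub_space N (J : pred nat) i : (i < N)%N -> J i ->
  measurable_fun setT (X i : sub_space N J -> E).
Proof.
move=> iN Ji _ B mB; rewrite setTI; apply: sub_sigma_algebra.
exists (fun j => if j == i then B else setT); split.
- by move=> j; case: ifP.
- by move=> j Jj; case: eqP Jj => // ->; rewrite Ji.
- apply/seteqP; split=> [w /= Bw j _|w /(_ i iN)].
    by rewrite /preimage/=; case: eqP => // ->.
  by rewrite /preimage/= eqxx.
Qed.

Hypothesis indX : independent_family P X.

Lemma prob_cylinder N (B : nat -> set E) : (forall i, measurable (B i)) ->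
  P (\bigcap_(i in `I_N) X i @^-1` B i) =
  (\prod_(0 <= i < N) P (X i @^-1` B i))%E.
Proof.
move=> mB; have := indX [fset i | i in iota 0 N]%fset mB.
rewrite (_ : [set` _] = `I_N); last first.
  by apply/seteqP; split=> i /=; rewrite !inE mem_iota.
move=> ->; rewrite (perm_big (iota 0 N)) ?/index_iota ?subn0//.
by apply: uniq_perm; rewrite ?iota_uniq ?fset_uniq// => i; rewrite !inE.
Qed.

Lemma prob_cylinderI N (J J' : pred nat) A B : (forall i, J i -> J' i -> False) ->
  cylinders N J A -> cylinders N J' B -> P (A `&` B) = (P A * P B)%E.
Proof.
move=> JJ' [C [mC JC ->]] [D [mD JD ->]].
rewrite -bigcapI; under eq_bigcapr do rewrite -preimage_setI.
rewrite !prob_cylinder//; last by move=> i; exact: measurableI.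
rewrite -big_split/=; apply: eq_bigr => i _.
have [Ji|Ji] := boolP (J i).
  rewrite (JD i) ?setIT ?preimage_setT ?probability_setT ?mule1//.
  by apply/negP => /(JJ' _ Ji).
by rewrite (JC i)// setTI preimage_setT probability_setT mul1e.
Qed.

Let indep_ext (G : set (set T)) (B : set T) : setI_closed G ->
  G `<=` measurable -> measurable B ->
  (forall A, G A -> P (A `&` B) = (P A * P B)%E) ->
  forall A, <<s G >> A -> P (A `&` B) = (P A * P B)%E.
Proof.
move=> GI mG mB GB.
have mS A : <<s G >> A -> measurable A.
  by apply: smallest_sub => //; exact: sigma_algebra_measurable.
apply: (@dynkin_induction _ (g_sigma_algebraType G) G) => //.
- by rewrite setTI probability_setT mul1e.
- move=> S /mS mSS PS; rewrite setIC -setDE measureD//; last first.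
    by rewrite -ge0_fin_numE ?fin_num_measure.
  transitivity (P B - P S * P B)%E.
    by congr (_ - _)%E; rewrite setIC; exact: PS.
  by rewrite probability_setC// muleBl ?mul1e// ?fin_num_measure.
- move=> F mF tF PF; rewrite setI_bigcupl.
  have mF' n : measurable (F n : set T) by apply: mS; exact: mF.
  rewrite measure_bigcup//=; last 2 first.
  + by move=> n _; exact: measurableI.
  + exact: trivIset_setIr.
  rewrite measure_bigcup//=.
  under eq_eseriesr do rewrite PF -(fineK (fin_num_measure P _ mB)) muleC.
  by rewrite nneseriesZl// muleC fineK ?fin_num_measure.
Qed.

Lemma indep_prob N (J J' : pred nat) (A : set (sub_space N J)) (B : set (sub_space N J')) :
  (forall i, J i -> J' i -> False) -> measurable A -> measurable B ->
  P (A `&` B) = (P A * P B)%E.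
Proof.
move=> JJ' mA mB; apply: (indep_ext _ _ _ _ mA).
- exact: setI_closed_cylinders.
- by move=> C; exact: cylinders_measurable.
- exact: sub_spaceW mB.
move=> {mA}A cA; rewrite setIC muleC; apply: (indep_ext _ _ _ _ mB).
- exact: setI_closed_cylinders.
- by move=> C; exact: cylinders_measurable.
- exact: cylinders_measurable cA.
- by move=> C cC; rewrite setIC muleC; exact: prob_cylinderI JJ' cA cC.
Qed.

End independence.

Section real_probability.
Context {R : realType} {dT} {T : measurableType dT} (P : probability T R).

Definition pr (A : set T) : R := fine (P A).

Lemma prE A : measurable A -> P A = (pr A)%:E.
Proof. by move=> mA; rewrite fineK ?fin_num_measure. Qed.

Lemma pr_ge0 A : 0 <= pr A.
Proof. exact/fine_ge0/measure_ge0. Qed.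

Lemma pr_le1 A : measurable A -> pr A <= 1.
Proof. by move=> mA; rewrite -lee_fin -prE//; exact: probability_le1. Qed.

Lemma le_pr A B : measurable A -> measurable B -> A `<=` B -> pr A <= pr B.
Proof. by move=> mA mB AB; rewrite -lee_fin -!prE// le_measure// inE. Qed.

Lemma prU_le A B : measurable A -> measurable B -> pr (A `|` B) <= pr A + pr B.
Proof.
move=> mA mB; have mU := measurableU _ _ mA mB.
by rewrite -lee_fin EFinD -!prE//; exact: measureU2.
Qed.

Lemma prC A : measurable A -> pr (~` A) = 1 - pr A.
Proof.
move=> mA; apply: EFin_inj; rewrite EFinB -!prE//; last exact: measurableC.
exact: probability_setC.
Qed.

Lemma pr_bigcup_le (A : nat -> set T) n : (forall i, measurable (A i)) ->
  pr (\big[setU/set0]_(i < n) A i) <= \sum_(i < n) pr (A i).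
Proof.
move=> mA; have mU k : measurable (\big[setU/set0]_(i < k) A i).
  by apply: bigsetU_measurable.
elim: n => [|n ih]; first by rewrite !big_ord0 /pr measure0.
rewrite !big_ord_recr/=; apply: le_trans (prU_le (mU n) (mA n)) _.
by rewrite lerD2r.
Qed.

Lemma pr_bigcup (A : nat -> set T) n : (forall i, measurable (A i)) ->
  trivIset setT A ->
  pr (\big[setU/set0]_(i < n) A i) = \sum_(i < n) pr (A i).
Proof.
move=> mA tA; apply: EFin_inj; rewrite -prE; last exact: bigsetU_measurable.
by rewrite measure_bigsetU// -sumEFin; apply: eq_bigr => i _; exact: prE.
Qed.

End real_probability.

Section indep_integral.
Context {R : realType} {dT} {T : measurableType dT} (P : probability T R).
Local Open Scope ereal_scope.

Lemma indep_integralM (U V : {mfun T >-> R}) :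
  (forall w, 0 <= U w)%R -> (forall w, 0 <= V w)%R ->
  (forall A B : set R, measurable A -> measurable B ->
    P (U @^-1` A `&` V @^-1` B) = P (U @^-1` A) * P (V @^-1` B)) ->
  \int[P]_w (U w * V w)%:E = \int[P]_w (U w)%:E * \int[P]_w (V w)%:E.
Proof.
move=> U0 V0 UV.
have mUV : measurable_fun setT (fun w => (U w, V w)) by exact: measurable_fun_pair.
pose W : {mfun T >-> (R * R)%type} := HB.pack (fun w => (U w, V w))
  (isMeasurableFun.Build _ _ _ _ _ mUV).
pose f (z : R * R) : \bar R := (`|z.1| * `|z.2|)%:E.
have mf : measurable_fun setT f.
  apply/measurable_EFinP; apply: measurable_funM.
    by apply: measurableT_comp; [exact: normr_measurable|exact: measurable_fst].
  by apply: measurableT_comp; [exact: normr_measurable|exact: measurable_snd].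
have f0 z : 0 <= f z by rewrite lee_fin mulr_ge0.
transitivity (\int[distribution P W]_z f z).
  rewrite ge0_integral_distribution//; apply: eq_integral => w _ /=.
  by rewrite /f/= !ger0_norm.
transitivity (\int[distribution P U \x distribution P V]_z f z).
  apply: eq_measure_integral => A mA _.
  apply/esym; exact: product_measure_unique.
transitivity (\int[distribution P U]_x fubini_F (distribution P V) f x).
  exact: fubini_tonelli1.
rewrite /fubini_F /f /=.
have mn : measurable_fun setT (fun y : R => `|y|%:E).
  by apply/measurable_EFinP; exact: normr_measurable.
under eq_integral do under eq_integral do rewrite EFinM.
under eq_integral.
  move=> x _; rewrite ge0_integralZl//.
  over.
rewrite ge0_integralZr//; last exact: integral_ge0.
congr (_ * _); rewrite ge0_integral_distribution//.
  by apply: eq_integral => w _ /=; rewrite ger0_norm.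
by apply: eq_integral => w _ /=; rewrite ger0_norm.
Qed.

End indep_integral.

Section iid_sums.
Context {R : realType} {dT} {T : measurableType dT} (P : probability T R).
Context {d : nat} (X : nat -> T -> borel 'rV[R]_d).
Hypothesis mX : forall k, measurable_fun setT (X k).
Hypothesis indX : independent_family P X.

Lemma measurable_block_sub N (J : pred nat) d' (f : 'rV[R]_d -> 'rV[R]_d') a b :
  measurable_fun setT (f : borel 'rV[R]_d -> borel 'rV[R]_d') ->
  (forall i, (a <= i < b)%N -> (i < N)%N /\ J i) ->
  measurable_fun setT
    ((fun w => \sum_(a <= i < b) f (X i w)) : sub_space X N J -> borel 'rV[R]_d').
Proof.
move=> mf ab; under eq_fun do rewrite big_nat_cond.
apply: (@measurable_vec_sum _ _ (sub_space X N J) _ (fun i w => f (X i w))).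
move=> i; rewrite andbT => /ab[iN Ji].
by apply: measurableT_comp => //; exact: measurable_sub_space.
Qed.

Lemma measurable_block d' (f : 'rV[R]_d -> 'rV[R]_d') a b :
  measurable_fun setT (f : borel 'rV[R]_d -> borel 'rV[R]_d') ->
  measurable_fun setT
    ((fun w => \sum_(a <= i < b) f (X i w)) : T -> borel 'rV[R]_d').
Proof.
move=> mf; apply: (@measurable_vec_sum _ _ T _ (fun i w => f (X i w))).
by move=> i _; exact: measurableT_comp.
Qed.

Lemma measurable_enorm_gt {dT'} {T' : measurableType dT'} d' (g : T' -> 'rV[R]_d') r :
  measurable_fun setT (g : T' -> borel 'rV[R]_d') ->
  measurable [set w | r < enorm (g w)].
Proof.
move=> mg; have := measurableT_comp (@measurable_enorm R d') mg.
move=> /(_ measurableT `]r, +oo[%classic (measurable_itv _)); rewrite setTI.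
by congr measurable; apply/seteqP; split=> w /=; rewrite in_itv/= andbT.
Qed.

Lemma ottaviani d' (f : 'rV[R]_d -> 'rV[R]_d') n (a : R) :
  measurable_fun setT (f : borel 'rV[R]_d -> borel 'rV[R]_d') ->
  let S k w := \sum_(1 <= i < k.+1) f (X i w) in
  (forall k, (k <= n)%N -> pr P [set w | a < enorm (S k w)] <= 4^-1) ->
  pr P [set w | exists2 k, (k <= n)%N & 3 * a < enorm (S k w)] <=
    2 * pr P [set w | a < enorm (S n w)].
Proof.
move=> mf S Sa.
have mS k : measurable_fun setT (S k : T -> borel _) by exact: measurable_block.
pose B k : set T := [set w | (k <= n)%N /\ 3 * a < enorm (S k w)].
pose A := seqDU B.
pose C k : set T := [set w | 2 * a < enorm (S n w - S k w)].
have SB k w : (k <= n)%N -> S n w - S k w = \sum_(k.+1 <= i < n.+1) f (X i w).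
  by move=> kn; rewrite /S (@big_cat_nat _ _ _ k.+1)//= addrAC subrr add0r.
have mBsub k j : (j <= k <= n)%N ->
    measurable (B j : set (sub_space X n.+1 [pred i | (i <= k)%N])).
  move=> /andP[jk kn]; rewrite /B (leq_trans jk kn).
  rewrite (_ : mkset _ = [set w | 3 * a < enorm (S j w)]); last first.
    by apply/seteqP; split=> w //= [].
  apply: measurable_enorm_gt; apply: measurable_block_sub => // i.
  move=> /andP[_ ij] /=; have {}ij : (i <= j)%N by [].
  by rewrite ltnS (leq_trans ij (leq_trans jk kn)) (leq_trans ij jk).
have mAsub k : (k <= n)%N ->
    measurable (A k : set (sub_space X n.+1 [pred i | (i <= k)%N])).
  move=> kn; rewrite /A /seqDU; apply: measurableD; first by apply: mBsub; rewrite leqnn.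
  apply: bigsetU_measurable => i _; apply: mBsub.
  by rewrite (ltnW (ltn_ord i)).
have mB k : measurable (B k).
  have [kn|kn] := leqP k n; last first.
    rewrite (_ : B k = set0)//; apply/seteqP; split=> w // -[].
    by rewrite leqNgt kn.
  by apply: sub_spaceW (mBsub k k _) => //; rewrite leqnn.
have mA k : measurable (A k).
  by rewrite /A /seqDU; apply: measurableD => //; exact: bigsetU_measurable.
have mC k : measurable (C k).
  rewrite /C; apply: measurable_enorm_gt.
  apply: measurable_vecD => //.
  rewrite (_ : (fun w => _) = (fun w => -1 *: S k w)); last first.
    by apply/funext => w; rewrite scaleN1r.
  exact: measurable_vecZ.
have mCsub k : (k <= n)%N ->
    measurable (~` C k : set (sub_space X n.+1 [pred i | (k < i)%N])).
  move=> kn; apply: measurableC; rewrite /C.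
  rewrite (_ : mkset _ =
      [set w | 2 * a < enorm (\sum_(k.+1 <= i < n.+1) f (X i w))]); last first.
    by apply/seteqP; split=> w /=; rewrite SB.
  apply: measurable_enorm_gt; apply: measurable_block_sub => // i.
  by move=> /andP[].
have mG k : measurable [set w | a < enorm (S k w)] by exact: measurable_enorm_gt.
have Ck k : (k <= n)%N -> 2^-1 <= pr P (~` C k).
  move=> kn; rewrite prC// lerBrDr addrC -lerBrDr.
  apply: (@le_trans _ _ (pr P [set w | a < enorm (S n w)] + pr P [set w | a < enorm (S k w)])).
    apply: le_trans (prU_le P (mG n) (mG k)); apply: le_pr => //.
      exact: measurableU.
    move=> w; rewrite /C /=; have [|SNa] := ltP a (enorm (S n w)); first by left.
    have [|SKa] := ltP a (enorm (S k w)); first by right.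
    move=> h; exfalso; have := enorm_triangle (S n w) (- S k w).
    by rewrite enormN; move: h SNa SKa; clear; lra.
  by have := Sa _ (leqnn n); have := Sa _ kn; clear; lra.
have mU : measurable (\big[setU/set0]_(k < n.+1) A k) by exact: bigsetU_measurable.
rewrite (_ : mkset _ = \big[setU/set0]_(k < n.+1) A k); last first.
  rewrite -bigsetU_seqDU -bigcup_mkord; apply/seteqP; split=> w /=.
    by move=> [k kn kS]; exists k => //=; rewrite ltnS.
  by move=> [k _ [kn kS]]; exists k.
rewrite pr_bigcup//; last exact: trivIset_seqDU.
rewrite -ler_pdivrMl//.
apply: (@le_trans _ _ (\sum_(k < n.+1) pr P (A k `&` ~` C k))).
  rewrite mulr_sumr; apply: ler_sum => k _.
  have kn : (k <= n)%N by rewrite -ltnS.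
  rewrite [leRHS]/pr (indep_prob mX indX _ (mAsub _ kn) (mCsub _ kn)).
    rewrite fineM ?fin_num_measure//; last exact: measurableC.
    by rewrite mulrC ler_wpM2l ?pr_ge0//; exact: Ck.
  by move=> i /= ik; rewrite ltnNge ik.
rewrite -(@pr_bigcup _ _ _ P (fun k => A k `&` ~` C k)); last 2 first.
- by move=> k; apply: measurableI => //; exact: measurableC.
- by apply: trivIset_setIr; exact: trivIset_seqDU.
apply: le_pr => //.
  by apply: bigsetU_measurable => k _; apply: measurableI => //; exact: measurableC.
rewrite -(bigcup_mkord _ (fun k => A k `&` ~` C k)) => w [k _ [[[kn Bk] _] /= /negP]]; rewrite -leNgt => nC.
have := enorm_triangle (S n w) (S k w - S n w); rewrite addrC subrK.
rewrite (enormB (S k w)); move: Bk nC; clear; lra.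
Qed.

End iid_sums.

(** * Bounded expectations and Chernoff's bound *)

Lemma expR_le2 {R : realType} (u : R) : expR u <= 1 + u + u ^+ 2 * expR `|u|.
Proof.
have e0 := expR_gt0 u; have h := expR_ge1Dx (- u).
have inv : expR u * expR (- u) = 1 by rewrite -expRD subrr expR0.
have hu : expR u - 1 <= u * expR u by move: e0 h inv; clear; move=> *; nra.
have [u0|u0] := leP 0 u; first by rewrite ger0_norm//; clear -u0 hu; nra.
rewrite ltr0_norm// in inv *.
have h1 : 1 <= expR (- u) by rewrite -[leLHS]expR0 ler_expR; lra.
have h3 : expR u * (1 - u) <= 1 by move: e0 h inv; clear; move=> *; nra.
have : expR u <= 1 + u + u ^+ 2.
  rewrite -(@ler_pM2r _ (1 - u)); last by lra.
  by apply: le_trans h3 _; clear -u0; nra.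
by move=> /le_trans; apply; rewrite lerD2l; clear -u0 h1; nra.
Qed.

Section bounded_expectation.
Context {R : realType} {dT} {T : measurableType dT} (P : probability T R).

Definition bounded_measurable (f : T -> R) :=
  measurable_fun setT f /\ exists M, forall w, `|f w| <= M.

Definition ex (f : T -> R) : R := \int[P]_w f w.

Lemma bm_integrable f : bounded_measurable f -> P.-integrable setT (EFin \o f).
Proof.
move=> [mf [M fM]]; apply: measurable_bounded_integrable => //.
  by apply: (@le_lt_trans _ _ 1%:E); [exact: probability_le1|exact: ltry].
exists M; split; first exact: num_real.
by move=> x Mx w _; apply: le_trans (fM w) _; exact: ltW.
Qed.

Lemma bm_cst a : bounded_measurable (fun=> a).
Proof. by split; [exact: measurable_cst|exists `|a|]. Qed.

Lemma bmD f g : bounded_measurable f -> bounded_measurable g ->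
  bounded_measurable (fun w => f w + g w).
Proof.
move=> [mf [M fM]] [mg [N gN]]; split; first exact: measurable_funD.
by exists (M + N) => w; apply: le_trans (ler_normD _ _) _; exact: lerD.
Qed.

Lemma bmM f g : bounded_measurable f -> bounded_measurable g ->
  bounded_measurable (fun w => f w * g w).
Proof.
move=> [mf [M fM]] [mg [N gN]]; split; first exact: measurable_funM.
by exists (M * N) => w; rewrite normrM; exact: ler_pM.
Qed.

Lemma bm_exp f : bounded_measurable f -> bounded_measurable (fun w => expR (f w)).
Proof.
move=> [mf [M fM]]; split.
  by apply: measurableT_comp => //; exact: measurable_expR.
exists (expR M) => w; rewrite ger0_norm ?expR_ge0// ler_expR.
by apply: le_trans (fM w); exact: ler_norm.
Qed.

Lemma bm_norm f : bounded_measurable f -> bounded_measurable (fun w => `|f w|).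
Proof.
move=> [mf [M fM]]; split; first exact: measurableT_comp.
by exists M => w; rewrite normr_id.
Qed.

Lemma bm_indic A : measurable A -> bounded_measurable (\1_A : T -> R).
Proof.
move=> mA; split; first exact: measurable_indic.
by exists 1 => w; rewrite indicE ger0_norm// lern1 leq_b1.
Qed.

Lemma ex_cst a : ex (fun=> a) = a.
Proof.
transitivity (a * fine (P setT)); first exact: Rintegral_cst.
by rewrite probability_setT mulr1.
Qed.

Lemma exD f g : bounded_measurable f -> bounded_measurable g ->
  ex (fun w => f w + g w) = ex f + ex g.
Proof. by move=> bf bg; apply: RintegralD => //; exact: bm_integrable. Qed.

Lemma exZ a f : bounded_measurable f -> ex (fun w => a * f w) = a * ex f.
Proof. by move=> bf; apply: RintegralZl => //; exact: bm_integrable. Qed.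

Lemma le_ex f g : bounded_measurable f -> bounded_measurable g ->
  (forall w, f w <= g w) -> ex f <= ex g.
Proof.
by move=> bf bg fg; apply: le_Rintegral => //; exact: bm_integrable.
Qed.

Lemma ex_ge0 f : (forall w, 0 <= f w) -> 0 <= ex f.
Proof. by move=> f0; exact: Rintegral_ge0. Qed.

Lemma ex_indic A : measurable A -> ex \1_A = pr P A.
Proof. by move=> mA; rewrite /ex /Rintegral integral_indic// setIT. Qed.

Lemma exE f : bounded_measurable f -> (\int[P]_w (f w)%:E)%E = (ex f)%:E.
Proof.
move=> bf; rewrite /ex /Rintegral fineK//.
exact: (integrable_fin_num _ (bm_integrable bf)).
Qed.

Lemma ex_markov f a : bounded_measurable f -> (forall w, 0 <= f w) -> 0 < a ->
  a * pr P [set w | a <= f w] <= ex f.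
Proof.
move=> bf f0 a0.
have := @le_integral_abse _ _ R P setT measurableT (EFin \o f) a.
have /= mf : measurable_fun setT (EFin \o f) by apply/measurable_EFinP; exact: bf.1.
move=> /(_ mf a0); rewrite setTI.
under eq_integral do rewrite ger0_norm//.
rewrite exE//.
rewrite (_ : [set x | _] = [set w | a <= f w]); last first.
  by apply/seteqP; split=> w /=; rewrite lee_fin ger0_norm.
rewrite prE ?lee_fin//.
rewrite (_ : mkset _ = f @^-1` `[a, +oo[); last first.
  by apply/seteqP; split=> w /=; rewrite in_itv/= andbT.
by rewrite -[X in measurable X]setTI; apply: bf.1.
Qed.

End bounded_expectation.

Section chernoff.
Context {R : realType} {dT} {T : measurableType dT} (P : probability T R).
Context {d : nat} (X : nat -> T -> borel 'rV[R]_d).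
Hypothesis mX : forall k, measurable_fun setT (X k).
Hypothesis indX : independent_family P X.
Hypothesis idX : identically_distributed P X.

Lemma ex_same_law (g : 'rV[R]_d -> R) i j :
  measurable_fun setT (g : borel 'rV[R]_d -> R) -> (forall x, 0 <= g x) ->
  ex P (fun w => g (X i w)) = ex P (fun w => g (X j w)).
Proof.
move=> mg g0; rewrite /ex /Rintegral; congr fine.
pose Y k : {mfun T >-> borel 'rV[R]_d} := HB.pack (X k)
  (isMeasurableFun.Build _ _ _ _ _ (mX k)).
have mg' : measurable_fun setT (EFin \o g : borel 'rV[R]_d -> \bar R).
  exact/measurable_EFinP.
have g0' (y : borel 'rV[R]_d) : (0 <= (EFin \o g) y)%E by rewrite lee_fin.
have h k := @ge0_integral_distribution _ _ _ _ _ P (Y k) _ mg' g0'.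
transitivity (\int[distribution P (Y i)]_y (g y)%:E)%E; first by rewrite h.
transitivity (\int[distribution P (Y j)]_y (g y)%:E)%E; last by rewrite h.
by apply: eq_measure_integral => A mA _; exact: idX.
Qed.

Lemma ex_expR_sum (g : 'rV[R]_d -> R) n :
  bounded_measurable (g : borel 'rV[R]_d -> R) ->
  ex P (fun w => expR (\sum_(1 <= i < n.+1) g (X i w))) =
  ex P (fun w => expR (g (X 0%N w))) ^+ n.
Proof.
move=> bg; have mg := bg.1.
have bgX k : bounded_measurable (fun w => g (X k w)).
  split; first exact: measurableT_comp.
  by have [M gM] := bg.2; exists M => w; exact: gM.
have bS k : bounded_measurable (fun w => \sum_(1 <= i < k.+1) g (X i w)).
  elim: k => [|k ih].
    by under eq_fun do rewrite big_geq//; exact: bm_cst.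
  by under eq_fun do rewrite big_nat_recr//=; exact: bmD.
elim: n => [|n ih].
  rewrite expr0 -[RHS](ex_cst P 1); congr ex.
  by apply/funext => w; rewrite big_geq// expR0.
have mS k : (k <= n)%N -> measurable_fun setT
    ((fun w => \sum_(1 <= i < k.+1) g (X i w)) :
      sub_space X n.+2 [pred i | (i <= n)%N] -> R).
  elim: k => [|k ihk] kn.
    apply: (@eq_measurable_fun _ _ (sub_space X n.+2 [pred i | (i <= n)%N]) R _ (fun=> 0)); last exact: measurable_cst.
    by move=> w _ /=; rewrite big_geq.
  apply: (@eq_measurable_fun _ _ (sub_space X n.+2 [pred i | (i <= n)%N]) R _
    (fun w => \sum_(1 <= i < k.+1) g (X i w) + g (X k.+1 w))).
    by move=> w _ /=; rewrite [RHS]big_nat_recr.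
  apply: measurable_funD; first by apply: ihk; exact: ltnW.
  apply: measurableT_comp => //; apply: measurable_sub_space => //.
  by rewrite !ltnS ltnW.
have mSn : measurable_fun setT
    ((fun w => expR (\sum_(1 <= i < n.+1) g (X i w))) :
      sub_space X n.+2 [pred i | (i <= n)%N] -> R).
  by apply: measurableT_comp; [exact: measurable_expR|exact: mS].
have mXn : measurable_fun setT
    ((fun w => expR (g (X n.+1 w))) :
      sub_space X n.+2 [pred i | (n < i)%N] -> R).
  apply: measurableT_comp; first exact: measurable_expR.
  by apply: measurableT_comp => //; apply: measurable_sub_space => //=.
pose U : {mfun T >-> R} := HB.pack (fun w => expR (\sum_(1 <= i < n.+1) g (X i w)))
  (isMeasurableFun.Build _ _ _ _ _ (bm_exp (bS n)).1).
pose V : {mfun T >-> R} := HB.pack (fun w => expR (g (X n.+1 w)))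
  (isMeasurableFun.Build _ _ _ _ _ (bm_exp (bgX n.+1)).1).
have UV : ex P (fun w => U w * V w) = ex P U * ex P V.
  apply: EFin_inj; rewrite -exE; last by apply: bmM; exact: bm_exp.
  rewrite EFinM -!exE; [|exact: bm_exp|exact: bm_exp].
  apply: indep_integralM => [w|w|A B mA mB]; rewrite ?expR_ge0//.
  apply: (@indep_prob _ _ _ P _ _ X mX indX n.+2
    [pred i | (i <= n)%N] [pred i | (n < i)%N]).
  - by move=> i /= h1 h2; move: (leq_ltn_trans h1 h2); rewrite ltnn.
  - by have := mSn measurableT A mA; rewrite setTI; exact.
  - by have := mXn measurableT B mB; rewrite setTI; exact.
transitivity (ex P (fun w => U w * V w)).
  by congr ex; apply/funext => w; rewrite big_nat_recr//= expRD.
rewrite UV ih exprSr; congr (_ * _).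
apply: (@ex_same_law (fun x => expR (g x))) => [|x]; last exact: expR_ge0.
by apply: measurableT_comp => //; exact: measurable_expR.
Qed.

Lemma chernoff_sum (g : 'rV[R]_d -> R) n x :
  bounded_measurable (g : borel 'rV[R]_d -> R) ->
  pr P [set w | x <= \sum_(1 <= i < n.+1) g (X i w)] <=
  expR (n%:R * (ex P (fun w => g (X 0%N w)) +
                ex P (fun w => g (X 0%N w) ^+ 2 * expR `|g (X 0%N w)|)) - x).
Proof.
move=> bg; have mg := bg.1.
have bgX k : bounded_measurable (fun w => g (X k w)).
  split; first exact: measurableT_comp.
  by have [M gM] := bg.2; exists M => w; exact: gM.
have bS k : bounded_measurable (fun w => \sum_(1 <= i < k.+1) g (X i w)).
  elim: k => [|k ih].
    by under eq_fun do rewrite big_geq//; exact: bm_cst.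
  by under eq_fun do rewrite big_nat_recr//=; exact: bmD.
rewrite addrC expRD expRN -ler_pdivrMl ?invr_gt0 ?expR_gt0// invrK.
apply: (@le_trans _ _ (ex P (fun w => expR (\sum_(1 <= i < n.+1) g (X i w))))).
  have := @ex_markov _ _ _ P _ (expR x) (bm_exp (bS n)) (fun w => expR_ge0 _) (expR_gt0 x).
  by congr (_ * pr P _ <= _); apply/seteqP; split=> w /=; rewrite ler_expR.
rewrite ex_expR_sum// expRM_natl.
rewrite lerXn2r ?nnegrE ?expR_ge0//; first by apply: ex_ge0 => w; exact: expR_ge0.
have b2 : bounded_measurable (fun w => g (X 0%N w) ^+ 2 * expR `|g (X 0%N w)|).
  apply: bmM; last by apply: bm_exp; exact: bm_norm.
  by under eq_fun do rewrite expr2; exact: bmM.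
apply: le_trans (expR_ge1Dx _); rewrite -(ex_cst P 1).
rewrite -exD// -exD//; [|exact: bm_cst|exact: bmD].
apply: le_ex => [||w]; first exact: bm_exp.
  by apply: bmD; [exact: bm_cst|exact: bmD].
by rewrite addrA; exact: expR_le2.
Qed.

End chernoff.

(** * The punctured space *)

Lemma compact_pullback (X Y : topologicalType) (h : X -> Y) (g : Y -> X)
    (K : set Y) (A : set X) : compact K ->
  (forall x, A x -> K (h x)) -> (forall c, K c -> A (g c)) ->
  (forall c B, K c -> nbhs (g c) B ->
    exists2 V, nbhs c V & forall x, A x -> V (h x) -> B x) ->
  compact A.
Proof.
move=> cK hA gA hg F FF FA.
have [|c [Kc clc]] := cK (h @ F) (fmap_proper_filter h FF).
  by apply: (@filterS _ F _ A (h @^-1` K) hA).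
exists (g c); split; first exact: gA.
move=> C B FC /(hg _ _ Kc)[V nV VB].
have [|_ [[x [Cx Ax] <-] Vx]] := clc (h @` (C `&` A)) V _ nV.
  by apply: (@filterS _ F _ (C `&` A)) (filterI FC FA) => x CAx; exists x.
by exists x; split => //; exact: VB.
Qed.

Lemma compact_ereal (R : realType) : compact [set: \bar R].
Proof.
apply: (@compact_pullback _ _ (@contract R) (@expand R) _ _ (@segment_compact R (-1) 1)).
- by move=> x _; rewrite /= in_itv/= -ler_norml contract_le1.
- by [].
move=> c B /=; rewrite in_itv/= -ler_norml => c1 /nbhs_ballP[e /= e0 eB].
exists (ball c e); first exact: nbhsx_ballx.
move=> x _; rewrite /ball/= => cx; apply: eB; rewrite /ball/= /ereal_ball.
by rewrite expandK.
Qed.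

Section punctured.
Context {R : realType} {d : nat}.
Local Notation E := (punctured_space R d).

Definition retract (y : E) : 'rV[R]_d.+1 := map_mx fine (coords y).

Definition embed (A : set 'rV[R]_d.+1) : set E :=
  [set y | ~ infinite_points y /\ A (retract y)].

Definition far_set (r : R) : set E :=
  [set y | exists i, (r%:E <= `|coords y ord0 i|)%E].

Definition mk_punctured (v : 'rV[\bar R]_d.+1) (v0 : v != const_mx 0%E) : E :=
  exist (fun x => x \in [set x : 'rV[\bar R]_d.+1 | x != const_mx 0%E]) v
    (mem_set (v0 : [set x : 'rV[\bar R]_d.+1 | x != const_mx 0%E] v)).

Lemma retractK (y : E) : ~ infinite_points y ->
  coords y = map_mx EFin (retract y).
Proof.
move=> fy; apply/matrixP => i j; rewrite !mxE (ord1 i) fineK//.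
by apply/negPn/negP => yj; apply: fy; exists j.
Qed.

Lemma coords_inj : injective (@coords R d).
Proof. exact: val_inj. Qed.

Lemma EFin_finite (y : E) (x : 'rV[R]_d.+1) : coords y = map_mx EFin x ->
  ~ infinite_points y /\ retract y = x.
Proof.
move=> yx; split; first by move=> [i]; rewrite yx mxE.
by apply/matrixP => i j; rewrite mxE yx mxE.
Qed.

Lemma lift_nonzero (x : 'rV[R]_d.+1) : x != 0 ->
  exists y : E, coords y = map_mx EFin x.
Proof.
move=> x0.
have h : map_mx EFin x != const_mx 0%E.
  apply/eqP => /matrixP hx; case/eqP: x0.
  by apply/matrixP => i j; have := hx i j; rewrite !mxE => -[].
by exists (mk_punctured h).
Qed.

Lemma retract_neq0 (y : E) : ~ infinite_points y -> retract y != 0.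
Proof.
move=> fy; apply/eqP => y0; have := valP y; rewrite inE /= => /eqP; apply.
rewrite -/(coords y) (retractK fy) y0.
by apply/matrixP => i j; rewrite !mxE.
Qed.

Lemma finite_part_embed (A : set 'rV[R]_d.+1) : ~ A 0 -> finite_part (embed A) = A.
Proof.
move=> A0; apply/seteqP; split=> [x [y [fy Ay] yx]|x Ax].
  by rewrite -(EFin_finite yx).2.
have [|y yx] := @lift_nonzero x; first by apply/eqP => x0; move: Ax; rewrite x0.
by have [fy yE] := EFin_finite yx; exists y => //; split => //; rewrite yE.
Qed.

Lemma nbhs_coords (y : E) (V : set 'rV[\bar R]_d.+1) :
  nbhs (coords y) V -> nbhs y [set z | V (coords z)].
Proof.
move=> nV; exact: (@initial_continuous E 'rV[\bar R]_d.+1 coords y V nV).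
Qed.

Lemma nbhs_embed (y : E) (V : set 'rV[R]_d.+1) : ~ infinite_points y ->
  nbhs (retract y) V -> nbhs y (embed V).
Proof.
move=> fy [Q nQ QV].
pose W : set 'rV[\bar R]_d.+1 := [set v | forall i, v ord0 i \is a fin_num /\
  Q ord0 i (fine (v ord0 i))].
have : nbhs (coords y) W.
  exists (fun i j => [set t : \bar R | t \is a fin_num /\ Q i j (fine t)]).
    move=> i j; rewrite (retractK fy) mxE; have := nQ i j.
    rewrite /= => h; apply: (@filterS _ (nbhs (retract y i j)) _ (Q i j)) h.
    by move=> t Qt; split.
  by move=> v hv i; exact: hv.
move=> /nbhs_coords; apply: filterS => z Wz; split.
  by move=> [i]; rewrite (Wz i).1.
by apply: QV => i j; rewrite mxE (ord1 i); exact: (Wz j).2.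
Qed.

Lemma continuous_coord_ereal i :
  continuous (fun y : E => coords y ord0 i).
Proof.
move=> y A nA; apply: (@nbhs_coords _ [set v | A (v ord0 i)]).
exists (fun _ j => if j == i then A else setT).
  by move=> k j; rewrite (ord1 k); case: eqP => [->//|_]; exact: filterT.
by move=> v /(_ ord0 i); rewrite eqxx.
Qed.

Lemma measurable_coord_ereal i :
  measurable_fun setT ((fun y => coords y ord0 i) : borel E -> \bar R).
Proof.
apply: (measurability _ (ErealGenOInfty.measurableE R)) => _ [_ [x ->] <-].
rewrite setTI; apply: borel_open.
have /continuousP := @continuous_coord_ereal i; apply.
by rewrite set_itvoy; exact: open_ereal_gt_ereal.
Qed.

Lemma measurable_retract :
  measurable_fun setT (retract : borel E -> borel 'rV[R]_d.+1).
Proof.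
apply: measurable_mx_borel => i j; rewrite (ord1 i).
under eq_fun do rewrite mxE.
by apply: measurableT_comp; [exact: fine_measurable|exact: measurable_coord_ereal].
Qed.

Lemma measurable_infinite : measurable (infinite_points : set (borel E)).
Proof.
rewrite (_ : infinite_points = \big[setU/set0]_(i < d.+1)
    (setT `&` (fun y : E => coords y ord0 i) @^-1` [set -oo; +oo]%E)).
  apply: bigsetU_measurable => i _; apply: measurable_coord_ereal => //.
  by apply: measurableU; exact: emeasurable_set1.
apply/seteqP; split=> y; rewrite -bigcup_seq => -[i].
  move=> yi; exists i; first by rewrite /= mem_index_enum.
  by split => //=; case: (coords y ord0 i) yi => [||]//; [right|left].
move=> _ [_ /= yi]; exists i; by case: yi => ->.
Qed.

Lemma measurable_embed (A : set 'rV[R]_d.+1) :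
  measurable (A : set (borel _)) -> measurable (embed A : set (borel E)).
Proof.
move=> mA; apply: measurableI; first by apply: measurableC; exact: measurable_infinite.
by rewrite -[X in measurable X]setTI; apply: measurable_retract.
Qed.

Lemma boundary_embed (A : set 'rV[R]_d.+1) :
  boundary (embed A) `<=` infinite_points `|` embed (boundary A).
Proof.
move=> y [cy iy]; have [|fy] := pselect (infinite_points y); first by left.
right; split => //; split.
  move=> V nV; have [z [[_ Az] [_ Vz]]] := cy _ (nbhs_embed fy nV).
  by exists (retract z).
move=> iA; apply: iy; apply: nbhs_embed => //.
Qed.

Lemma compact_far_set r : 0 < r -> compact (far_set r).
Proof.
move=> r0.
pose K : set 'rV[\bar R]_d.+1 := [set v | exists i, (r%:E <= `|v ord0 i|)%E].
have cT : compact [set: 'rV[\bar R]_d.+1].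
  have := @rV_compact (\bar R) d.+1 (fun=> setT) (fun=> @compact_ereal R).
  by congr compact; apply/seteqP; split.
have cK : compact K.
  apply: (subclosed_compact _ cT) => //.
  rewrite (_ : K = \bigcup_i [set v | (r%:E <= `|v ord0 i|)%E]).
    apply: closed_bigcup => [|i _]; first exact: finite_finset.
    have cc : continuous (fun v : 'rV[\bar R]_d.+1 => `|v ord0 i|)%E.
      move=> v; apply: (@continuous_comp _ _ _ (fun v : 'rV[\bar R]_d.+1 => v ord0 i) abse).
        move=> A nA; exists (fun _ j => if j == i then A else setT).
          by move=> k j; rewrite (ord1 k); case: eqP => [->//|_]; exact: filterT.
        by move=> w /(_ ord0 i); rewrite eqxx.
      exact: abse_continuous.
    exact: ((continuous_closedP _).1 cc _ (@closed_ereal_le_ereal R r%:E)).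
  by apply/seteqP; split=> v [i]; exists i.
have K0 v : K v -> v != const_mx 0%E.
  move=> [i ri]; apply/eqP => v0; move: ri.
  by rewrite v0 mxE abse0 lee_fin leNgt r0.
pose g (v : 'rV[\bar R]_d.+1) : E := if pselect (K v) is left Kv then
  mk_punctured (K0 v Kv) else point.
have gK v : K v -> coords (g v) = v by rewrite /g; case: pselect.
apply: (@compact_pullback _ _ (@coords R d) g _ _ cK) => //.
  by move=> c Kc; rewrite /far_set /= gK.
move=> c B Kc; rewrite nbhsE => -[U [oU Uc] UB].
have [V oV VU] := oU; exists V.
  by apply: open_nbhs_nbhs; split => //; rewrite -(gK c Kc); move: Uc; rewrite -VU.
by move=> x _ Vx; apply: UB; rewrite -VU.
Qed.

Lemma closed_far_set r : closed (far_set r).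
Proof.
rewrite (_ : far_set r = \bigcup_i [set y | (r%:E <= `|coords y ord0 i|)%E]).
  apply: closed_bigcup => [|i _]; first exact: finite_finset.
  have cc : continuous (fun y : E => `|coords y ord0 i|)%E.
    move=> y; apply: (@continuous_comp _ _ _ (fun y : E => coords y ord0 i) abse).
      exact: continuous_coord_ereal.
    exact: abse_continuous.
  exact: ((continuous_closedP _).1 cc _ (@closed_ereal_le_ereal R r%:E)).
by apply/seteqP; split=> v [i]; exists i.
Qed.

Lemma embed_far r : 0 < r -> exists2 r', 0 < r' &
  embed [set x | r < enorm x] `<=` far_set r'.
Proof.
move=> r0; have s0 : 0 < Num.sqrt (d.+1%:R : R) by rewrite sqrtr_gt0 ltr0n.
exists (r / Num.sqrt d.+1%:R); first by rewrite divr_gt0.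
move=> y [fy /= ry]; apply: contrapT => nfar.
suff : enorm (retract y) <= r by rewrite leNgt ry.
apply: le_trans (enorm_le_norm _) _; rewrite mulrC -ler_pdivlMr//.
rewrite [leLHS]/normr/= mx_normrE; apply/bigmax_leP; split=> [|[i j] _/=].
  by rewrite ltW// divr_gt0.
rewrite (ord1 i) leNgt; apply/negP => h; apply: nfar; exists j.
by rewrite (retractK fy) mxE lee_fin ltW.
Qed.

Lemma precompact_embed r (A : set 'rV[R]_d.+1) : 0 < r ->
  A `<=` [set x | r < enorm x] -> precompact (embed A).
Proof.
move=> r0 Ar; have [r' r'0 rr'] := embed_far r0.
apply: (@precompact_subset _ _ (far_set r')).
  by move=> y [fy Ay]; apply: rr'; split => //; exact: Ar.
by rewrite precompact_closed; [exact: compact_far_set|exact: closed_far_set].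
Qed.

End punctured.

Section level_sets.
Context {R : realType} {dX} {X : measurableType dX} (mu : {measure set X -> \bar R}).

Lemma exists_null_level (f : X -> R) (a b : R) : measurable_fun setT f ->
  (mu [set x | (a < f x)%R] < +oo)%E -> a < b ->
  exists2 c, a < c < b & mu [set x | f x = c] = 0%E.
Proof.
move=> mf fin ab; apply: contrapT => noc.
pose L c : set X := [set x | f x = c].
have mL c : measurable (L c).
  rewrite (_ : L c = f @^-1` [set c])//.
  by rewrite -[X in measurable X]setTI; apply: mf.
have mI : measurable [set x | (a < f x)%R].
  rewrite (_ : mkset _ = f @^-1` `]a, +oo[); last first.
    by apply/seteqP; split=> x /=; rewrite in_itv/= andbT.
  by rewrite -[X in measurable X]setTI; apply: mf.
pose A (k : nat) : set R := [set c | a < c < b /\ ((k.+1%:R^-1)%:E <= mu (L c))%E].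
have fA k : finite_set (A k).
  apply: contrapT => infA.
  pose M := fine (mu [set x | (a < f x)%R]).
  have [B BA nB] := infinite_set_fset (Num.truncn (M * k.+1%:R)).+1 infA.
  have tL : trivIset [set` B] L.
    by move=> i j _ _ [x [fi fj]]; rewrite -(fi : f x = i) -(fj : f x = j).
  have : (mu (\big[setU/set0]_(c <- B) L c) <= mu [set x | (a < f x)%R])%E.
    apply: le_measure; rewrite ?inE//.
      by apply: bigsetU_measurable => c _.
    by rewrite -bigcup_fset => x [c /= /BA[/andP[ac _] _]]; rewrite /L /= => ->.
  rewrite measure_fbigsetU//; apply/negP; rewrite -ltNge.
  apply: (@lt_le_trans _ _ (\sum_(c <- B) (k.+1%:R^-1)%:E)%E); last first.
    rewrite big_seq [leRHS]big_seq; apply: lee_sum => c cB.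
    by have [_] := BA c cB.
  rewrite sumEFin -(@fineK _ (mu [set x | (a < f x)%R])) ?ge0_fin_numE//.
  rewrite lte_fin -/M big_const_seq count_predT iter_addr_0 -[ltRHS]mulr_natr.
  have k0 : (0 : R) < k.+1%:R by rewrite ltr0n.
  rewrite [ltRHS]mulrC ltr_pdivlMr//.
  by apply: lt_le_trans (truncnS_gt _) _; rewrite ler_nat.
have cA : countable (\bigcup_k A k).
  by apply: bigcup_countable => // k _; exact: finite_set_countable.
have : (lebesgue_measure `]a, b[%classic <= @lebesgue_measure R (\bigcup_k A k))%E.
  apply: le_outer_measure => c /=; rewrite in_itv/= => cab.
  have Lc0 : (0 < mu (L c))%E.
    rewrite lt_neqAle measure_ge0 andbT eq_sym; apply/eqP => L0; apply: noc.
    by exists c.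
  have Lfin : mu (L c) \is a fin_num.
    rewrite ge0_fin_numE//; apply: le_lt_trans fin; apply: le_measure; rewrite ?inE//.
    by move=> x /= ->; case/andP: cab.
  exists (Num.truncn (fine (mu (L c)))^-1) => //; split=> //.
  rewrite -(fineK Lfin) lee_fin invf_ple ?posrE ?ltr0n ?fine_gt0 ?Lc0 ?ltey_eq ?Lfin//.
  exact/ltW/truncnS_gt.
rewrite [leRHS]countable_lebesgue_measure0// lebesgue_measure_itv/= lte_fin ab.
by rewrite lee_fin leNgt subr_gt0 ab.
Qed.

End level_sets.

Section distance.
Context {R : realType} {d : nat}.
Implicit Types (x y : 'rV[R]_d) (C : set 'rV[R]_d).

Definition edist_to C x : R := inf [set enorm (x - z) | z in C].

Lemma edist_to_le C x z : C z -> edist_to C x <= enorm (x - z).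
Proof.
move=> Cz; apply: ge_inf; last by exists z.
by exists 0 => _ [u _ <-]; exact: enorm_ge0.
Qed.

Lemma edist_to_lip C x y : C !=set0 -> edist_to C x <= enorm (x - y) + edist_to C y.
Proof.
move=> C0; rewrite -lerBlDl; apply: lb_le_inf.
  by have [z Cz] := C0; exists (enorm (y - z)), z.
move=> _ [z Cz <-]; rewrite lerBlDl.
by apply: le_trans (enorm_distD y _ _); exact: edist_to_le.
Qed.

Lemma edist_to_continuous C : C !=set0 -> continuous (edist_to C).
Proof.
move=> C0 x A /nbhs_ballP[e /= e0 eA]; apply/nbhs_enormP; exists e => // y xy.
apply: eA; rewrite -ball_normE /=; apply: le_lt_trans xy.
have h1 := edist_to_lip x y C0; have h2 := edist_to_lip y x C0.
rewrite (enormB x) in h1; rewrite ler_norml.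
by move: h1 h2; clear; move=> *; apply/andP; split; lra.
Qed.

Lemma edist_to_gt0 (U : set 'rV[R]_d) x : ~` U !=set0 -> open U ->
  (0 < edist_to (~` U) x) = `[< U x >].
Proof.
move=> C0 oU; apply/idP/asboolP => [h|Ux].
  apply: contrapT => nU; have := edist_to_le x (nU : (~` U) x).
  by rewrite subrr enorm0 leNgt h.
have /nbhs_enormP[e e0 eU] := open_nbhs_nbhs (conj oU Ux : open_nbhs x U).
apply: lt_le_trans e0 _; apply: lb_le_inf.
  by have [z Cz] := C0; exists (enorm (x - z)), z.
move=> _ [z nUz <-]; rewrite leNgt enormB; apply/negP => /eU; exact: nUz.
Qed.

End distance.

(* [pushforward] with the measurability of the map as an argument, so that the
   measure structure can be inferred. *)
Section image_measure.
Context {R : realType} {d1 d2} {X : measurableType d1} {Y : measurableType d2}.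
Variables (mu : {measure set X -> \bar R}) (f : X -> Y).

Definition image_measure of measurable_fun setT f : set Y -> \bar R :=
  fun A => mu (f @^-1` A).

Variable mf : measurable_fun setT f.

Let mpre A : measurable A -> measurable (f @^-1` A).
Proof. by move=> mA; rewrite -[X in measurable X]setTI; exact: mf. Qed.

Let image0 : image_measure mf set0 = 0%E.
Proof. by rewrite /image_measure preimage_set0 measure0. Qed.

Let image_ge0 A : (0 <= image_measure mf A)%E.
Proof. exact: measure_ge0. Qed.

Let image_sigma_additive : semi_sigma_additive (image_measure mf).
Proof.
move=> F mF tF mUF; rewrite /image_measure preimage_bigcup.
apply: measure_semi_sigma_additive => [n||]; first exact: mpre.
  apply/trivIsetP => i j _ _ ij; rewrite -preimage_setI.
  by move/trivIsetP : tF => /(_ _ _ _ _ ij) ->//; rewrite preimage_set0.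
by rewrite -preimage_bigcup; exact: mpre.
Qed.

HB.instance Definition _ := isMeasure.Build _ _ _ (image_measure mf)
  image0 image_ge0 image_sigma_additive.

End image_measure.

Section limit_measure.
Context {R : realType} {d : nat}.
Local Notation E := (punctured_space R d).
Local Notation V := 'rV[R]_d.+1.
Variable mu : {measure set (borel E) -> \bar R}.

Definition flat : {measure set (borel V) -> \bar R} :=
  image_measure mu (@measurable_retract R d).

Lemma flatE A : flat A = mu (retract @^-1` A).
Proof. by []. Qed.

Hypothesis mu_infinite : mu infinite_points = 0%E.

Lemma mu_finite (B : set (borel E)) : measurable B ->
  mu (B `\` infinite_points) = mu B.
Proof.
move=> mB; rewrite [RHS](measureDI _ mB measurable_infinite).
rewrite [X in (_ + X)%E](_ : _ = 0%E) ?adde0//.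
apply/eqP; rewrite eq_le measure_ge0 andbT -mu_infinite.
apply: le_measure; rewrite ?inE//; first by apply: measurableI => //; exact: measurable_infinite.
by apply: measurable_infinite.
Qed.

Lemma mu_embed (A : set (borel V)) : measurable A -> mu (embed A) = flat A.
Proof.
move=> mA; rewrite flatE -[RHS]mu_finite; last first.
  by rewrite -[X in measurable X]setTI; apply: measurable_retract.
by congr (mu _); apply/seteqP; split=> y [].
Qed.

Lemma measurable_finite_part (B : set (borel E)) : measurable B ->
  measurable (finite_part B : set (borel V)).
Proof.
have finC (C : set E) : finite_part (~` C) = [set x | x != 0] `\` finite_part C.
  apply/seteqP; split=> [x [y nCy yx]|x [/= x0 nx]].
    have [fy yE] := EFin_finite yx; split.
      by rewrite /= -yE; exact: retract_neq0.
    by move=> [z Cz zx]; apply: nCy; rewrite (coords_inj (etrans yx (esym zx))).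
  by have [y yx] := lift_nonzero x0; exists y => // Cy; apply: nx; exists y.
have open0 := @open_neq0 R d.+1.
pose G := [set B : set E | measurable (finite_part B : set (borel V))].
suff : <<s open >> `<=` G by move=> h mB; exact: h.
apply: smallest_sub.
  split=> [|A GA|F GF]; rewrite /G /=.
  - rewrite (_ : finite_part set0 = set0)//.
    by apply/seteqP; split=> x // -[].
  - rewrite setTD finC; apply: measurableD => //; exact: borel_open.
  - rewrite (_ : finite_part _ = \bigcup_k finite_part (F k)).
      exact: bigcupT_measurable.
    apply/seteqP; split=> [x [y [k _ Fy] yx]|x [k _ [y Fy yx]]].
      by exists k => //; exists y.
    by exists y => //; exists k.
move=> U oU; rewrite /G /=; apply: borel_open.
rewrite openE => x [y Uy yx]; have [fy yE] := EFin_finite yx.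
have : nbhs y U by exact: open_nbhs_nbhs.
rewrite nbhsE => -[_ [[W oW <-] Wy] WU].
have [Q nQ QW] : nbhs (coords y) W by exact: open_nbhs_nbhs.
have h1 : nbhs x [set z : V | W (map_mx EFin z)].
  exists (fun i j => [set t : R | Q i j t%:E]).
    by move=> i j; have := nQ i j; rewrite yx mxE.
  by move=> z hz; apply: QW => i j; rewrite mxE; exact: hz.
have h2 : nbhs x [set z : V | z != 0].
  by apply: open_nbhs_nbhs; split => //; rewrite /= -yE; exact: retract_neq0.
apply: filterS2 h1 h2 => z Wz z0; have [y' y'z] := lift_nonzero z0.
by exists y' => //; apply: WU; change (W (coords y')); rewrite y'z.
Qed.

Lemma muE (B : set (borel E)) : measurable B -> mu B = flat (finite_part B).
Proof.
move=> mB; rewrite -mu_finite// -mu_embed; last exact: measurable_finite_part.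
congr (mu _); apply/seteqP; split=> y [h1 h2]; split=> //.
  by exists y => //; exact: retractK.
move: h2 => [z Bz zy]; rewrite (_ : y = z)//; apply: coords_inj.
by rewrite zy retractK.
Qed.

End limit_measure.

(** * Regular variation *)

Lemma ratio_bound {R : realFieldType} (x u b : R) : 0 < u -> 0 < b -> b <= 1 ->
  x * (1 - b / 2) < u -> u < x * (1 + b / 2) -> 0 < x /\ `|x - u| < b * u.
Proof.
move=> u0 b0 b1 h1 h2; have x0 : 0 < x by nra.
split=> //; rewrite ltr_norml; apply/andP; split; last by nra.
have : x < 2 * u by nra.
by nra.
Qed.

Section regular_variation_limits.
Context {R : realType} {d : nat} {dT} {T : measurableType dT}.
Variables (P : probability T R) (Z : T -> borel 'rV[R]_d.+1).
Local Notation E := (punctured_space R d).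
Local Notation V := 'rV[R]_d.+1.
Hypothesis mZ : measurable_fun setT Z.
Variables (mu : {measure set (borel E) -> \bar R}) (alpha : R).
Hypothesis alpha0 : 0 < alpha.
Hypothesis mu_radon : radon mu.
Hypothesis mu_infinite : mu infinite_points = 0%E.
Hypothesis mu_dilate : forall (u : R) (B : set E), 0 < u -> <<s open >> B ->
  mu (dilate u B) = ((u `^ (- alpha))%:E * mu B)%E.

Let nu := flat mu.

Lemma borel_enorm_gt r : measurable ([set x | r < enorm x] : set (borel V)).
Proof. by apply: borel_open; exact: open_enorm_gt. Qed.

Lemma flat_far_fin r : 0 < r -> (nu [set x | (r < enorm x)%R] < +oo)%E.
Proof.
move=> r0; rewrite -mu_embed//; last exact: borel_enorm_gt.
have [r' r'0 rr'] := @embed_far R d r r0.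
apply: le_lt_trans (mu_radon (compact_far_set r'0)).
apply: le_measure; rewrite ?inE//.
  by apply: measurable_embed; exact: borel_enorm_gt.
by apply: borel_closed; exact: closed_far_set.
Qed.

Lemma flat_homogeneous u (A : set (borel V)) : 0 < u -> measurable A -> ~ A 0 ->
  nu [set x | A (u^-1 *: x)] = ((u `^ (- alpha))%:E * nu A)%E.
Proof.
move=> u0 mA A0.
have mA' : measurable ([set x : V | A (u^-1 *: x)] : set (borel V)).
  have := @measurable_vecZ R _ (borel V) _ id u^-1 (@measurable_id _ _ _).
  by move=> /(_ measurableT A mA); rewrite setTI.
rewrite -!mu_embed// -mu_dilate//; last exact: measurable_embed.
congr (mu _); apply/seteqP; split=> [y [fy /= Ay]|y [x [fx Ax] yx]].
  have [|x xE] := @lift_nonzero _ _ (u^-1 *: retract y).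
    by rewrite scaler_eq0 invr_eq0 gt_eqF//= retract_neq0.
  have [fx rx] := EFin_finite xE.
  exists x; first by split => //; rewrite rx.
  rewrite xE (retractK fy); apply/matrixP => i j; rewrite !mxE.
  by rewrite -EFinM mulVKf ?gt_eqF.
have yE : coords y = map_mx EFin (u *: retract x).
  by rewrite yx (retractK fx); apply/matrixP => i j; rewrite !mxE.
have [fy ry] := EFin_finite yE.
by split => //=; rewrite ry scalerA mulVf ?gt_eqF// scale1r.
Qed.

Lemma flat_sphere r : 0 < r -> nu [set x | enorm x = r] = 0%E.
Proof.
move=> r0; have [] := @exists_null_level R _ (borel V) nu (@enorm R d.+1) 1 2.
- exact: measurable_enorm.
- by apply: flat_far_fin.
- by rewrite ltr1n.
move=> c /andP[c1 _] nc; have c0 : 0 < c by apply: lt_trans c1.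
have mS : measurable ([set x | enorm x = c] : set (borel V)).
  rewrite (_ : mkset _ = (@enorm R d.+1) @^-1` [set c])//.
  by rewrite -[X in measurable X]setTI; apply: measurable_enorm.
have u0 : 0 < r / c by rewrite divr_gt0.
have := flat_homogeneous u0 mS; rewrite /= enorm0 nc mule0 => <-; last first.
  by move/eqP; rewrite lt_eqF.
congr (nu _); apply/seteqP; split=> x /=; rewrite enormZ gtr0_norm ?invr_gt0// invf_div.
  by move=> ->; rewrite divfK ?gt_eqF.
move=> h; apply: (@mulfI _ (c / r)); first by rewrite gt_eqF// divr_gt0.
by rewrite h divfK ?gt_eqF.
Qed.

Lemma flat_far r : 0 < r ->
  nu [set x | r < enorm x] = ((r `^ (- alpha))%:E * nu [set x | (1 < enorm x)%R])%E.
Proof.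
move=> r0; rewrite -flat_homogeneous//; last 2 first.
- exact: borel_enorm_gt.
- by rewrite /= enorm0 ltr10.
congr (nu _); apply/seteqP; split=> x /=; rewrite enormZ gtr0_norm ?invr_gt0//.
  by rewrite mulrC ltr_pdivlMr// mul1r.
by rewrite mulrC ltr_pdivlMr// mul1r.
Qed.

Variable a : nat -> R.
Hypothesis a_oo : a @ \oo --> +oo.
Hypothesis tail_a : (n%:R%:E * tail_prob P Z (a n))%E @[n --> \oo] --> 1%:E.
Hypothesis vague_a : vague_cvg (fun n B =>
  (n%:R%:E * P [set w | finite_part B ((a n)^-1 *: Z w)%R])%E) mu.

Let G u := pr P [set w | u < enorm (Z w)].

Lemma measurable_scaled_event (A : set (borel V)) u : measurable A ->
  measurable [set w | A (u *: Z w)].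
Proof.
move=> mA; have := measurable_vecZ u mZ.
by move=> /(_ measurableT A mA); rewrite setTI.
Qed.

Lemma measurable_tail u : measurable [set w | u < enorm (Z w)].
Proof. exact: measurable_enorm_gt. Qed.

Lemma vague_flat r (A : set (borel V)) : 0 < r -> measurable A ->
  A `<=` [set x | r < enorm x] -> nu (boundary (A : set V)) = 0%E ->
  (n%:R%:E * P [set w | A ((a n)^-1 *: Z w)%R])%E @[n --> \oo] --> nu A.
Proof.
move=> r0 mA Ar bA.
have A0 : ~ A 0 by move=> /Ar /=; rewrite enorm0 ltNge ltW.
have mB : measurable (boundary (A : set V) : set (borel V)).
  apply: measurableD; first by (apply: borel_closed; exact: closed_closure).
  by apply: borel_open; exact: open_interior.
have mB' : measurable (boundary (embed A) : set (borel E)).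
  apply: measurableD; first by (apply: borel_closed; exact: closed_closure).
  by apply: borel_open; exact: open_interior.
have := @vague_a (embed A) (measurable_embed mA) (precompact_embed r0 Ar).
rewrite mu_embed// finite_part_embed//; apply.
apply/eqP; rewrite eq_le measure_ge0 andbT.
apply: (@le_trans _ _ (mu (infinite_points `|` embed (boundary (A : set V))))).
  apply: le_measure; rewrite ?inE//; last exact: boundary_embed.
  by apply: measurableU; [exact: measurable_infinite|exact: measurable_embed].
apply: (@le_trans _ _ (mu infinite_points + mu (embed (boundary (A : set V))))%E).
  by apply: measureU2; [exact: measurable_infinite|exact: measurable_embed].
by rewrite mu_infinite mu_embed// -/nu bA adde0.
Qed.

Lemma boundary_far r : boundary [set x : V | r < enorm x] `<=` [set x | enorm x = r].
Proof.
move=> x [cx ix]; apply/eqP; rewrite eq_le; apply/andP; split.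
  rewrite leNgt; apply/negP => rx; apply: ix.
  by apply: open_nbhs_nbhs; split => //; exact: open_enorm_gt.
have : closure [set x : V | r <= enorm x] x by apply: closure_subset cx => y /ltW.
by rewrite -(closure_id _).1//; exact: closed_enorm_ge.
Qed.

Lemma tail_cvg r : 0 < r ->
  (n%:R%:E * P [set w | r < enorm ((a n)^-1 *: Z w)]%R)%E @[n --> \oo] -->
  nu [set x | r < enorm x].
Proof.
move=> r0; apply: (@vague_flat r) => //; first exact: borel_enorm_gt.
apply/eqP; rewrite eq_le measure_ge0 andbT -(flat_sphere r0).
apply: le_measure; rewrite ?inE//; last exact: boundary_far.
  apply: measurableD; first by (apply: borel_closed; exact: closed_closure).
  by apply: borel_open; exact: open_interior.
rewrite (_ : mkset _ = (@enorm R d.+1) @^-1` [set r])//.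
by rewrite -[X in measurable X]setTI; apply: measurable_enorm.
Qed.

Let a_gt0 : \forall n \near \oo, 0 < a n.
Proof. by move/cvgryPgt : a_oo; exact. Qed.

Let tail_scale r : 0 < r -> \forall n \near \oo,
  P [set w | r < enorm ((a n)^-1 *: Z w)]%R = (G (r * a n))%:E.
Proof.
move=> r0; near=> n; have an0 : 0 < a n by near: n.
rewrite /G -prE; last exact: measurable_tail.
congr (P _); apply/seteqP; split=> w /=; rewrite enormZ gtr0_norm ?invr_gt0//;
  by rewrite (_ : (r < _ * _) = (r * a n < enorm (Z w)))// mulrC ltr_pdivlMr.
Unshelve. all: by end_near. Qed.

Lemma flat_far1 : nu [set x | (1 < enorm x)%R] = 1%E.
Proof.
have h : (n%:R%:E * P [set w | 1 < enorm ((a n)^-1 *: Z w)]%R)%E @[n --> \oo] --> 1%:E.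
  apply: cvg_trans tail_a; apply: near_eq_cvg; near=> n.
  rewrite (near (tail_scale ltr01) n)// mul1r -prE//.
  exact: measurable_tail.
have <- := cvg_lim (@ereal_hausdorff R) h.
by have -> := cvg_lim (@ereal_hausdorff R) (tail_cvg ltr01).
Unshelve. all: by end_near. Qed.

Lemma flat_farE r : 0 < r -> nu [set x | r < enorm x] = (r `^ (- alpha))%:E.
Proof. by move=> r0; rewrite flat_far// flat_far1 mule1. Qed.

Lemma tail_cvgr r : 0 < r -> n%:R * G (r * a n) @[n --> \oo] --> r `^ (- alpha).
Proof.
move=> r0; have := tail_cvg r0; rewrite flat_farE// => h.
have : (n%:R * G (r * a n))%:E @[n --> \oo] --> (r `^ (- alpha))%:E.
  apply: cvg_trans h; apply: near_eq_cvg; near=> n.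
  by rewrite EFinM (near (tail_scale r0) n).
by move=> /fine_cvg.
Unshelve. all: by end_near. Qed.

Lemma portmanteau_open r (O : set V) c : 0 < r -> open O ->
  O `<=` [set x | r < enorm x] -> (c%:E < nu O)%E ->
  \forall n \near \oo, c < n%:R * pr P [set w | O ((a n)^-1 *: Z w)].
Proof.
move=> r0 oO Or cO.
have O0 : ~ O 0 by move=> /Or /=; rewrite enorm0 ltNge ltW.
have CO : ~` O !=set0 by exists 0.
pose f := edist_to (~` O); have cf : continuous f := edist_to_continuous CO.
have f0 x : (0 < f x) = `[< O x >] by exact: edist_to_gt0.
have oA t : open [set x | t < f x].
  by move/continuousP: cf => cf; apply: (cf [set y | t < y]); exact: open_gt.
have mA t : measurable ([set x | t < f x] : set (borel V)) by exact: borel_open.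
have mf : measurable_fun setT (f : borel V -> R) by exact: continuous_borel_real.
have OE : O = \bigcup_k [set x | k.+1%:R^-1 < f x].
  apply/seteqP; split=> x.
    move=> Ox; have fx : 0 < f x by rewrite f0; apply/asboolP.
    exists (Num.truncn (f x)^-1) => //=.
    by rewrite invf_plt ?posrE//; exact: truncnS_gt.
  move=> [k _ /= kf]; apply/asboolP; rewrite -f0; apply: lt_trans kf.
  by rewrite invr_gt0 ltr0n.
have [k ck] : exists k : nat, (c%:E < nu [set x | (k.+1%:R^-1 < f x)%R])%E.
  have h : nu [set x | (k.+1%:R^-1 < f x)%R] @[k --> \oo] --> nu O.
    rewrite OE; apply: nondecreasing_cvg_mu => //.
      by rewrite -OE; exact: borel_open.
    apply/nondecreasing_seqP => n; apply/subsetPset => x /=.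
    apply: le_lt_trans; rewrite lef_pV2 ?posrE ?ltr0n// ler_nat.
    by [].
  have [k _ hk] := h _ (open_nbhs_nbhs (conj (@open_ereal_gt_ereal R c%:E) cO)).
  by exists k; exact: (hk k (leqnn k)).
have k0 : (0 : R) < k.+1%:R^-1 by rewrite invr_gt0 ltr0n.
have [] := @exists_null_level R _ (borel V) nu f 0 k.+1%:R^-1 mf _ k0.
  rewrite (_ : mkset _ = O); last first.
    by apply/seteqP; split=> x /=; rewrite f0 => /asboolP.
  apply: le_lt_trans (flat_far_fin r0); apply: le_measure; rewrite ?inE//.
    exact: borel_open.
  exact: borel_enorm_gt.
move=> t /andP[t0 tk] nt.
have AO : [set x | t < f x] `<=` O.
  by move=> x /= tx; apply/asboolP; rewrite -f0; exact: lt_trans tx.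
have := @vague_flat r [set x | t < f x] r0 (mA t) (subset_trans AO Or).
have -> : nu (boundary [set x | t < f x]) = 0%E.
  apply/eqP; rewrite eq_le measure_ge0 andbT -nt.
  apply: le_measure; rewrite ?inE.
  - apply: measurableD; first by apply: borel_closed; exact: closed_closure.
    by apply: borel_open; exact: open_interior.
  - rewrite (_ : mkset _ = f @^-1` [set t])//.
    by rewrite -[X in measurable X]setTI; apply: mf.
  - move=> x [cx ix]; apply/eqP; rewrite eq_le; apply/andP; split.
      by rewrite leNgt; apply/negP => tx; apply: ix; apply: open_nbhs_nbhs; split.
    have : closure [set x : V | t <= f x] x by apply: closure_subset cx => y /ltW.
    rewrite -(closure_id _).1//.
    by move/continuous_closedP: cf => cf; apply: (cf [set y | t <= y]); exact: closed_ge.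
move=> /(_ erefl) h.
have ct : (c%:E < nu [set x | (t < f x)%R])%E.
  apply: lt_le_trans ck _; apply: le_measure; rewrite ?inE// => x /=.
  exact: lt_trans.
have [N NT hN] := h _ (open_nbhs_nbhs (conj (@open_ereal_gt_ereal R c%:E) ct)).
exists N => // n /hN /=; rewrite prE; last exact: (measurable_scaled_event _ (mA t)).
rewrite -EFinM lte_fin => /lt_le_trans; apply; rewrite ler_wpM2l//.
apply: le_pr => [||w /AO//]; first exact: (measurable_scaled_event _ (mA t)).
exact: (measurable_scaled_event _ (borel_open oO)).
Qed.

Lemma tail_ge0 u : 0 <= G u. Proof. exact: pr_ge0. Qed.

Lemma le_tail u v : u <= v -> G v <= G u.
Proof.
by move=> uv; apply: le_pr => [||w /=]; [exact: measurable_tail..|exact: le_lt_trans].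
Qed.

Let tail_a1 : n%:R * G (a n) @[n --> \oo] --> (1 : R).
Proof.
have := tail_cvgr ltr01; rewrite powR1.
by under eq_fun do rewrite mul1r.
Qed.

Lemma tail_gt0 u : 0 < G u.
Proof.
near \oo => n.
have an : u <= a n by near: n; move/cvgryPge : a_oo; exact.
have h : 0 < n%:R * G (a n).
  by near: n; exact: (cvgr_gt _ tail_a1 _ ltr01).
apply: lt_le_trans (le_tail an); rewrite lt_neqAle tail_ge0 andbT eq_sym.
by apply/eqP => G0; move: h; rewrite G0 mulr0 ltxx.
Unshelve. all: by end_near. Qed.

Lemma tail_cvg0 e : 0 < e -> \forall u \near +oo, G u < e.
Proof.
move=> e0; near \oo => n.
have h : n%:R * G (a n) < 2 by near: n; apply: (cvgr_lt _ tail_a1 2); rewrite ltr1n.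
have n0 : 2 / e < n%:R by near: n; exact: nbhs_infty_gtr.
near=> u; apply: le_lt_trans (@le_tail (a n) u _) _.
  by near: u; apply: nbhs_pinfty_ge; exact: num_real.
have n1 : (0 : R) < n%:R by apply: lt_trans n0; rewrite divr_gt0.
rewrite -(ltr_pM2l n1); apply: lt_trans h _.
by rewrite -ltr_pdivrMr.
Unshelve. all: by end_near. Qed.

(* Since n P(|Z| > a n) -> 1, the index n = [idx u] satisfies a n ~ u. *)
Let idx u := Num.truncn (G u)^-1.

Let idx_le u : (idx u)%:R * G u <= 1.
Proof.
rewrite -ler_pdivlMr ?tail_gt0// div1r truncn_le.
by rewrite ltW// invr_gt0 tail_gt0.
Qed.

Let idx_oo N : \forall u \near +oo, (N <= idx u)%N.
Proof.
have N0 : (0 : R) < N.+1%:R by rewrite ltr0n.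
near=> u; rewrite truncn_ge_nat ?invr_ge0 ?tail_ge0//.
have : G u < N.+1%:R^-1 by near: u; apply: tail_cvg0; rewrite invr_gt0.
rewrite -{1}(invrK (G u)) ltf_pV2 ?posrE ?invr_gt0 ?tail_gt0// => /ltW.
by apply: le_trans; rewrite ler_nat.
Unshelve. all: by end_near. Qed.

Let level_ratio e : 0 < e < 1 -> \forall u \near +oo,
  a (idx u) * (1 - e) < u < a (idx u) * (1 + e).
Proof.
move=> /andP[e0 e1].
have x0 : 0 < 1 + e by lra.
have y0 : 0 < 1 - e by lra.
have one : 1 `^ alpha = 1 :> R by rewrite powR1.
have x1 : (1 + e) `^ (- alpha) < 1.
  rewrite powRN invf_lt1 ?powR_gt0// -{1}one.
  by apply: gt0_ltr_powR; rewrite ?nnegrE//; lra.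
have y1 : 1 < (1 - e) `^ (- alpha).
  rewrite powRN invf_gt1 ?powR_gt0// -[ltRHS]one.
  by apply: gt0_ltr_powR; rewrite ?nnegrE//; lra.
pose q := (1 + (1 + e) `^ (- alpha)) / 2.
have q1 : q < 1 by rewrite /q; lra.
have hq : (1 + e) `^ (- alpha) < q by rewrite /q; lra.
have [N _ hN] : \forall n \near \oo, n%:R * G ((1 + e) * a n) < q /\
    1 < n%:R * G ((1 - e) * a n).
  near=> n; split; near: n.
    exact: (cvgr_lt _ (tail_cvgr x0) _ hq).
  exact: (cvgr_gt _ (tail_cvgr y0) _ y1).
near=> u; have Nu : (N.+1 <= idx u)%N by near: u; exact: idx_oo.
have [h1 h2] := hN _ (ltnW Nu).
have Gu0 := tail_gt0 u; have le1 := idx_le u.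
have Guq : G u < 1 - q by near: u; apply: tail_cvg0; rewrite subr_gt0.
have nR0 : (0 : R) < (idx u)%:R by rewrite ltr0n (leq_trans _ Nu).
have ge1 : 1 < ((idx u)%:R + 1) * G u.
  rewrite -ltr_pdivrMr// div1r natr1; exact: truncnS_gt.
rewrite mulrC; apply/andP; split; rewrite ltNge; apply/negP => /le_tail.
  rewrite -(ler_pM2l nR0); move: h2 le1; lra.
rewrite mulrC -(ler_pM2l nR0); move: h1 ge1 Guq; lra.
Unshelve. all: by end_near. Qed.

Lemma rv_open r (O : set V) c : 0 < r -> open O ->
  O `<=` [set x | r < enorm x] -> (c%:E < nu O)%E ->
  \forall u \near +oo, c * G u <= pr P [set w | O (u^-1 *: Z w)].
Proof.
move=> r0 oO Or cO.
have [c0|c0] := leP c 0.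
  near=> u; apply: (@le_trans _ _ 0); last exact: pr_ge0.
  by rewrite mulr_le0_ge0// tail_ge0.
pose O' (k : nat) : set V := interior
  [set y | forall s, `|s - 1| < k.+1%:R^-1 -> O (s *: y)].
have oO' k : open (O' k) by exact: open_interior.
have O'O k : O' k `<=` O.
  move=> y /interior_subset /(_ 1); rewrite subrr normr0 scale1r; apply.
  by rewrite invr_gt0 ltr0n.
have OE : O = \bigcup_k O' k.
  apply/seteqP; split=> [y Oy|y [k _ /O'O//]].
  have /nbhs_enormP[e e0 eO] := open_nbhs_nbhs (conj oO Oy : open_nbhs y O).
  have M0 : 0 < enorm y + 1 by rewrite ltr_wpDl ?enorm_ge0.
  pose k := Num.truncn (4 * (enorm y + 1) / e + 1).
  have kS : 4 * (enorm y + 1) / e + 1 < k.+1%:R := truncnS_gt _.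
  have t1 : 4 * (enorm y + 1) / e < k.+1%:R by lra.
  have e4 : 0 < 4 * (enorm y + 1) / e by rewrite divr_gt0// mulr_gt0.
  have k1 : (1 : R) <= k.+1%:R by rewrite ler1n.
  have ki : k.+1%:R^-1 * (enorm y + 1) < e / 4.
    rewrite mulrC ltr_pdivrMr ?ltr0n// -ltr_pdivrMl ?divr_gt0//.
    by rewrite invf_div; move: t1; rewrite mulrAC; lra.
  have kd : k.+1%:R^-1 <= (1 : R) by rewrite invf_le1 ?ltr0n.
  exists k => //; apply/nbhs_enormP.
  exists (Num.min (e / 4) 1); first by rewrite lt_min ltr01 divr_gt0.
  move=> z; rewrite lt_min => /andP[ze z1] s hs; apply: eO.
  have -> : s *: z - y = (s - 1) *: z + (z - y).
    by rewrite scalerBl scale1r addrA subrK.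
  apply: le_lt_trans (enorm_triangle _ _) _; rewrite enormZ.
  have zM : enorm z <= enorm y + 1.
    rewrite -(subrK y z); apply: le_trans (enorm_triangle _ _) _.
    by rewrite addrC lerD2l ltW.
  have : `|s - 1| * enorm z <= k.+1%:R^-1 * (enorm y + 1).
    by apply: ler_pM => //; [exact: enorm_ge0|exact: ltW].
  move: ki ze e0; move: (k.+1%:R^-1) => b; lra.
have [k ck] : exists k : nat, (c%:E < nu (O' k))%E.
  have h : nu (O' k) @[k --> \oo] --> nu O.
    rewrite OE; apply: nondecreasing_cvg_mu => [i||].
    - by apply: borel_open.
    - by rewrite -OE; exact: borel_open.
    - apply/nondecreasing_seqP => n; apply/subsetPset; apply: interiorS => y h s hs.
      apply: h; apply: lt_le_trans hs _; rewrite lef_pV2 ?posrE ?ltr0n// ler_nat.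
      by [].
  have [k _ hk] := h _ (open_nbhs_nbhs (conj (@open_ereal_gt_ereal R c%:E) cO)).
  by exists k; exact: (hk k (leqnn k)).
have [N _ hN] := portmanteau_open r0 (oO' k) (subset_trans (O'O k) Or) ck.
have d0 : (0 : R) < k.+1%:R^-1 by rewrite invr_gt0 ltr0n.
have d1 : k.+1%:R^-1 <= (1 : R) by rewrite invf_le1 ?ltr0n// ler1n.
near=> u.
have u0 : 0 < u by near: u; apply: nbhs_pinfty_gt; exact: num_real.
have Nu : (N.+1 <= idx u)%N by near: u; exact: idx_oo.
have nR0 : (0 : R) < (idx u)%:R by rewrite ltr0n (leq_trans _ Nu).
have /andP[ua au] : a (idx u) * (1 - k.+1%:R^-1 / 2) < u < a (idx u) * (1 + k.+1%:R^-1 / 2).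
  near: u; apply: level_ratio; rewrite divr_gt0//= ltr_pdivrMr// mul1r.
  by apply: le_lt_trans d1 _; rewrite ltr1n.
have := hN _ (ltnW Nu); rewrite /= => hc.
apply: (@le_trans _ _ (pr P [set w | O' k ((a (idx u))^-1 *: Z w)])).
  have Gu0 := tail_gt0 u; have le1 := idx_le u.
  rewrite -(ler_pM2l nR0); apply: le_trans (ltW hc).
  by rewrite mulrCA ler_piMr// ltW.
have mO' := measurable_scaled_event (a (idx u))^-1 (borel_open (oO' k)).
have mO := measurable_scaled_event u^-1 (borel_open oO).
apply: le_pr => // w /= /interior_subset /(_ (a (idx u) / u)).
have [a0 hu] := ratio_bound u0 d0 d1 ua au.
rewrite scalerA mulrAC divff ?gt_eqF// mul1r; apply.
have -> : a (idx u) / u - 1 = (a (idx u) - u) / u.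
  by rewrite mulrBl divff ?gt_eqF.
by rewrite normrM [X in _ * X]gtr0_norm ?invr_gt0// ltr_pdivrMr.
Unshelve. all: by end_near. Qed.

End regular_variation_limits.

Lemma near_pinftyP {R : realType} (Q : set R) : (\forall u \near +oo, Q u) <->
  exists2 M, 0 < M & forall u, M <= u -> Q u.
Proof.
split=> [[M [_ MQ]]|[M M0 MQ]].
  exists (`|M| + 1); first by have := normr_ge0 M; lra.
  by move=> u Mu; apply: MQ; apply: lt_le_trans Mu; rewrite ltr_pwDr// ler_norm.
by exists M; split; [exact: num_real|move=> u /ltW; exact: MQ].
Qed.

Section regularly_varying_tail.
Context {R : realType} {d : nat} {dT} {T : measurableType dT}.
Variables (P : probability T R) (Z : T -> borel 'rV[R]_d.+1).
Hypothesis mZ : measurable_fun setT Z.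
Variables (mu : {measure set (borel (punctured_space R d)) -> \bar R}) (alpha : R).
Hypothesis alpha0 : 0 < alpha.
Hypothesis rv : regularly_varying P Z alpha mu.

Let G u := pr P [set w | u < enorm (Z w)].

Lemma rv_flat_far r : 0 < r -> flat mu [set x | r < enorm x] = (r `^ (- alpha))%:E.
Proof.
have [_ mr mi [a [_ _ aoo ta va]] md] := rv.
by move=> r0; exact: (flat_farE mZ mr mi md aoo ta va).
Qed.

Lemma rv_tail_gt0 u : 0 < G u.
Proof.
have [_ mr mi [a [_ _ aoo ta va]] md] := rv.
exact: (tail_gt0 mZ mr mi md aoo ta va).
Qed.

Lemma rv_open_ge r (O : set 'rV[R]_d.+1) c : 0 < r -> open O ->
  O `<=` [set x | r < enorm x] -> (c%:E < flat mu O)%E ->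
  \forall u \near +oo, c * G u <= pr P [set w | O (u^-1 *: Z w)].
Proof.
have [_ mr mi [a [_ _ aoo ta va]] md] := rv.
exact: (rv_open mZ alpha0 mr mi md aoo ta va).
Qed.

Lemma rv_tail_ge x c : 0 < x -> c < x `^ (- alpha) ->
  \forall u \near +oo, c * G u <= G (x * u).
Proof.
move=> x0 cx; near=> u.
have u0 : 0 < u by near: u; apply: nbhs_pinfty_gt; exact: num_real.
rewrite [leRHS](_ : _ = pr P [set w | [set y | x < enorm y] (u^-1 *: Z w)]).
  near: u; apply: (@rv_open_ge x) => //; first exact: open_enorm_gt.
  by rewrite rv_flat_far// lte_fin.
congr pr; apply/seteqP; split=> w /=; rewrite enormZ gtr0_norm ?invr_gt0//;
  by rewrite (_ : (x < _^-1 * _) = (x * u < enorm (Z w)))// mulrC ltr_pdivlMr.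
Unshelve. all: by end_near. Qed.

Lemma rv_tail_le x c : 0 < x -> x `^ (- alpha) < c ->
  \forall u \near +oo, G (x * u) <= c * G u.
Proof.
move=> x0 xc; have c0 : 0 < c by apply: lt_trans xc; exact: powR_gt0.
have h : c^-1 < x^-1 `^ (- alpha).
  rewrite -(powR_inv1 (ltW x0)) powRAC powR_inv1 ?powR_ge0//.
  by rewrite ltf_pV2 ?posrE// powR_gt0.
have xi0 : 0 < x^-1 by rewrite invr_gt0.
have /near_pinftyP[M M0 hM] := rv_tail_ge xi0 h.
apply/near_pinftyP; exists (M / x); first by rewrite divr_gt0.
move=> u Mu; have Mxu : M <= x * u by rewrite mulrC -ler_pdivrMr.
by have := hM _ Mxu; rewrite mulKf ?gt_eqF// ler_pdivrMl.
Qed.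

End regularly_varying_tail.

(** * Truncated moments *)

Lemma doubling_ind {R : realType} (Q : R -> Prop) u0 : 0 < u0 ->
  (forall u, u0 <= u <= 2 * u0 -> Q u) ->
  (forall u, u0 <= u -> Q u -> Q (2 * u)) -> forall u, u0 <= u -> Q u.
Proof.
move=> u00 base step u u0u.
have [n] : exists n : nat, u <= u0 * 2 ^+ n.
  exists (Num.truncn (u / u0)).
  rewrite mulrC -ler_pdivrMr//; apply: le_trans (ltW (truncnS_gt _)) _.
  by rewrite -natrX ler_nat ltn_expl.
elim: n u u0u => [|n ih] u u0u hu.
  by apply: base; rewrite u0u /=; move: hu; rewrite expr0 mulr1; lra.
have [u2|u2] := leP u (2 * u0); first by apply: base; rewrite u0u.
rewrite (_ : u = 2 * (u / 2)); last by field.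
apply: step; first by lra.
apply: ih; first by lra.
by rewrite ler_pdivrMr// -mulrA -exprSr.
Qed.

Lemma le_powR {R : realType} (p x y : R) : 0 <= p -> 0 <= x -> x <= y ->
  x `^ p <= y `^ p.
Proof.
move=> p0 x0 xy; apply: ge0_ler_powR; rewrite ?nnegrE//.
exact: le_trans xy.
Qed.

Section truncated_moments.
Context {R : realType} {dT} {T : measurableType dT} (P : probability T R).
Variables (Y : T -> R).
Hypothesis mY : measurable_fun setT Y.
Hypothesis Y0 : forall w, 0 <= Y w.

Let G u := pr P [set w | u < Y w].

Lemma measurable_gt_event u : measurable [set w | u < Y w].
Proof.
rewrite (_ : mkset _ = Y @^-1` `]u, +oo[); last first.
  by apply/seteqP; split=> x /=; rewrite in_itv/= andbT.
by rewrite -[X in measurable X]setTI; apply: mY.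
Qed.

Lemma indicE_le u w : (\1_(~` [set w | u < Y w]) w : R) = (Y w <= u)%R%:R.
Proof. by rewrite indicE in_setC; congr (_%:R); rewrite leNgt mem_setE. Qed.

Lemma indicE_gt u w : (\1_[set w | u < Y w] w : R) = (u < Y w)%R%:R.
Proof. by rewrite indicE; congr ((nat_of_bool _)%:R); apply/idP/idP; rewrite inE. Qed.

Lemma bm_trunc (g : R -> R) u M : measurable_fun setT g ->
  (forall y, 0 <= y <= u -> `|g y| <= M) ->
  bounded_measurable (fun w => g (Y w) * (Y w <= u)%R%:R).
Proof.
move=> mg gM; split.
  apply: measurable_funM; first exact: measurableT_comp.
  rewrite (_ : (fun w => _) = \1_(~` [set w | u < Y w])).
    by apply: measurable_indic; apply: measurableC; exact: measurable_gt_event.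
  by apply/funext => w; rewrite indicE_le.
exists `|M| => w; case: (leP (Y w) u) => Yu.
  by rewrite mulr1; apply: le_trans (ler_norm _); apply: gM; rewrite Y0.
by rewrite mulr0 normr0.
Qed.

Definition tmoment p u := ex P (fun w => Y w `^ p * (Y w <= u)%R%:R).

Lemma bm_tmoment p u : 0 <= p -> bounded_measurable (fun w => Y w `^ p * (Y w <= u)%R%:R).
Proof.
move=> p0; apply: (@bm_trunc (fun y => y `^ p) u (u `^ p)); first exact: measurable_powR.
move=> y /andP[y0 yu]; rewrite ger0_norm ?powR_ge0//.
by apply: ge0_ler_powR; rewrite ?nnegrE// (le_trans y0).
Qed.

Lemma tmoment_le p u : 0 <= p -> tmoment p u <= u `^ p.
Proof.
move=> p0; rewrite -(ex_cst P (u `^ p)); apply: le_ex => [||w].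
- exact: bm_tmoment.
- exact: bm_cst.
case: (leP (Y w) u) => Yu; last by rewrite mulr0 powR_ge0.
by rewrite mulr1; apply: ge0_ler_powR; rewrite ?nnegrE// (le_trans (Y0 w)).
Qed.

Lemma tmoment_double p u : 0 <= p -> 0 <= u ->
  tmoment p (2 * u) <= tmoment p u + 2 `^ p * (u `^ p * G u).
Proof.
move=> p0 u0; rewrite mulrA -powRM// /G -(ex_indic P (measurable_gt_event u)).
have bi : bounded_measurable (\1_[set w | u < Y w] : T -> R).
  by apply: bm_indic; exact: measurable_gt_event.
rewrite -exZ// -exD//; last 2 first.
- exact: bm_tmoment.
- by apply: bmM => //; exact: bm_cst.
apply: le_ex => [||w].
- exact: bm_tmoment.
- by apply: bmD; [exact: bm_tmoment|apply: bmM => //; exact: bm_cst].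
rewrite indicE_gt; have u2 : 0 <= (2 * u) `^ p by exact: powR_ge0.
have Yp : 0 <= Y w `^ p by exact: powR_ge0.
have [Yu|Yu] := leP (Y w) u.
  have -> : Y w <= 2 * u by lra.
  by rewrite mulr0 addr0.
rewrite mulr0 add0r mulr1; have [Y2|Y2] := leP (Y w) (2 * u); last by rewrite mulr0.
rewrite mulr1; apply: ge0_ler_powR; rewrite ?nnegrE//; lra.
Qed.

Variable alpha : R.
Hypothesis alpha0 : 0 < alpha.
Hypothesis G_gt0 : forall u, 0 < G u.
Hypothesis G_ge : forall x c, 0 < x -> c < x `^ (- alpha) ->
  \forall u \near +oo, c * G u <= G (x * u).
Hypothesis G_le : forall x c, 0 < x -> x `^ (- alpha) < c ->
  \forall u \near +oo, G (x * u) <= c * G u.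

Let le_G u v : u <= v -> G v <= G u.
Proof.
by move=> uv; apply: le_pr => [||w /=]; [exact: measurable_gt_event..|exact: le_lt_trans].
Qed.

Lemma ltr_powR2 p q : p < q -> 2 `^ p < 2 `^ q :> R.
Proof.
move=> pq; rewrite /powR !gt_eqF// ltr_expR ltr_pM2r// ln_gt0//.
by rewrite ltr1n.
Qed.

Lemma tail_power_ge : exists c u0, [/\ 0 < c, 0 < u0 &
  forall u, u0 <= u -> c <= u `^ (alpha + 1) * G u].
Proof.
have h2 : 2 `^ (- (alpha + 1)) < 2 `^ (- alpha) :> R by apply: ltr_powR2; lra.
have /near_pinftyP[u0 u00 hu] := G_ge (ltr0Sn R 1) h2.
have a10 : 0 <= alpha + 1 by rewrite addr_ge0// ltW.
exists (u0 `^ (alpha + 1) * G (2 * u0)), u0; split=> //.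
  by rewrite mulr_gt0// powR_gt0.
apply: (doubling_ind u00) => [u /andP[u0u uu0]|u u0u].
  apply: ler_pM; rewrite ?powR_ge0 ?(ltW (G_gt0 _))//; last exact: le_G.
  by apply: ge0_ler_powR; rewrite ?nnegrE// ?(ltW u00)// (le_trans _ u0u)// ltW.
move=> h1; apply: (le_trans h1); have u_gt0 : 0 < u by apply: lt_le_trans u00 _.
have h : u `^ (alpha + 1) * (2 `^ (- (alpha + 1)) * G u) <=
    u `^ (alpha + 1) * G (2 * u) by rewrite ler_wpM2l ?powR_ge0// hu.
rewrite (powRM _ (ler0n R 2) (ltW u_gt0)) -mulrA -ler_pdivrMl ?powR_gt0// -powRN.
by apply: le_trans h; rewrite mulrCA.
Qed.

Lemma tail_power_le b : b < alpha -> exists C u0, [/\ 0 < C, 0 < u0 &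
  forall u, u0 <= u -> u `^ b * G u <= C].
Proof.
move=> ba.
have h2 : 2 `^ (- alpha) < 2 `^ (- b) :> R by apply: ltr_powR2; lra.
have /near_pinftyP[u0 u00 hu] := G_le (ltr0Sn R 1) h2.
exists ((u0 `^ b + (2 * u0) `^ b) * G u0), u0; split=> //.
  by rewrite mulr_gt0// ltr_wpDl ?powR_ge0// powR_gt0// mulr_gt0.
apply: (doubling_ind u00) => [u /andP[u0u uu0]|u u0u].
  have u_gt0 : 0 < u by apply: lt_le_trans u00 _.
  apply: ler_pM; rewrite ?powR_ge0 ?(ltW (G_gt0 _))//; last exact: le_G.
  have [b0|b0] := leP 0 b.
    apply: le_trans (_ : (2 * u0) `^ b <= _); last by rewrite lerDr powR_ge0.
    by apply: ge0_ler_powR; rewrite ?nnegrE// ?ltW// mulr_gt0.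
  apply: le_trans (_ : u0 `^ b <= _); last by rewrite lerDl powR_ge0.
  by rewrite /powR !gt_eqF// ler_expR ler_wnM2l ?(ltW b0)// ler_ln ?posrE.
move=> h1; apply: le_trans h1; have u_gt0 : 0 < u by apply: lt_le_trans u00 _.
have h : u `^ b * G (2 * u) <= u `^ b * (2 `^ (- b) * G u).
  by rewrite ler_wpM2l ?powR_ge0// hu.
rewrite (powRM _ (ler0n R 2) (ltW u_gt0)) -mulrA -ler_pdivlMl ?powR_gt0// -powRN.
by apply: le_trans h _; rewrite mulrCA.
Qed.

Lemma tmoment2_le : alpha < 2 -> exists C u0, [/\ 0 < C, 0 < u0 &
  forall u, u0 <= u -> tmoment 2 u <= C * (u ^+ 2 * G u)].
Proof.
move=> a2; have p24 : 2 `^ 2 = 4 :> R by rewrite powR_mulrn//; ring.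
have h1 : 4^-1 < 2 `^ (- alpha) :> R.
  by rewrite -p24 -powRN; apply: ltr_powR2; lra.
pose c := (4^-1 + 2 `^ (- alpha)) / 2.
have c4 : 4^-1 < c by rewrite /c; lra.
have ca : c < 2 `^ (- alpha) by rewrite /c; lra.
have /near_pinftyP[u0 u00 hu] := G_ge (ltr0Sn R 1) ca.
pose C := 4 / (4 * c - 1) + 4 / G (2 * u0).
have c1 : 0 < 4 * c - 1 by lra.
have C1 : 4 / (4 * c - 1) <= C by rewrite /C lerDl divr_ge0// ltW.
have C2 : 4 / G (2 * u0) <= C by rewrite /C lerDr divr_ge0// ltW.
have C0 : 0 < C by rewrite /C ltr_pwDl// ?divr_gt0// divr_ge0// ltW.
exists C, u0; split=> //.
apply: (doubling_ind u00) => [u /andP[u0u uu0]|u u0u ih].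
  have u_gt0 : 0 < u by apply: lt_le_trans u00 _.
  apply: le_trans (tmoment_le _ _) _ => //.
  rewrite (powR_mulrn 2 (ltW u_gt0)) mulrCA ler_peMr ?sqr_ge0//.
  apply: (@le_trans _ _ (C * G (2 * u0))); last by rewrite ler_pM2l// le_G.
  rewrite -ler_pdivrMr// div1r; apply: le_trans C2.
  by rewrite ler_peMl ?ler1n// invr_ge0 ltW.
have u_gt0 : 0 < u by apply: lt_le_trans u00 _.
apply: le_trans (tmoment_double _ (ltW u_gt0)) _ => //.
rewrite (powR_mulrn 2 (ltW u_gt0)) p24.
have hG := hu u u0u; rewrite exprMn.
have D0 : 0 <= u ^+ 2 by exact: sqr_ge0.
have C1' : 4 <= C * (4 * c - 1) by rewrite -ler_pdivrMr.
have G0 := G_gt0 u.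
apply: (@le_trans _ _ ((C + 4) * (u ^+ 2 * G u))); first by lra.
apply: (@le_trans _ _ ((C * (4 * c)) * (u ^+ 2 * G u))).
  by apply: ler_wpM2r; [rewrite mulr_ge0// ltW|lra].
rewrite (_ : 2 ^+ 2 = 4 :> R); last by ring.
rewrite (_ : C * (4 * c) * (u ^+ 2 * G u) = (4 * C * u ^+ 2) * (c * G u)); last by ring.
rewrite (_ : C * (4 * u ^+ 2 * G (2 * u)) = (4 * C * u ^+ 2) * G (2 * u)); last by ring.
by rewrite ler_wpM2l// !mulr_ge0// ltW.
Qed.

Lemma tmoment_alpha_le k : 0 < k -> exists C u0, [/\ 0 < C, 0 < u0 &
  forall u, u0 <= u -> tmoment alpha u <= C * u `^ k].
Proof.
move=> k0; have [|C1 [u0 [C10 u00 hu]]] := @tail_power_le (alpha - k); first by lra.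
have k1 : 0 < 2 `^ k - 1 :> R.
  by rewrite subr_gt0 -[ltLHS](powRr0 (2 : R)); exact: ltr_powR2.
pose C := 2 `^ alpha * C1 / (2 `^ k - 1) + (2 * u0) `^ alpha / u0 `^ k.
have E1 : 0 < 2 `^ alpha * C1 / (2 `^ k - 1) by rewrite divr_gt0// mulr_gt0// powR_gt0.
have E2 : 0 < (2 * u0) `^ alpha / u0 `^ k by rewrite divr_gt0 ?powR_gt0 ?mulr_gt0.
exists C, u0; split=> //; first by rewrite addr_gt0.
apply: (doubling_ind u00) => [u /andP[u0u uu0]|u u0u ih].
  have u_gt0 : 0 < u by apply: lt_le_trans u00 _.
  apply: le_trans (tmoment_le _ (ltW alpha0)) _.
  apply: (@le_trans _ _ ((2 * u0) `^ alpha)).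
    by apply: le_powR => //; exact: ltW.
  apply: (@le_trans _ _ (C * u0 `^ k)).
    by rewrite -ler_pdivrMr ?powR_gt0// /C lerDr ltW.
  rewrite ler_wpM2l//; first by rewrite addr_ge0// ltW.
  by apply: le_powR => //; exact: ltW.
have u_gt0 : 0 < u by apply: lt_le_trans u00 _.
apply: le_trans (tmoment_double (ltW alpha0) (ltW u_gt0)) _.
have hG : u `^ alpha * G u <= C1 * u `^ k.
  rewrite -ler_pdivrMr ?powR_gt0// mulrAC -powRB; first exact: hu.
  by rewrite (gt_eqF u_gt0) implybT.
rewrite (powRM _ (ler0n R 2) (ltW u_gt0)).
have hC : 2 `^ alpha * C1 <= C * (2 `^ k - 1) by rewrite -ler_pdivrMr// /C lerDl ltW.
have p0 : 0 < u `^ k by rewrite powR_gt0.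
have q0 : 0 < 2 `^ alpha :> R by rewrite powR_gt0.
have := ler_wpM2l (ltW q0) hG; have := ler_wpM2r (ltW p0) hC.
by move: ih; rewrite mulrBr mulr1; lra.
Qed.

Lemma tmoment2_bounded : 2 < alpha -> exists K u0, [/\ 0 < K, 0 < u0 &
  forall u, u0 <= u -> tmoment 2 u <= K].
Proof.
move=> a2; pose k := (alpha - 2) / 2; have k0 : 0 < k by rewrite /k; lra.
have [|C1 [u0 [C10 u00 hu]]] := @tail_power_le (2 + k); first by rewrite /k; lra.
have k1 : 2 `^ (- k) < 1 :> R.
  by rewrite -[ltRHS](powRr0 (2 : R)); apply: ltr_powR2; lra.
pose D := 4 * C1 / (1 - 2 `^ (- k)).
have D0 : 0 < D by rewrite /D divr_gt0 ?subr_gt0// mulr_gt0.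
pose K := (2 * u0) `^ 2 + D * u0 `^ (- k).
exists K, u0; split=> //.
  by apply: addr_gt0; [apply: powR_gt0; exact: mulr_gt0|rewrite mulr_gt0// powR_gt0].
suff H : forall u, u0 <= u -> tmoment 2 u <= K - D * u `^ (- k).
  move=> u u0u; apply: le_trans (H u u0u) _.
  by rewrite gerBl mulr_ge0 ?powR_ge0// ltW.
apply: (doubling_ind u00) => [u /andP[u0u uu0]|u u0u ih].
  have u_gt0 : 0 < u by apply: lt_le_trans u00 _.
  apply: le_trans (tmoment_le _ _) _ => //.
  have h1 : u `^ 2 <= (2 * u0) `^ 2.
    by apply: le_powR => //; exact: ltW.
  have h2 : D * u `^ (- k) <= D * u0 `^ (- k).
    rewrite ler_pM2l// /powR !gt_eqF// ler_expR ler_wnM2l ?oppr_le0 ?(ltW k0)//.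
    by rewrite ler_ln ?posrE.
  by rewrite /K; lra.
have u_gt0 : 0 < u by apply: lt_le_trans u00 _.
apply: le_trans (tmoment_double _ (ltW u_gt0)) _ => //.
have hG : u `^ 2 * G u <= C1 * u `^ (- k).
  rewrite powRN ler_pdivlMr ?powR_gt0// mulrAC -powRD; first exact: hu.
  by rewrite (gt_eqF u_gt0) implybT.
rewrite (powRM _ (ler0n R 2) (ltW u_gt0)).
have hD : 4 * C1 = D * (1 - 2 `^ (- k)).
  by rewrite /D divfK// gt_eqF// subr_gt0.
rewrite (_ : 2 `^ 2 = 4 :> R); last by rewrite powR_mulrn//; ring.
have : 4 * C1 * u `^ (- k) = D * (1 - 2 `^ (- k)) * u `^ (- k) by rewrite hD.
by move: ih hG; rewrite mulrBr mulr1 mulrBl; lra.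
Qed.

End truncated_moments.

Section growth.
Context {R : realType}.

Lemma powR_expR (x p : R) : 0 < x -> x `^ p = expR (p * ln x).
Proof. by move=> x0; rewrite /powR gt_eqF. Qed.

Lemma ln_le_powR (x s : R) : 0 < x -> 0 < s -> ln x <= x `^ s / s.
Proof.
move=> x0 s0; rewrite ler_pdivlMr// mulrC -ln_powR.
exact/ltW/ln_sublinear/powR_gt0.
Qed.

Lemma expR_half_le (x : R) : 0 < x -> x * expR (- x / 2) <= 8 / x.
Proof.
move=> x0; have h : (x / 2) ^+ 2 / 2 <= expR (x / 2).
  have x2 : 0 <= x / 2 by lra.
  have := expR_ge1Dxn 1 x2; rewrite (_ : 2`!%:R = 2 :> R)//; lra.
rewrite ler_pdivlMr// mulNr expRN mulrAC ler_pdivrMr ?expR_gt0//.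
by rewrite -expr2; move: h; rewrite expr_div_n; lra.
Qed.

Lemma near_cvg_pinfty (u : nat -> R) (Q : R -> Prop) : u @ \oo --> +oo ->
  (\forall x \near +oo, Q x) -> \forall n \near \oo, Q (u n).
Proof. by move=> uoo Qoo; exact: uoo _ Qoo. Qed.

Lemma powR_neg_small (p e : R) : 0 < p -> 0 < e ->
  \forall x \near +oo, x `^ (- p) < e.
Proof.
move=> p0 e0; near=> x.
have x0 : 0 < x by near: x; apply: nbhs_pinfty_gt; exact: num_real.
have h : (e^-1) `^ (p^-1) < x by near: x; apply: nbhs_pinfty_gt; exact: num_real.
rewrite powRN invf_plt ?posrE ?powR_gt0//.
rewrite -[ltLHS](@powRr1 _ e^-1) ?invr_ge0 ?ltW//.
rewrite -(mulVf (lt0r_neq0 p0)) powRrM.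
by apply: gt0_ltr_powR; rewrite ?nnegrE ?powR_ge0// ltW.
Unshelve. all: by end_near. Qed.

End growth.

Section exponential_moments.
Context {R : realType} {dT} {T : measurableType dT} (P : probability T R).
Variables (Y : T -> R).
Hypothesis mY : measurable_fun setT Y.
Hypothesis Y0 : forall w, 0 <= Y w.
Let G u := pr P [set w | u < Y w].
Variable alpha : R.
Hypothesis alpha0 : 0 < alpha.
Hypothesis G_gt0 : forall u, 0 < G u.
Hypothesis G_ge : forall x c, 0 < x -> c < x `^ (- alpha) ->
  \forall u \near +oo, c * G u <= G (x * u).
Hypothesis G_le : forall x c, 0 < x -> x `^ (- alpha) < c ->
  \forall u \near +oo, G (x * u) <= c * G u.

Variable lam : nat -> R.
Hypothesis lam_oo : lam @ \oo --> +oo.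
Let tau n := n%:R * G (lam n).
Hypothesis tau0 : tau @ \oo --> (0 : R).
Let L n := - ln (tau n).

(* Bounds the remainder of [expR_le2] for h * Y, truncated at the level u. *)
Definition exp_moment h u :=
  ex P (fun w => (h * Y w) ^+ 2 * expR (h * Y w) * (Y w <= u)%R%:R).

Lemma bm_exp_moment h u :
  bounded_measurable (fun w => (h * Y w) ^+ 2 * expR (h * Y w) * (Y w <= u)%R%:R).
Proof.
have mh : measurable_fun setT (fun y : R => h * y) by exact: measurable_funM.
apply: (@bm_trunc _ _ _ _ mY Y0 (fun y => (h * y) ^+ 2 * expR (h * y)) u
  ((`|h| * `|u|) ^+ 2 * expR (`|h| * `|u|))).
  apply: measurable_funM; first exact: measurable_funX.
  by apply: measurableT_comp => //; exact: measurable_expR.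
move=> y /andP[y0 yu]; have hy : `|h * y| <= `|h| * `|u|.
  by rewrite normrM ler_wpM2l// !ger0_norm// (le_trans y0).
rewrite normrM normrX (ger0_norm (expR_ge0 _)).
apply: ler_pM; rewrite ?exprn_ge0 ?expR_ge0//.
  by rewrite lerXn2r ?nnegrE ?mulr_ge0.
by rewrite ler_expR; apply: le_trans hy; exact: ler_norm.
Qed.

Lemma exp_moment_le2 h u : 0 <= h -> 0 <= u ->
  exp_moment h u <= h ^+ 2 * expR (h * u) * tmoment P Y 2 u.
Proof.
move=> h0 u0; have bt := @bm_tmoment _ _ _ Y mY Y0 2 u (ler0n R 2).
rewrite /tmoment -exZ//; apply: le_ex => [||w]; first exact: bm_exp_moment.
  by apply: bmM => //; exact: bm_cst.
rewrite powR_mulrn//; case: (leP (Y w) u) => Yu; last by rewrite !mulr0.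
rewrite !mulr1 exprMn -mulrA [leRHS]mulrAC -[leRHS]mulrA ler_wpM2l ?sqr_ge0//.
by rewrite ler_wpM2l ?sqr_ge0// ler_expR ler_wpM2l.
Qed.

Lemma exp_moment_le h u : 0 <= h -> 0 <= u -> 2 <= alpha ->
  exp_moment h u <= h ^+ 2 * expR 1 * tmoment P Y 2 u +
    h `^ alpha * expR (h * u) * tmoment P Y alpha u.
Proof.
move=> h0 u0 a2; have bt := @bm_tmoment _ _ _ Y mY Y0 2 u (ler0n R 2).
have bta := @bm_tmoment _ _ _ Y mY Y0 alpha u (ltW alpha0).
rewrite /tmoment -exZ// -exZ// -exD//; last 2 first.
- by apply: bmM => //; exact: bm_cst.
- by apply: bmM => //; exact: bm_cst.
apply: le_ex => [||w]; first exact: bm_exp_moment.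
  by apply: bmD; apply: bmM => //; exact: bm_cst.
rewrite powR_mulrn//; case: (leP (Y w) u) => Yu; last by rewrite !mulr0 addr0.
have hY0 : 0 <= h * Y w by rewrite mulr_ge0.
have eE : h ^+ 2 * expR 1 * (Y w ^+ 2 * true%:R) = (h * Y w) ^+ 2 * expR 1.
  by rewrite mulr1 exprMn mulrAC.
have fE : h `^ alpha * expR (h * u) * (Y w `^ alpha * true%:R) =
    (h * Y w) `^ alpha * expR (h * u).
  by rewrite mulr1 powRM// mulrAC.
rewrite eE fE mulr1.
have [h1|h1] := leP (h * Y w) 1.
  apply: le_trans (_ : (h * Y w) ^+ 2 * expR 1 <= _).
    by rewrite ler_wpM2l ?sqr_ge0// ler_expR.
  by rewrite lerDl mulr_ge0 ?powR_ge0 ?expR_ge0.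
apply: le_trans (_ : (h * Y w) `^ alpha * expR (h * u) <= _); last first.
  by rewrite lerDr mulr_ge0 ?sqr_ge0 ?expR_ge0.
apply: ler_pM; rewrite ?sqr_ge0 ?expR_ge0//.
  by rewrite -powR_mulrn//; apply: ler_powR => //; exact: ltW.
by rewrite ler_expR ler_wpM2l.
Qed.

Lemma lam_gt a : \forall n \near \oo, a < lam n.
Proof. by move/cvgryPgt : lam_oo; exact. Qed.

Lemma tau_gt0 : \forall n \near \oo, 0 < tau n.
Proof.
near=> n; rewrite mulr_gt0// ltr0n.
by near: n; exists 1%N.
Unshelve. all: by end_near. Qed.

Lemma L_oo : L @ \oo --> +oo.
Proof.
apply/cvgryPge => A; near=> n; rewrite /L lerNr.
have t0 : 0 < tau n by near: n; exact: tau_gt0.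
rewrite -[leRHS](expRK (- A)) ler_ln ?posrE ?expR_gt0//.
by near: n; apply: (cvgr_le _ tau0); exact: expR_gt0.
Unshelve. all: by end_near. Qed.

Lemma L_ge a : \forall n \near \oo, a <= L n.
Proof. by move/cvgryPge : L_oo; exact. Qed.

Lemma tauE : \forall n \near \oo, tau n = expR (- L n).
Proof.
near=> n; have t0 : 0 < tau n by near: n; exact: tau_gt0.
by rewrite /L opprK lnK.
Unshelve. all: by end_near. Qed.

Lemma L_le_ln : \forall n \near \oo, L n <= (alpha + 2) * ln (lam n).
Proof.
have [c [u0 [c0 u00 hu]]] := tail_power_ge mY alpha0 G_gt0 G_ge.
near=> n; have l0 : u0 < lam n by near: n; exact: lam_gt.
have lp : 0 < lam n by apply: lt_trans l0.
have n1 : (1 : R) <= n%:R by rewrite ler1n; near: n; exists 1%N.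
have nR0 : (0 : R) < n%:R by apply: lt_le_trans n1.
have h := hu _ (ltW l0).
have t0 : 0 < tau n by near: n; exact: tau_gt0.
have ht : c * lam n `^ (- (alpha + 1)) <= tau n.
  rewrite powRN ler_pdivrMr ?powR_gt0//; apply: le_trans h _.
  by rewrite mulrC ler_wpM2r ?powR_ge0// /tau ler_peMl// ltW ?G_gt0.
have := ht; rewrite -ler_ln ?posrE ?mulr_gt0 ?powR_gt0//.
rewrite lnM ?posrE ?powR_gt0// ln_powR.
have : - ln c <= ln (lam n).
  rewrite -lnV ?posrE// ler_ln ?posrE ?invr_gt0//.
  by near: n; move/cvgryPge : lam_oo; exact.
by rewrite /L; lra.
Unshelve. all: by end_near. Qed.

Lemma exp_moment_small_lt2 A : alpha < 2 -> 0 < A -> exists2 eta, 0 < eta &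
  forall e, 0 < e -> \forall n \near \oo,
    n%:R * exp_moment (A * L n / lam n) (eta * lam n) <= e * L n.
Proof.
move=> a2 A0; have [C [u0 [C0 u00 hu]]] := tmoment2_le mY Y0 G_gt0 G_ge a2.
pose eta := (2 * A)^-1; have eta0 : 0 < eta by rewrite invr_gt0 mulr_gt0.
exists eta => // e e0; pose c' := eta `^ (- alpha) + 1.
have c'0 : 0 < c' by rewrite ltr_pwDr// powR_ge0.
have cc : eta `^ (- alpha) < c' by rewrite ltrDl.
pose D := C * c' / 4; have D0 : 0 < D by rewrite divr_gt0// mulr_gt0.
have hG := near_cvg_pinfty lam_oo (G_le eta0 cc).
near=> n.
have lp : 0 < lam n by near: n; exact: lam_gt.
have hl : u0 <= eta * lam n.
  rewrite mulrC -ler_pdivrMr//.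
  by near: n; move/cvgryPge : lam_oo; exact.
have Gn : G (eta * lam n) <= c' * G (lam n) by near: n; exact: hG.
have Ln0 : 1 <= L n by near: n; exact: L_ge.
have LD : 8 * D / e <= L n by near: n; exact: L_ge.
have tE : tau n = expR (- L n) by near: n; exact: tauE.
have L0 : 0 < L n by apply: lt_le_trans Ln0.
set h := A * L n / lam n.
have h0 : 0 <= h by rewrite /h divr_ge0// ?mulr_ge0 ?ltW.
have el0 : 0 <= eta * lam n by rewrite mulr_ge0// ltW.
have hel : h * (eta * lam n) = L n / 2.
  by rewrite /h /eta; field; rewrite !gt_eqF.
have ht : tmoment P Y 2 (eta * lam n) <= C * ((eta * lam n) ^+ 2 * (c' * G (lam n))).
  apply: le_trans (hu _ hl) _; rewrite ler_wpM2l ?(ltW C0)//.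
  by rewrite ler_wpM2l ?sqr_ge0.
have := exp_moment_le2 h0 el0; rewrite hel => hm.
have E2 : h ^+ 2 * (eta * lam n) ^+ 2 = L n ^+ 2 / 4.
  by rewrite -exprMn hel expr_div_n; congr (_ / _); ring.
have : exp_moment h (eta * lam n) <=
    D * (L n ^+ 2 * expR (L n / 2)) * G (lam n).
  apply: le_trans hm _.
  apply: le_trans (ler_wpM2l _ ht) _; first by rewrite mulr_ge0 ?sqr_ge0 ?expR_ge0.
  rewrite (_ : h ^+ 2 * expR (L n / 2) * _ = C * c' * (h ^+ 2 * (eta * lam n) ^+ 2)
     * expR (L n / 2) * G (lam n)); last by ring.
  by rewrite E2 le_eqVlt; apply/orP; left; apply/eqP; rewrite /D; field.
move=> /(ler_wpM2l (ler0n R n)) /le_trans; apply.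
rewrite mulrCA -/(tau n) tE -mulrA.
have -> : L n ^+ 2 * expR (L n / 2) * expR (- L n) = L n * (L n * expR (- L n / 2)).
  by rewrite -mulrA -expRD expr2 -mulrA; congr (_ * (_ * expR _)); field.
have h8 := expR_half_le L0.
have h9 : D * (8 / L n) <= e.
  by rewrite mulrA ler_pdivrMr//; move: LD; rewrite ler_pdivrMr//; lra.
rewrite mulrCA [leRHS]mulrC ler_pM2l//.
exact: le_trans (ler_wpM2l (ltW D0) h8) h9.
Unshelve. all: by end_near. Qed.

Lemma high_moment_small A th : 0 < A -> th < alpha ->
  (\forall n \near \oo, n%:R <= lam n `^ th) -> exists2 eta, 0 < eta &
  \forall n \near \oo, n%:R * ((A * L n / lam n) `^ alpha *
    expR (A * L n / lam n * (eta * lam n)) *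
    tmoment P Y alpha (eta * lam n)) <= 1.
Proof.
move=> A0 tha hn; pose del := (alpha - th) / 8.
have del0 : 0 < del by rewrite divr_gt0 ?subr_gt0.
have a20 : 0 < alpha + 2 by rewrite addr_gt0.
pose eta := del / (A * (alpha + 2)).
have eta0 : 0 < eta by rewrite divr_gt0// mulr_gt0.
have [C [u0 [C0 u00 hu]]] := tmoment_alpha_le mY Y0 alpha0 G_gt0 G_le del0.
pose s := del / alpha; have s0 : 0 < s by rewrite divr_gt0.
pose K := (A * ((alpha + 2) / s)) `^ alpha * (C * eta `^ del).
have K0 : 0 < K.
  apply: mulr_gt0; last by apply: mulr_gt0 => //; exact: powR_gt0.
  by apply: powR_gt0; apply: mulr_gt0 => //; exact: divr_gt0.
exists eta => //.
have d5 : 0 < 5 * del by rewrite mulr_gt0.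
have Ki : 0 < K^-1 by rewrite invr_gt0.
have hK := near_cvg_pinfty lam_oo (powR_neg_small d5 Ki).
near=> n.
have lp : 0 < lam n by near: n; exact: lam_gt.
have hl : u0 <= eta * lam n.
  rewrite mulrC -ler_pdivrMr//.
  by near: n; move/cvgryPge : lam_oo; exact.
have Ln0 : 1 <= L n by near: n; exact: L_ge.
have L0 : 0 < L n by apply: lt_le_trans Ln0.
have LL : L n <= (alpha + 2) * ln (lam n) by near: n; exact: L_le_ln.
have nn : n%:R <= lam n `^ th by near: n.
have Kn : lam n `^ (- (5 * del)) < K^-1 by near: n; exact: hK.
have Ls : L n <= (alpha + 2) / s * lam n `^ s.
  apply: le_trans LL _; rewrite -mulrA ler_pM2l// mulrC; exact: ln_le_powR.
have as0 : 0 < (alpha + 2) / s by exact: divr_gt0.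
have Aas0 : 0 <= A * ((alpha + 2) / s) by apply: ltW; exact: mulr_gt0.
have AL0 : 0 <= A * L n by apply: ltW; exact: mulr_gt0.
have ALl0 : 0 <= A * L n / lam n by rewrite divr_ge0// ltW.
have h1 : (A * L n / lam n) `^ alpha <=
    (A * ((alpha + 2) / s)) `^ alpha * (lam n `^ del * lam n `^ (- alpha)).
  rewrite powRN mulrA ler_pdivlMr ?powR_gt0// -powRM ?(ltW lp)//.
  rewrite divfK ?gt_eqF//.
  rewrite (_ : lam n `^ del = (lam n `^ s) `^ alpha); last first.
    by rewrite -powRrM /s divfK ?gt_eqF.
  rewrite -powRM ?powR_ge0//; apply: le_powR; rewrite ?(ltW alpha0)//.
  by rewrite -mulrA ler_pM2l.
have h2 : expR (A * L n / lam n * (eta * lam n)) <= lam n `^ del.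
  rewrite powR_expR// ler_expR.
  have -> : A * L n / lam n * (eta * lam n) = A * eta * L n.
    by field; rewrite gt_eqF.
  apply: le_trans (ler_wpM2l _ LL) _; first by apply: ltW; exact: mulr_gt0.
  rewrite le_eqVlt; apply/orP; left; apply/eqP; rewrite /eta; field.
  by rewrite !gt_eqF.
have h3 : tmoment P Y alpha (eta * lam n) <= C * eta `^ del * lam n `^ del.
  by apply: le_trans (hu _ hl) _; rewrite (powRM _ (ltW eta0) (ltW lp)) mulrA.
have t0 : 0 <= tmoment P Y alpha (eta * lam n).
  by apply: ex_ge0 => w; rewrite mulr_ge0 ?powR_ge0.
have h12 := ler_pM (powR_ge0 _ _) (expR_ge0 _) h1 h2.
have h123 := ler_pM (mulr_ge0 (powR_ge0 _ _) (expR_ge0 _)) t0 h12 h3.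
have {h123}h := ler_pM (ler0n R n) (mulr_ge0 (mulr_ge0 (powR_ge0 _ _) (expR_ge0 _)) t0) nn h123.
apply: le_trans h _.
have -> : lam n `^ th * ((A * ((alpha + 2) / s)) `^ alpha *
    (lam n `^ del * lam n `^ (- alpha)) * lam n `^ del * (C * eta `^ del * lam n `^ del)) =
    K * (lam n `^ th * lam n `^ del * lam n `^ (- alpha) * lam n `^ del * lam n `^ del).
  by rewrite /K; ring.
have -> : lam n `^ th * lam n `^ del * lam n `^ (- alpha) * lam n `^ del * lam n `^ del =
    lam n `^ (- (5 * del)).
  rewrite !powR_expR// -!expRD -!mulrDl; congr (expR (_ * _)).
  by rewrite /del; field.
by rewrite mulrC -ler_pdivlMr// div1r ltW.
Unshelve. all: by end_near. Qed.

Lemma sqrt_growth K (c : nat -> R) : 0 < K ->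
  (\forall n \near \oo, 0 < c n) ->
  lam n / Num.sqrt (c n) @[n --> \oo] --> +oo ->
  \forall n \near \oo, K * c n <= lam n ^+ 2.
Proof.
move=> K0 c0 h; near=> n.
have cn : 0 < c n by near: n.
have sn : 0 < Num.sqrt (c n) by rewrite sqrtr_gt0.
have : Num.sqrt K <= lam n / Num.sqrt (c n).
  by near: n; move/cvgryPge : h; exact.
rewrite ler_pdivlMr// -sqrtrM ?(ltW K0)// => hl.
rewrite -[leLHS]sqr_sqrtr; last by rewrite mulr_ge0// ltW.
by rewrite lerXn2r ?nnegrE ?sqrtr_ge0// (le_trans _ hl)// sqrtr_ge0.
Unshelve. all: by end_near. Qed.

Lemma n_ln_small e : 0 < e ->
  lam n / Num.sqrt (n%:R * ln n%:R) @[n --> \oo] --> +oo ->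
  \forall n \near \oo, n%:R * ln (lam n) <= e * lam n ^+ 2.
Proof.
move=> e0 h; have K0 : 0 < 2 / e by rewrite divr_gt0.
have c0 : \forall n \near \oo, 0 < n%:R * ln n%:R :> R.
  near=> n; have n1 : (1 : R) < n%:R by near: n; exact: nbhs_infty_gtr.
  by rewrite mulr_gt0 ?ln_gt0// (lt_trans _ n1).
have hK := sqrt_growth K0 c0 h.
near=> n.
have n1 : (1 : R) < n%:R by near: n; exact: nbhs_infty_gtr.
have ne : e^-1 < n%:R by near: n; exact: nbhs_infty_gtr.
have n0 : (0 : R) < n%:R by apply: lt_trans n1.
have lp : 0 < lam n by near: n; exact: lam_gt.
have hn : 2 / e * (n%:R * ln n%:R) <= lam n ^+ 2 by near: n.
have [l2|l2] := leP (ln (lam n)) (2 * ln n%:R).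
  apply: le_trans (ler_wpM2l (ltW n0) l2) _.
  rewrite -ler_pdivrMl//; apply: le_trans hn.
  by rewrite le_eqVlt; apply/orP; left; apply/eqP; ring.
have n2 : n%:R ^+ 2 <= lam n.
  by rewrite -ler_ln ?posrE ?exprn_gt0// lnXn// mulr2n; lra.
apply: (@le_trans _ _ (n%:R * lam n)).
  by rewrite ler_pM2l// ltW// ln_sublinear.
rewrite expr2 mulrA ler_pM2r//.
apply: (@le_trans _ _ (e * n%:R ^+ 2)); last by rewrite ler_pM2l.
rewrite expr2 mulrA ler_peMl ?(ltW n0)//; move: ne.
by rewrite -div1r ltr_pdivrMr// mulrC => /ltW.
Unshelve. all: by end_near. Qed.

Lemma exp_moment_small A :
  (alpha = 2 -> exists2 g : R, 0 < g &
      lam n / Num.sqrt (n%:R `^ (1 + g)) @[n --> \oo] --> +oo) ->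
  (2 < alpha -> lam n / Num.sqrt (n%:R * ln n%:R) @[n --> \oo] --> +oo) ->
  0 < A -> exists2 eta, 0 < eta &
  forall e, 0 < e -> \forall n \near \oo,
    n%:R * exp_moment (A * L n / lam n) (eta * lam n) <= e * L n.
Proof.
move=> hyp2 hypgt A0.
have [a2|a2|a2] := ltrgtP alpha 2; first exact: exp_moment_small_lt2.
- have h := hypgt a2.
  have c0 : \forall n \near \oo, 0 < n%:R * ln n%:R :> R.
    near=> n; have n1 : (1 : R) < n%:R by near: n; exact: nbhs_infty_gtr.
    by rewrite mulr_gt0 ?ln_gt0// (lt_trans _ n1).
  have hK := sqrt_growth ltr01 c0 h.
  have hth : \forall n \near \oo, n%:R <= lam n `^ 2.
    near=> n; have lp : 0 < lam n by near: n; exact: lam_gt.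
    have n1 : expR 1 < n%:R :> R by near: n; exact: nbhs_infty_gtr.
    have n0 : (0 : R) < n%:R by apply: lt_trans n1; exact: expR_gt0.
    rewrite powR_mulrn ?(ltW lp)//.
    have : 1 * (n%:R * ln n%:R) <= lam n ^+ 2 by near: n.
    apply: le_trans; rewrite mul1r ler_peMr ?(ltW n0)//.
    by rewrite -[leLHS](expRK (1 : R)) ler_ln ?posrE ?expR_gt0// ltW.
  have [eta eta0 hh] := high_moment_small A0 a2 hth.
  have [K [u0 [K0 u00 hu]]] := tmoment2_bounded mY Y0 G_gt0 G_le a2.
  exists eta => // e e0.
  pose D := A ^+ 2 * expR 1 * K * (alpha + 2).
  have D0 : 0 < D.
    apply: mulr_gt0; last exact: addr_gt0.
    by apply: mulr_gt0 => //; apply: mulr_gt0; [exact: exprn_gt0|exact: expR_gt0].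
  have e20 : 0 < e / 2 / D by rewrite !divr_gt0.
  have hs := n_ln_small e20 h.
  near=> n.
  have lp : 0 < lam n by near: n; exact: lam_gt.
  have hl : u0 <= eta * lam n.
    rewrite mulrC -ler_pdivrMr//.
    by near: n; move/cvgryPge : lam_oo; exact.
  have Ln0 : 1 <= L n by near: n; exact: L_ge.
  have Le : 2 / e <= L n by near: n; exact: L_ge.
  have L0 : 0 < L n by apply: lt_le_trans Ln0.
  have LL : L n <= (alpha + 2) * ln (lam n) by near: n; exact: L_le_ln.
  have hsn : n%:R * ln (lam n) <= e / 2 / D * lam n ^+ 2 by near: n.
  have hhn : n%:R * ((A * L n / lam n) `^ alpha *
    expR (A * L n / lam n * (eta * lam n)) *
    tmoment P Y alpha (eta * lam n)) <= 1 by near: n.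
  have h0 : 0 <= A * L n / lam n.
    by apply: ltW; apply: divr_gt0 => //; exact: mulr_gt0.
  have el0 : 0 <= eta * lam n by apply: ltW; exact: mulr_gt0.
  have := exp_moment_le h0 el0 (ltW a2) => /(ler_wpM2l (ler0n R n)) /le_trans; apply.
  rewrite mulrDr (_ : e * L n = e / 2 * L n + e / 2 * L n); last by field.
  apply: lerD; last first.
    apply: le_trans hhn _; rewrite -ler_pdivrMl ?divr_gt0// mulr1.
    by rewrite invf_div.
  have q0 : 0 <= n%:R * ((A * L n / lam n) ^+ 2 * expR 1).
    by rewrite mulr_ge0// mulr_ge0 ?sqr_ge0 ?expR_ge0.
  rewrite mulrA; apply: le_trans (ler_wpM2l q0 (hu _ hl)) _.
  rewrite (_ : _ * K = L n * (A ^+ 2 * expR 1 * K * (n%:R * L n)) / lam n ^+ 2); last first.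
    by field; rewrite gt_eqF.
  rewrite ler_pdivrMr ?exprn_gt0// [e / 2 * _]mulrC -[leRHS]mulrA ler_pM2l//.
  have q1 : 0 < A ^+ 2 * expR 1 * K.
    by apply: mulr_gt0 => //; apply: mulr_gt0; [exact: exprn_gt0|exact: expR_gt0].
  apply: (@le_trans _ _ (D * (n%:R * ln (lam n)))).
    rewrite /D -[leRHS]mulrA ler_pM2l// mulrCA ler_wpM2l//.
  apply: le_trans (ler_wpM2l (ltW D0) hsn) _.
  by rewrite le_eqVlt; apply/orP; left; apply/eqP; field; rewrite gt_eqF.
- have [g g0 h] := hyp2 a2.
  have g10 : 0 < 1 + g by rewrite addr_gt0.
  have c0 : \forall n \near \oo, 0 < n%:R `^ (1 + g) :> R.
    near=> n; apply: powR_gt0; rewrite ltr0n; near: n; by exists 1%N.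
  have hK := sqrt_growth ltr01 c0 h.
  pose th := 2 / (1 + g).
  have tha : th < alpha.
    by rewrite a2 /th ltr_pdivrMr// mulrDr mulr1 ltrDl mulr_gt0.
  have hth : \forall n \near \oo, n%:R <= lam n `^ th.
    near=> n; have lp : 0 < lam n by near: n; exact: lam_gt.
    have : 1 * (n%:R `^ (1 + g)) <= lam n ^+ 2 by near: n.
    rewrite mul1r -powR_mulrn ?(ltW lp)// => hn.
    rewrite /th powRrM.
    have := le_powR (_ : 0 <= (1 + g)^-1) (powR_ge0 _ _) hn.
    rewrite -powRrM divff ?gt_eqF// powRr1//; apply.
    by rewrite invr_ge0 ltW.
  have [eta eta0 hh] := high_moment_small A0 tha hth.
  exists eta => // e e0; near=> n.
  have lp : 0 < lam n by near: n; exact: lam_gt.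
  have Ln0 : 1 <= L n by near: n; exact: L_ge.
  have Le : e^-1 <= L n by near: n; exact: L_ge.
  have L0 : 0 < L n by apply: lt_le_trans Ln0.
  have h0 : 0 <= A * L n / lam n.
    by apply: ltW; apply: divr_gt0 => //; exact: mulr_gt0.
  have el0 : 0 <= eta * lam n by apply: ltW; exact: mulr_gt0.
  have hhn : n%:R * ((A * L n / lam n) `^ alpha *
    expR (A * L n / lam n * (eta * lam n)) *
    tmoment P Y alpha (eta * lam n)) <= 1 by near: n.
  have := exp_moment_le2 h0 el0 => /(ler_wpM2l (ler0n R n)) /le_trans; apply.
  move: hhn; rewrite a2 powR_mulrn// => hhn; apply: le_trans hhn _.
  by rewrite -ler_pdivrMl// mulr1.
Unshelve. all: by end_near. Qed.

End exponential_moments.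

(** * Estimates for the walk *)

Section truncated_vectors.
Context {R : realType} {d : nat}.

Definition truncv (u : R) (x : 'rV[R]_d) : 'rV[R]_d := (enorm x <= u)%R%:R *: x.

Lemma measurable_truncv u : measurable_fun setT (truncv u : borel _ -> borel _).
Proof.
apply: measurable_mx_borel => i j; under eq_fun do rewrite mxE.
apply: measurable_funM; last exact: measurable_coord.
rewrite (_ : (fun w => _) = \1_(~` [set x : borel 'rV[R]_d | u < enorm x])).
  apply: measurable_indic; apply: measurableC.
  by apply: measurable_enorm_gt; exact: measurable_id.
by apply/funext => x; rewrite indicE in_setC; congr ((nat_of_bool _)%:R);
  rewrite leNgt; congr (~~ _); apply/idP/idP; rewrite inE.
Qed.

Lemma enorm_truncv u x : enorm (truncv u x) = enorm x * (enorm x <= u)%R%:R.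
Proof. by rewrite enormZ normr_nat mulrC. Qed.

Lemma enorm_gt_coord (x : 'rV[R]_d) y : 0 <= y -> Num.sqrt d%:R * y < enorm x ->
  exists i, y < `|x ord0 i|.
Proof.
move=> y0 yx; apply: contrapT => nex.
suff : enorm x <= Num.sqrt d%:R * y by rewrite leNgt yx.
apply: le_trans (enorm_le_norm _) _; rewrite ler_wpM2l ?sqrtr_ge0//.
rewrite [leLHS]/normr/= mx_normrE; apply/bigmax_leP; split=> // -[i j] _/=.
by rewrite (ord1 i) leNgt; apply/negP => h; apply: nex; exists j.
Qed.

End truncated_vectors.

Section walk_estimates.
Context {R : realType} {dT} {T : measurableType dT} (P : probability T R).
Context {d : nat} (X : nat -> T -> borel 'rV[R]_d.+1).
Hypothesis mX : forall k, measurable_fun setT (X k).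
Hypothesis indX : independent_family P X.
Hypothesis idX : identically_distributed P X.

Let S k w : 'rV[R]_d.+1 := \sum_(1 <= i < k.+1) (X i w : 'rV[R]_d.+1).

Definition max_gt n x : set T := [set w | exists2 k, (k <= n)%N & x < enorm (S k w)].

Lemma measurable_S k : measurable_fun setT (S k : T -> borel _).
Proof. by apply: (@measurable_block _ _ _ _ X mX _ id). Qed.

Lemma exists_le_bigcup n (Q : nat -> set T) :
  [set w | exists2 k, (k <= n)%N & Q k w] = \big[setU/set0]_(k < n.+1) Q k.
Proof.
rewrite -(bigcup_mkord n.+1 Q); apply/seteqP; split=> w /= [k kn Qk];
  by exists k.
Qed.

Lemma measurable_max_gt n x : measurable (max_gt n x).
Proof.
rewrite /max_gt (exists_le_bigcup n (fun k => [set w | x < enorm (S k w)])).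
apply: bigsetU_measurable => k _; apply: measurable_enorm_gt; exact: measurable_S.
Qed.

Lemma pr_tail_small (W : T -> R) e : measurable_fun setT W -> 0 < e ->
  exists M, forall x, M <= x -> pr P [set w | x < W w] <= e.
Proof.
move=> mW e0.
have mE x : measurable [set w | x < W w].
  rewrite (_ : mkset _ = W @^-1` `]x, +oo[); last first.
    by apply/seteqP; split=> w /=; rewrite in_itv/= andbT.
  by rewrite -[X in measurable X]setTI; apply: mW.
have h : P [set w | (k%:R < W w)%R] @[k --> \oo] --> P (\bigcap_k [set w | (k%:R < W w)%R]).
  apply: nonincreasing_cvg_mu => //.
  - by apply: (@le_lt_trans _ _ 1%:E); [exact: probability_le1|exact: ltry].
  - exact: bigcapT_measurable.
  - apply/nonincreasing_seqP => n; apply/subsetPset => w /=.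
    by apply: le_lt_trans; rewrite ler_nat.
have E0 : \bigcap_k [set w | (k%:R < W w)%R] = set0.
  apply/seteqP; split=> w // hw; have := hw (Num.truncn (W w)).+1 I.
  by rewrite /= ltNge ltW// truncnS_gt.
rewrite E0 measure0 in h.
have [N _ hN] := h _ (open_nbhs_nbhs (conj (@open_ereal_lt_ereal R e%:E) (e0 : (0 < e%:E)%E))).
exists N%:R => x Nx; have /= := hN N (leqnn N); rewrite prE// lte_fin => /ltW.
by apply: le_trans; apply: le_pr => // w /=; exact: le_lt_trans.
Qed.

Variables (alpha : R) (lam : nat -> R).
Hypothesis alpha0 : 0 < alpha.
Let Y w := enorm (X 0%N w).
Let G u := pr P [set w | u < Y w].
Hypothesis G_gt0 : forall u, 0 < G u.
Hypothesis G_ge : forall x c, 0 < x -> c < x `^ (- alpha) ->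
  \forall u \near +oo, c * G u <= G (x * u).
Hypothesis G_le : forall x c, 0 < x -> x `^ (- alpha) < c ->
  \forall u \near +oo, G (x * u) <= c * G u.
Hypothesis lam_mono : forall k n, (0 < k <= n)%N -> lam k <= lam n.
Hypothesis lam_oo : lam @ \oo --> +oo.
Hypothesis S_small : cvg_probability0 P (fun n w => (lam n)^-1 *: S n w).

Let tau n := n%:R * G (lam n).

Let lam_gt a : \forall n \near \oo, a < lam n.
Proof. by move/cvgryPgt : lam_oo; exact. Qed.

Lemma mY : measurable_fun setT Y.
Proof. exact: (measurableT_comp (@measurable_enorm R d.+1) (mX 0%N)). Qed.

Lemma pr_X_gt k u : pr P [set w | u < enorm (X k w)] = G u.
Proof.
congr fine; apply: (idX k 0%N (B := [set x | u < enorm x])).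
exact: (@measurable_enorm_gt R _ (borel 'rV[R]_d.+1) _ id u (@measurable_id _ _ _)).
Qed.

Lemma walk_uniform_small e del : 0 < e -> 0 < del -> \forall n \near \oo,
  forall k, (k <= n)%N -> pr P [set w | e * lam n < enorm (S k w)] <= del.
Proof.
move=> e0 del0.
have [N0 _ hN0] := S_small e0 (open_nbhs_nbhs
  (conj (@open_ereal_lt_ereal R del%:E) (del0 : (0 < del%:E)%E))).
have [N1 _ hN1] := lam_gt 0.
pose N := (maxn N0 N1).+1.
have hM k := cid (pr_tail_small (measurableT_comp (@measurable_enorm R d.+1) (measurable_S k)) del0).
pose M := \big[Num.max/0]_(k < N) projT1 (hM k).
have MM (k : nat) : (k < N)%N -> projT1 (hM k) <= M.
  by move=> kN; apply: (le_bigmax _ (fun k : 'I_N => projT1 (hM k)) (Ordinal kN)).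
near=> n => k kn.
have Mn : M / e < lam n by near: n; exact: lam_gt.
have [kN|Nk] := ltnP k N.
  apply: (projT2 (hM k)); apply: le_trans (MM k kN) _.
  by rewrite mulrC -ler_pdivrMr// ltW.
have k0 : (0 < k)%N by apply: leq_trans Nk.
have lk0 : 0 < lam k by apply: hN1; apply: leq_trans (ltnW Nk); rewrite leq_maxr.
have := hN0 k; rewrite /= => /(_ _)/ltW; rewrite prE.
  rewrite lee_fin => h.
  apply: le_trans (h _); last by apply: leq_trans (ltnW Nk); rewrite leq_maxl.
  apply: le_pr.
  - by apply: measurable_enorm_gt; exact: measurable_S.
  - by apply: measurable_enorm_gt; apply: measurable_vecZ; exact: measurable_S.
  move=> w /= h1; rewrite enormZ gtr0_norm ?invr_gt0// mulrC ltr_pdivlMr//.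
  apply: le_lt_trans h1; by rewrite ler_pM2l// lam_mono// k0.
by apply: measurable_enorm_gt; apply: measurable_vecZ; exact: measurable_S.
Unshelve. all: by end_near. Qed.

Lemma max_small e del : 0 < e -> 0 < del ->
  \forall n \near \oo, pr P (max_gt n (e * lam n)) <= del.
Proof.
move=> e0 del0; have e3 : 0 < e / 3 by rewrite divr_gt0.
have d2 : 0 < Num.min 4^-1 (del / 2) by rewrite lt_min invr_gt0 ltr0n divr_gt0.
near=> n.
have h : forall k, (k <= n)%N -> pr P [set w | e / 3 * lam n < enorm (S k w)] <=
    Num.min 4^-1 (del / 2) by near: n; exact: walk_uniform_small.
have := @ottaviani _ _ _ P _ X mX indX d.+1 id n (e / 3 * lam n) (@measurable_id _ _ _).
rewrite (_ : 3 * (e / 3 * lam n) = e * lam n); last by field.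
move=> /(_ _)/le_trans; apply.
  by move=> k kn; apply: le_trans (h k kn) _; rewrite ge_min lexx.
have : pr P [set w | e / 3 * lam n < enorm (S n w)] <= del / 2.
  by apply: le_trans (h n (leqnn n)) _; rewrite ge_min lexx orbT.
rewrite -/(S n); lra.
Unshelve. all: by end_near. Qed.

Lemma tau_cvg0 : tau @ \oo --> (0 : R).
Proof.
apply/cvgrPdist_le => e e0; rewrite /=.
pose del := Num.min 2^-1 (e / 2).
have del0 : 0 < del by rewrite lt_min invr_gt0 ltr0n divr_gt0.
near=> n.
have h : pr P (max_gt n (2^-1 * lam n)) <= del.
  by near: n; apply: max_small.
have tau0 : 0 <= tau n by rewrite mulr_ge0// ltW ?G_gt0.
rewrite sub0r normrN ger0_norm//.
pose B (i : nat) : set (borel 'rV[R]_d.+1) :=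
  if i == 0%N then setT else ~` [set x | lam n < enorm x].
have mB i : measurable (B i).
  rewrite /B; case: ifP => // _; apply: measurableC.
  exact: (@measurable_enorm_gt R _ (borel 'rV[R]_d.+1) _ id _ (@measurable_id _ _ _)).
have hP := prob_cylinder indX n.+1 mB.
have h0 : (P (X 0 @^-1` B 0%N) = 1)%E by rewrite preimage_setT probability_setT.
rewrite big_nat_recl//= h0 mul1e in hP.
have hi i : (P (X i.+1 @^-1` B i.+1) = (1 - G (lam n))%:E)%E.
  rewrite /B /= preimage_setC EFinB -(pr_X_gt i.+1) -prE.
    apply: probability_setC.
    exact: measurable_enorm_gt.
  exact: measurable_enorm_gt.
have hP2 : P (\bigcap_(i in `I_n.+1) X i @^-1` B i) = ((1 - G (lam n)) ^+ n)%:E.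
  rewrite hP; under eq_bigr do rewrite hi.
  by rewrite prodEFin prodr_const_nat subn0.
have mC : measurable (\bigcap_(i in `I_n.+1) X i @^-1` B i).
  apply: bigcap_measurable => [|i _]; first by exists 0%N.
  exact: measurable_preimage.
have hd : 1 - del <= (1 - G (lam n)) ^+ n.
  rewrite lerBlDr -lerBlDl; apply: le_trans h.
  have := prC P mC; rewrite /pr hP2 /= => <-.
  apply: le_pr; [exact: measurableC|exact: measurable_max_gt|].
  move=> w hw; apply: contrapT => nmax; apply: hw => i /= iin; rewrite /B.
  case: i iin => //= i iin lamX; apply: nmax.
  have SX : X i.+1 w = S i.+1 w - S i w :> 'rV[R]_d.+1.
    by rewrite /S [in X in X - _]big_nat_recr//= addrAC subrr add0r.
  have [h1|h1] := ltP (2^-1 * lam n) (enorm (S i.+1 w)).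
    by exists i.+1.
  exists i; first exact: ltnW.
  have := enorm_triangle (S i.+1 w) (- S i w); rewrite -SX enormN.
  by move: lamX h1 => /=; lra.
have G1 : G (lam n) <= 1 by apply: pr_le1; exact: (@measurable_gt_event _ _ _ _ mY).
have he : (1 - G (lam n)) ^+ n <= expR (- tau n).
  rewrite /tau -mulrN expRM_natl lerXn2r ?nnegrE ?expR_ge0 ?subr_ge0//.
  exact: expR_ge1Dx.
have d12 : del <= 2^-1 by rewrite ge_min lexx.
have d1e : del <= e / 2 by rewrite ge_min lexx orbT.
have he2 : expR (- tau n) * (1 + tau n) <= 1.
  by rewrite expRN mulrC ler_pdivrMr ?expR_gt0// mul1r expR_ge1Dx.
have hd2 := le_trans hd he.
have : (1 - del) * (1 + tau n) <= 1.
  by apply: le_trans he2; rewrite ler_wpM2r// addr_ge0.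
by have := ler_wpM2r tau0 d12; lra.
Unshelve. all: by end_near. Qed.

Definition big_jump n u : set T :=
  \big[setU/set0]_(i < n) [set w | u < enorm (X i.+1 w)].

Lemma measurable_X_gt k u : measurable [set w | u < enorm (X k w)].
Proof. exact: measurable_enorm_gt. Qed.

Lemma measurable_big_jump n u : measurable (big_jump n u).
Proof. by apply: bigsetU_measurable => i _; exact: measurable_X_gt. Qed.

Lemma pr_big_jump n u : pr P (big_jump n u) <= n%:R * G u.
Proof.
apply: le_trans (pr_bigcup_le P n (fun i => measurable_X_gt i.+1 u)) _.
under eq_bigr do rewrite pr_X_gt.
by rewrite sumr_const card_ord mulr_natl.
Qed.

Lemma big_jumpP n u w : big_jump n u w <-> exists2 i, (0 < i <= n)%N & u < enorm (X i w).
Proof.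
rewrite /big_jump -(bigcup_mkord n (fun i => [set w | u < enorm (X i.+1 w)])).
split=> [[i /= iin ui]|[[|i]//= iin ui]]; first by exists i.+1.
by exists i.
Qed.

Let trS u k w : 'rV[R]_d.+1 := \sum_(1 <= i < k.+1) truncv u (X i w : 'rV[R]_d.+1).

Lemma trS_eq n u k w : (k <= n)%N -> ~ big_jump n u w -> trS u k w = S k w.
Proof.
move=> kn nb; rewrite /trS /S; apply: eq_big_nat => i /andP[i0 ik].
rewrite /truncv (_ : (_ <= _) = true) ?scale1r// leNgt; apply/negP => ui.
by apply: nb; apply/big_jumpP; exists i => //; rewrite i0 (leq_trans _ kn).
Qed.

Lemma measurable_trS u k : measurable_fun setT (trS u k : T -> borel _).
Proof. by apply: (@measurable_block _ _ _ _ X mX _ (truncv u)); exact: measurable_truncv. Qed.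

Lemma tau_scale x : 0 < x -> exists2 C, 0 < C &
  \forall n \near \oo, n%:R * G (x * lam n) <= C * tau n.
Proof.
move=> x0; exists (x `^ (- alpha) + 1); first by rewrite ltr_pwDr// powR_ge0.
have xc : x `^ (- alpha) < x `^ (- alpha) + 1 by rewrite ltrDl.
have h := near_cvg_pinfty lam_oo (G_le x0 xc).
near=> n; rewrite /tau mulrCA ler_wpM2l//; near: n; exact: h.
Unshelve. all: by end_near. Qed.

Lemma tau_small e : 0 < e -> \forall n \near \oo, tau n <= e.
Proof. by move=> e0; exact: (cvgr_le _ tau_cvg0). Qed.

Lemma trS_uniform_small eta e del : 0 < eta -> 0 < e -> 0 < del -> \forall n \near \oo,
  forall k, (k <= n)%N ->
    pr P [set w | e * lam n < enorm (trS (eta * lam n) k w)] <= del.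
Proof.
move=> eta0 e0 del0; have d2 : 0 < del / 2 by rewrite divr_gt0.
have [C C0 hC] := tau_scale eta0.
have d3 : 0 < del / 2 / C by rewrite !divr_gt0.
near=> n => k kn.
have h : forall k, (k <= n)%N -> pr P [set w | e * lam n < enorm (S k w)] <= del / 2
  by near: n; exact: walk_uniform_small.
have ht : tau n <= del / 2 / C by near: n; exact: tau_small.
have hn : n%:R * G (eta * lam n) <= C * tau n by near: n; exact: hC.
have mE : measurable [set w | e * lam n < enorm (S k w)].
  by apply: measurable_enorm_gt; exact: measurable_S.
have mB := measurable_big_jump n (eta * lam n).
apply: (@le_trans _ _ (pr P ([set w | e * lam n < enorm (S k w)] `|`
    big_jump n (eta * lam n)))).
  apply: le_pr; [|exact: measurableU|].
    by apply: measurable_enorm_gt; exact: measurable_trS.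
  move=> w /= hw; have [|nb] := pselect (big_jump n (eta * lam n) w); first by right.
  by left; rewrite -(trS_eq kn nb).
apply: le_trans (prU_le P mE mB) _.
have h1 := le_trans (pr_big_jump n (eta * lam n)) hn.
have h2 : C * tau n <= del / 2 by rewrite mulrC -ler_pdivlMr.
have := h k kn; lra.
Unshelve. all: by end_near. Qed.

Hypothesis lam2 : alpha = 2 -> exists2 g : R, 0 < g &
  lam n / Num.sqrt (n%:R `^ (1 + g)) @[n --> \oo] --> +oo.
Hypothesis lam_gt2 : 2 < alpha ->
  lam n / Num.sqrt (n%:R * ln n%:R) @[n --> \oo] --> +oo.

Let L n := - ln (tau n).
Let Y0 w : 0 <= Y w := enorm_ge0 _.

Lemma exp_moment_scale h h' u : 0 <= h' -> h' <= h -> 0 < h ->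
  exp_moment P Y h' u <= (h' / h) ^+ 2 * exp_moment P Y h u.
Proof.
move=> h'0 h'h h0.
rewrite /exp_moment -exZ; last exact: (bm_exp_moment mY Y0).
apply: le_ex => [||w]; first exact: (bm_exp_moment mY Y0).
  by apply: bmM; [exact: bm_cst|exact: (bm_exp_moment mY Y0)].
have -> : (h' * Y w) ^+ 2 = (h' / h) ^+ 2 * (h * Y w) ^+ 2.
  by field; rewrite gt_eqF.
rewrite -[_ * _ * expR _]mulrA -[leLHS]mulrA ler_wpM2l ?sqr_ge0//.
rewrite ler_wpM2r// ler_wpM2l ?sqr_ge0// ler_expR ler_wpM2r//; exact: Y0.
Qed.

Let coordf h u (i : 'I_d.+1) (x : 'rV[R]_d.+1) : R := h * truncv u x ord0 i.

Let coordf_le h u i x : `|coordf h u i x| <= `|h| * (enorm x * (enorm x <= u)%R%:R).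
Proof. by rewrite normrM ler_wpM2l// -enorm_truncv; exact: coord_le_enorm. Qed.

Let bm_coordf h u i :
  bounded_measurable (coordf h u i : borel 'rV[R]_d.+1 -> R).
Proof.
split.
  apply: measurable_funM => //.
  exact: (measurableT_comp (measurable_coord ord0 i) (measurable_truncv u)).
exists (`|h| * `|u|) => x; apply: le_trans (coordf_le _ _ _ _) _.
rewrite ler_wpM2l//; case: (leP (enorm x) u) => xu; last by rewrite mulr0.
by rewrite mulr1; apply: le_trans xu _; exact: ler_norm.
Qed.

Let ex_coordf_sq h u i : ex P (fun w => coordf h u i (X 0%N w) ^+ 2 *
  expR `|coordf h u i (X 0%N w)|) <= exp_moment P Y `|h| u.
Proof.
have bc : bounded_measurable (fun w => coordf h u i (X 0%N w)).
  split; first exact: (measurableT_comp (bm_coordf h u i).1 (mX 0%N)).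
  by have [M hM] := (bm_coordf h u i).2; exists M => w; exact: hM.
apply: le_ex => [||w].
- apply: bmM; last by apply: bm_exp; exact: bm_norm.
  by under eq_fun do rewrite expr2; exact: bmM.
- exact: (bm_exp_moment mY Y0).
have := coordf_le h u i (X 0%N w); rewrite -/(Y w).
case: (leP (Y w) u) => Yu; rewrite ?mulr0 ?mulr1 => hc.
  apply: ler_pM; rewrite ?sqr_ge0 ?expR_ge0// ?ler_expR//.
  rewrite -[leLHS]real_normK ?num_real// lerXn2r ?nnegrE//.
  by rewrite mulr_ge0//; exact: Y0.
by move: hc; rewrite normr_le0 => /eqP ->; rewrite expr0n /= mul0r.
Qed.

Let chernoff_coord h u i n x :
  pr P [set w | x <= \sum_(1 <= k < n.+1) coordf h u i (X k w)] <=
  expR (n%:R * (ex P (fun w => coordf h u i (X 0%N w)) + exp_moment P Y `|h| u) - x).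
Proof.
have h1 := chernoff_sum mX indX idX n x (bm_coordf h u i).
apply: (le_trans h1).
by rewrite ler_expR lerD2r ler_wpM2l// lerD2l; exact: ex_coordf_sq.
Qed.

Let coordf_sum h u i n w :
  \sum_(1 <= k < n.+1) coordf h u i (X k w) = h * trS u n w ord0 i.
Proof. by rewrite -mulr_sumr /trS summxE. Qed.

Let ex_coordf h u i :
  ex P (fun w => coordf h u i (X 0%N w)) = h * ex P (fun w => coordf 1 u i (X 0%N w)).
Proof.
have bc : bounded_measurable (fun w => coordf 1 u i (X 0%N w)).
  split; first exact: (measurableT_comp (bm_coordf 1 u i).1 (mX 0%N)).
  by have [M hM] := (bm_coordf 1 u i).2; exists M => w; exact: hM.
by rewrite -exZ//; congr ex; apply/funext => w; rewrite /coordf mul1r.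
Qed.

Let L_ge a : \forall n \near \oo, a <= L n.
Proof. by have /cvgryPge := @L_oo _ _ _ P Y G_gt0 lam tau_cvg0; exact. Qed.

Let tauE : \forall n \near \oo, tau n = expR (- L n).
Proof. exact: (@tauE _ _ _ P Y G_gt0 lam). Qed.

(* The truncated walk is small with high probability, whereas Chernoff's bound
   would make it large if its mean were large. *)
Lemma mean_small A eta e : 0 < A -> 0 < eta -> 0 < e ->
  (\forall n \near \oo,
    n%:R * exp_moment P Y (A * L n / lam n) (eta * lam n) <= L n) ->
  \forall n \near \oo, forall (i : 'I_d.+1) (s : R), `|s| = 1 ->
    s * (n%:R * ex P (fun w => coordf 1 (eta * lam n) i (X 0%N w))) <= e * lam n.
Proof.
move=> A0 eta0 e0 heta; pose b := 8 / e.
have b0 : 0 < b by rewrite divr_gt0.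
have e2 : 0 < e / 2 by rewrite divr_gt0.
have q0 : 0 < 4^-1 :> R by rewrite invr_gt0.
near=> n => i s s1.
have lp : 0 < lam n by near: n; exact: lam_gt.
have Ln1 : 1 <= L n by near: n; exact: L_ge.
have L0 : 0 < L n by apply: lt_le_trans Ln1.
have Lb : b / A <= L n by near: n; exact: L_ge.
have Lb2 : b ^+ 2 / A ^+ 2 <= L n by near: n; exact: L_ge.
have hm : n%:R * exp_moment P Y (A * L n / lam n) (eta * lam n) <= L n.
  by near: n.
have hsm : forall k, (k <= n)%N ->
    pr P [set w | e / 2 * lam n < enorm (trS (eta * lam n) k w)] <= 4^-1.
  by near: n; exact: trS_uniform_small.
set u := eta * lam n in hm hsm *.
set m := n%:R * _.
rewrite leNgt; apply/negP => hgt.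
pose h := - (s * (b / lam n)).
have hh : `|h| = b / lam n.
  by rewrite /h normrN normrM s1 mul1r gtr0_norm// divr_gt0.
have hem : n%:R * exp_moment P Y `|h| u <= 1.
  have AL0 : 0 < A * L n / lam n by rewrite divr_gt0// mulr_gt0.
  have b1 : 0 <= b / lam n by apply: ltW; exact: divr_gt0.
  have b2 : b / lam n <= A * L n / lam n.
    by rewrite ler_pM2r ?invr_gt0// mulrC -ler_pdivrMr.
  have := exp_moment_scale u b1 b2 AL0; rewrite hh => /(ler_wpM2l (ler0n R n)) h1.
  apply: (le_trans h1); rewrite mulrCA.
  apply: le_trans (ler_wpM2l (sqr_ge0 _) hm) _.
  rewrite (_ : _ * L n = b ^+ 2 / A ^+ 2 / L n); last first.
    by field; rewrite !gt_eqF.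
  by rewrite ler_pdivrMr// mul1r.
have hc := chernoff_coord h u i n (- (b * (e / 2))).
have hexp : n%:R * (ex P (fun w => coordf h u i (X 0%N w)) + exp_moment P Y `|h| u)
    - - (b * (e / 2)) <= - 3.
  rewrite ex_coordf mulrDr mulrCA -/m opprK.
  have : b / lam n * (e * lam n) < b / lam n * (s * m).
    by rewrite ltr_pM2l// divr_gt0.
  rewrite (_ : b / lam n * (e * lam n) = 8); last first.
    by rewrite /b; field; rewrite !gt_eqF.
  rewrite (_ : b * (e / 2) = 4); last by rewrite /b; field; rewrite gt_eqF.
  rewrite (_ : h * m = - (b / lam n * (s * m))); last by rewrite /h; ring.
  by move: hem; lra.
have mE : measurable [set w | e / 2 * lam n < enorm (trS u n w)].
  by apply: measurable_enorm_gt; exact: measurable_trS.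
have mF : measurable [set w | - (b * (e / 2)) <= \sum_(1 <= k < n.+1) coordf h u i (X k w)].
  rewrite (_ : mkset _ = (fun w => \sum_(1 <= k < n.+1) coordf h u i (X k w)) @^-1`
      `[- (b * (e / 2)), +oo[); last first.
    by apply/seteqP; split=> w /=; rewrite in_itv/= andbT.
  rewrite -[X in measurable X]setTI; apply: measurable_sum => // k.
  exact: (measurableT_comp (bm_coordf h u i).1 (mX k)).
have : 1 - 4^-1 <= pr P [set w | - (b * (e / 2)) <= \sum_(1 <= k < n.+1) coordf h u i (X k w)].
  apply: (@le_trans _ _ (pr P (~` [set w | e / 2 * lam n < enorm (trS u n w)]))).
    by rewrite prC// lerD2l lerN2; exact: hsm.
  apply: le_pr => //; first exact: measurableC.
  move=> w /= /negP; rewrite -leNgt coordf_sum => hw.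
  have : `|trS u n w ord0 i| <= e / 2 * lam n.
    by apply: le_trans hw; exact: coord_le_enorm.
  have : `|h * trS u n w ord0 i| = b / lam n * `|trS u n w ord0 i| by rewrite normrM hh.
  move=> hE hle; have : `|h * trS u n w ord0 i| <= b * (e / 2).
    rewrite hE (_ : b * (e / 2) = b / lam n * (e / 2 * lam n)).
      by rewrite ler_wpM2l// ltW// divr_gt0.
    by field; rewrite gt_eqF.
  by rewrite ler_norml => /andP[].
apply/negP; rewrite -ltNge; apply: le_lt_trans hc _.
have h3 : expR (- 3) <= 4^-1 :> R.
  rewrite expRN lef_pV2 ?posrE ?expR_gt0//.
  by apply: le_trans (expR_ge1Dx _); lra.
apply: (@le_lt_trans _ _ (expR (- 3))); first by rewrite ler_expR.
apply: (le_lt_trans h3); lra.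
Unshelve. all: by end_near. Qed.

(* Ottaviani's inequality reduces the maximum to the last partial sum, and
   Chernoff's bound with parameter A L / lam, where L = - ln tau, is of order
   tau ^+ 2. *)
Lemma truncated_core c : 0 < c -> exists2 eta, 0 < eta & forall del, 0 < del ->
  \forall n \near \oo,
    pr P (max_gt n (c * lam n) `&` ~` big_jump n (eta * lam n)) <= del * tau n.
Proof.
move=> c0.
pose D := Num.sqrt (d.+1%:R : R); have D0 : 0 < D by rewrite sqrtr_gt0 ltr0n.
pose c' := c / 3 / D; have c'0 : 0 < c' by rewrite !divr_gt0.
pose A := 8 / c'; have A0 : 0 < A by rewrite divr_gt0.
have [eta eta0 heta] := exp_moment_small mY Y0 alpha0 G_gt0 G_ge G_le lam_oo
  tau_cvg0 lam2 lam_gt2 A0.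
exists eta => // del del0.
have c3 : 0 < c / 3 by rewrite divr_gt0.
have c'4 : 0 < c' / 4 by rewrite divr_gt0.
have q0 : 0 < 4^-1 :> R by rewrite invr_gt0.
have hm1 := heta 1 ltr01.
have hmean := mean_small A0 eta0 c'4 _.
pose K : R := 4 * d.+1%:R.
have K0 : 0 < K by rewrite mulr_gt0 ?ltr0n.
have dK : 0 < del / K by rewrite divr_gt0.
near=> n.
have lp : 0 < lam n by near: n; exact: lam_gt.
have Ln1 : 1 <= L n by near: n; exact: L_ge.
have L0 : 0 < L n by apply: lt_le_trans Ln1.
have tE : tau n = expR (- L n) by near: n; exact: tauE.
have tK : tau n <= del / K by near: n; exact: tau_small.
have hm : n%:R * exp_moment P Y (A * L n / lam n) (eta * lam n) <= L n.
  near: n; apply: filterS hm1 => n; by rewrite mul1r.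
have hmn : forall (i : 'I_d.+1) (s : R), `|s| = 1 ->
    s * (n%:R * ex P (fun w => coordf 1 (eta * lam n) i (X 0%N w))) <= c' / 4 * lam n.
  near: n; apply: hmean; apply: filterS hm1 => n; by rewrite mul1r.
have hsm : forall k, (k <= n)%N ->
    pr P [set w | c / 3 * lam n < enorm (trS (eta * lam n) k w)] <= 4^-1.
  by near: n; exact: trS_uniform_small.
set u := eta * lam n in hm hmn hsm *.
have mT k x : measurable [set w | x < enorm (trS u k w)].
  by apply: measurable_enorm_gt; exact: measurable_trS.
have mU : measurable [set w | exists2 k, (k <= n)%N & c * lam n < enorm (trS u k w)].
  rewrite (exists_le_bigcup n (fun k => [set w | c * lam n < enorm (trS u k w)])).
  by apply: bigsetU_measurable => k _; exact: mT.
apply: (@le_trans _ _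
    (pr P [set w | exists2 k, (k <= n)%N & c * lam n < enorm (trS u k w)])).
  apply: le_pr => //.
    apply: measurableI; first exact: measurable_max_gt.
    by apply: measurableC; exact: measurable_big_jump.
  by move=> w [[k kn ck] nb]; exists k => //; rewrite (trS_eq kn nb).
have := @ottaviani _ _ _ P _ X mX indX d.+1 (truncv u) n (c / 3 * lam n) (measurable_truncv u) hsm.
rewrite (_ : 3 * (c / 3 * lam n) = c * lam n); last by field.
move=> /le_trans; apply.
pose h := A * L n / lam n; have h0 : 0 < h by rewrite divr_gt0// mulr_gt0.
pose F (i : 'I_d.+1) (s : R) := [set w | A * L n * c' <= \sum_(1 <= k < n.+1) coordf (s * h) u i (X k w)].
have mF i s : measurable (F i s).
  rewrite (_ : F i s = (fun w => \sum_(1 <= k < n.+1) coordf (s * h) u i (X k w)) @^-1`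
      `[A * L n * c', +oo[); last first.
    by apply/seteqP; split=> w /=; rewrite in_itv/= andbT.
  rewrite -[X in measurable X]setTI; apply: measurable_sum => // k.
  exact: (measurableT_comp (bm_coordf (s * h) u i).1 (mX k)).
have Fle i s : `|s| = 1 -> pr P (F i s) <= tau n ^+ 2.
  move=> s1; apply: le_trans (chernoff_coord (s * h) u i n _) _.
  rewrite tE -expRM_natl ler_expR.
  have -> : `|s * h| = h by rewrite normrM s1 mul1r gtr0_norm.
  rewrite ex_coordf mulrDr.
  rewrite (_ : n%:R * (s * h * _) = h * (s * (n%:R * ex P (fun w => coordf 1 u i (X 0%N w)))));
    last by ring.
  have := ler_wpM2l (ltW h0) (hmn i s s1).
  rewrite (_ : h * (c' / 4 * lam n) = 2 * L n); last first.
    by rewrite /h /A; field; rewrite !gt_eqF.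
  rewrite (_ : A * L n * c' = 8 * L n); last first.
    by rewrite /A; field; rewrite gt_eqF.
  move: hm; rewrite -/h; lra.
pose I i := F i 1 `|` F i (-1).
have mI i : measurable (I i) by exact: measurableU.
have sub : [set w | c / 3 * lam n < enorm (trS u n w)] `<=`
    \big[setU/set0]_(i < d.+1) I i.
  move=> w /= hw; rewrite -bigcup_seq.
  have [||i hi] := @enorm_gt_coord R d.+1 (trS u n w) (c' * lam n).
  - by apply: ltW; exact: mulr_gt0.
  - rewrite -/D (_ : D * (c' * lam n) = c / 3 * lam n)//.
    by rewrite /c'; field; rewrite gt_eqF.
  exists i; first by rewrite /= mem_index_enum.
  have E s : s * h * trS u n w ord0 i = A * L n * (s * trS u n w ord0 i / lam n).
    by rewrite /h; field; rewrite gt_eqF.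
  rewrite /I /F /= !coordf_sum !E.
  have AL : 0 < A * L n by exact: mulr_gt0.
  rewrite !(ler_pM2l AL) !(ler_pdivlMr _ _ lp) mul1r mulN1r.
  by move: hi; rewrite ltr_normr => /orP[] /ltW; [left|right].
have hsum : pr P (\big[setU/set0]_(i < d.+1) I i) <= \sum_(i < d.+1) pr P (I i).
  rewrite (_ : \big[setU/set0]_(i < d.+1) I i =
      \big[setU/set0]_(i < d.+1) I (inord i)); last first.
    by apply: eq_bigr => i _; rewrite inord_val.
  apply: le_trans (pr_bigcup_le P d.+1 (fun i => mI (inord i))) _.
  by rewrite le_eqVlt; apply/orP; left; apply/eqP; apply: eq_bigr => i _; rewrite inord_val.
have hI : pr P [set w | c / 3 * lam n < enorm (trS u n w)] <= d.+1%:R * (2 * tau n ^+ 2).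
  apply: le_trans (le_pr P (mT n _) _ sub) _; first exact: bigsetU_measurable.
  apply: (le_trans hsum); rewrite mulr_natl -[X in _ *+ X]card_ord -sumr_const.
  apply: ler_sum => i _; apply: le_trans (prU_le P (mF i 1) (mF i (-1))) _.
  have := Fle i 1 (normr1 _); have := Fle i (-1) (normrN1 _); lra.
have t0 : 0 <= tau n by rewrite tE expR_ge0.
rewrite -/(trS u n).
apply: le_trans (ler_wpM2l (ler0n R 2) hI) _.
rewrite (_ : 2 * (d.+1%:R * (2 * tau n ^+ 2)) = K * tau n * tau n); last by rewrite /K; ring.
by rewrite ler_wpM2r// mulrC -ler_pdivlMr.
Unshelve. all: by end_near. Qed.

Definition drop_step k j w : 'rV[R]_d.+1 :=
  \sum_(1 <= i < j.+1 | i != k) (X i w : 'rV[R]_d.+1).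

Definition drop_gt k n y : set T :=
  [set w | exists2 j, (j <= n)%N & y < enorm (drop_step k j w)].

Lemma drop_stepE k j w : (0 < k)%N ->
  S j w = drop_step k j w + (if (k <= j)%N then X k w : 'rV[R]_d.+1 else 0).
Proof.
move=> k0; rewrite /S /drop_step; case: leqP => [kj|jk].
  by rewrite addrC (bigD1_seq k) ?iota_uniq//= mem_index_iota k0.
rewrite addr0 big_nat_cond [RHS]big_nat_cond; apply: eq_bigl => i.
case: (boolP (_ <= i < _)%N) => //= /andP[_ ij].
by rewrite neq_ltn (leq_trans ij jk).
Qed.

Lemma measurable_drop_sub k n y :
  measurable (drop_gt k n y : set (sub_space X n.+1 [pred i | i != k])).
Proof.
rewrite /drop_gt (exists_le_bigcup n (fun j => [set w | y < enorm (drop_step k j w)])).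
apply: bigsetU_measurable => j _; apply: measurable_enorm_gt.
rewrite (_ : drop_step k j = (fun w =>
    \sum_(1 <= i < j.+1 | (1 <= i < j.+1)%N && (i != k)) (X i w : 'rV[R]_d.+1))); last first.
  by apply/funext => w; rewrite /drop_step big_nat_cond.
apply: (@measurable_vec_sum _ _ (sub_space X n.+1 [pred i | i != k]) _ (fun i w => X i w)).
move=> i /andP[/andP[_ ij] ik]; apply: measurable_sub_space => //.
by apply: leq_trans ij _; exact: ltn_ord.
Qed.

Lemma measurable_drop_gt k n y : measurable (drop_gt k n y).
Proof. by apply: (sub_spaceW mX); exact: measurable_drop_sub. Qed.

Lemma pr_indep_drop k n y (B : set (borel 'rV[R]_d.+1)) (C : set T) :
  (k <= n)%N -> measurable B -> (C = drop_gt k n y \/ C = ~` drop_gt k n y) ->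
  pr P (X k @^-1` B `&` C) = pr P (X 0%N @^-1` B) * pr P C.
Proof.
move=> kn mB hC.
have mC : measurable (C : set (sub_space X n.+1 [pred i | i != k])).
  by case: hC => ->; [|apply: measurableC]; exact: measurable_drop_sub.
have mXk : measurable (X k @^-1` B : set (sub_space X n.+1 [pred i | i == k])).
  have := @measurable_sub_space _ _ _ _ X n.+1 [pred i | i == k] k.
  rewrite /= ltnS eqxx => /(_ kn isT measurableT B mB); by rewrite setTI.
rewrite /pr (indep_prob mX indX _ mXk mC); last by move=> i /= /eqP ->; rewrite eqxx.
rewrite fineM ?fin_num_measure//; last 2 first.
- exact: (sub_spaceW mX mXk).
- exact: (sub_spaceW mX mC).
by congr (fine _ * _); exact: idX.
Qed.

Lemma drop_gt_max k n y w : (0 < k <= n)%N -> drop_gt k n y w -> max_gt n (y / 3) w.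
Proof.
move=> /andP[k0 kn] [j jn yj].
have := drop_stepE j w k0; case: leqP => [kj|jk] hS; last first.
  rewrite addr0 in hS; have h0 := enorm_ge0 (S j w).
  have [y0|y0] := leP 0 y; first by exists j => //; rewrite hS; move: yj; lra.
  by exists j => //; apply: lt_le_trans h0; rewrite pmulr_llt0// invr_gt0.
have SX : X k w = S k w - S k.-1 w :> 'rV[R]_d.+1.
  rewrite /S prednK// [in X in X - _]big_nat_recr//=.
  by rewrite addrAC subrr add0r.
have dS : drop_step k j w = S j w - (S k w - S k.-1 w) by rewrite hS -SX addrK.
have h1 := enorm_triangle (S j w) (- (S k w - S k.-1 w)).
have h2 := enorm_triangle (S k w) (- S k.-1 w).
rewrite enormN -dS in h1; rewrite enormN in h2.
have [a1|a1] := ltP (y / 3) (enorm (S j w)); first by exists j.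
have [a2|a2] := ltP (y / 3) (enorm (S k w)); first by exists k.
exists k.-1; first by rewrite (leq_trans (leq_pred k)).
by move: yj h1 h2 a1 a2; lra.
Qed.

Lemma drop_small e del : 0 < e -> 0 < del -> \forall n \near \oo,
  forall k, (0 < k <= n)%N -> pr P (drop_gt k n (e * lam n)) <= del.
Proof.
move=> e0 del0; have e3 : 0 < e / 3 by rewrite divr_gt0.
near=> n => k kn.
have : pr P (max_gt n (e / 3 * lam n)) <= del by near: n; exact: max_small.
apply: le_trans; apply: le_pr.
- exact: measurable_drop_gt.
- exact: measurable_max_gt.
- by move=> w /(drop_gt_max kn); rewrite mulrAC.
Unshelve. all: by end_near. Qed.

(* Either some step exceeds x lam, with x < r; or one exceeds eta lam while the
   walk without it is still large; or none does. *)
Lemma max_upper r c : 0 < r -> r `^ (- alpha) < c ->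
  \forall n \near \oo, pr P (max_gt n (r * lam n)) <= c * tau n.
Proof.
move=> r0 rc; pose c2 := (r `^ (- alpha) + c) / 2.
have p0 : 0 < r `^ (- alpha) by rewrite powR_gt0.
have rc2 : r `^ (- alpha) < c2 by rewrite /c2; lra.
have c2c : c2 < c by rewrite /c2; lra.
have c20 : 0 < c2 by apply: lt_trans rc2.
pose x := c2 `^ (- alpha^-1); have x0 : 0 < x by rewrite powR_gt0.
have xE : x `^ (- alpha) = c2.
  by rewrite /x -powRrM mulrNN mulVf ?gt_eqF// powRr1// ltW.
have xr : x < r.
  rewrite ltNge; apply/negP => rx.
  move: rc2; rewrite -xE ltNge; apply/negP/negPn.
  rewrite !powRN lef_pV2 ?posrE ?powR_gt0//.
  by apply: le_powR => //; exact: ltW.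
pose c3 := (c2 + c) / 2.
have c23 : x `^ (- alpha) < c3 by rewrite xE /c3; lra.
have hx := near_cvg_pinfty lam_oo (G_le x0 c23).
have [eta eta0 hcore] := truncated_core r0.
have [C C0 hC] := tau_scale eta0.
have rx0 : 0 < r - x by rewrite subr_gt0.
pose e1 := (c - c3) / 2.
have e10 : 0 < e1 by rewrite /e1 /c3; lra.
have e1C : 0 < e1 / C by rewrite divr_gt0.
near=> n.
have h1 : G (x * lam n) <= c3 * G (lam n) by near: n; exact: hx.
have h2 : pr P (max_gt n (r * lam n) `&` ~` big_jump n (eta * lam n)) <= e1 * tau n.
  by near: n; exact: hcore.
have h3 : n%:R * G (eta * lam n) <= C * tau n by near: n; exact: hC.
have h4 : forall k, (0 < k <= n)%N -> pr P (drop_gt k n ((r - x) * lam n)) <= e1 / C.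
  by near: n; exact: drop_small.
pose E (k : nat) := if (k < n)%N then [set w | eta * lam n < enorm (X k.+1 w)] `&`
   drop_gt k.+1 n ((r - x) * lam n) else set0.
have mE k : measurable (E k).
  rewrite /E; case: ifP => // _; apply: measurableI; first exact: measurable_X_gt.
  exact: measurable_drop_gt.
have sub : max_gt n (r * lam n) `<=` big_jump n (x * lam n) `|`
    (\big[setU/set0]_(k < n) E k `|`
      (max_gt n (r * lam n) `&` ~` big_jump n (eta * lam n))).
  move=> w hw; have [bx|nbx] := pselect (big_jump n (x * lam n) w); first by left.
  right; have [be|nbe] := pselect (big_jump n (eta * lam n) w); last by right.
  left; move/big_jumpP : be => [[|k]//= kn etaX].
  rewrite -(bigcup_mkord n E); exists k => //; rewrite /E kn; split=> //.
  have [j jn rj] := hw; exists j => //.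
  have hX : enorm (X k.+1 w) <= x * lam n.
    by rewrite leNgt; apply/negP => h; apply: nbx; apply/big_jumpP; exists k.+1.
  have hS := drop_stepE j w (ltn0Sn k).
  have := enorm_triangle (drop_step k.+1 j w) (if (k.+1 <= j)%N then X k.+1 w : 'rV[R]_d.+1 else 0).
  rewrite -hS; have : enorm (if (k.+1 <= j)%N then X k.+1 w : 'rV[R]_d.+1 else 0) <= x * lam n.
    case: ifP => // _; rewrite enorm0; apply: le_trans hX; exact: enorm_ge0.
  by move: rj; rewrite mulrBl; lra.
have mU : measurable (\big[setU/set0]_(k < n) E k) by exact: bigsetU_measurable.
have mI : measurable (max_gt n (r * lam n) `&` ~` big_jump n (eta * lam n)).
  apply: measurableI; first exact: measurable_max_gt.
  by apply: measurableC; exact: measurable_big_jump.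
have mUI := measurableU _ _ mU mI.
apply: le_trans (le_pr P (measurable_max_gt _ _) _ sub) _.
  by apply: measurableU => //; exact: measurable_big_jump.
apply: le_trans (prU_le P (measurable_big_jump _ _) mUI) _.
have hU : pr P (\big[setU/set0]_(k < n) E k) <= e1 * tau n.
  apply: le_trans (pr_bigcup_le P n mE) _.
  apply: (@le_trans _ _ (\sum_(k < n) G (eta * lam n) * (e1 / C))).
    apply: ler_sum => k _; rewrite /E ltn_ord.
    have := @pr_indep_drop k.+1 n ((r - x) * lam n) [set v | eta * lam n < enorm v]
      (drop_gt k.+1 n ((r - x) * lam n)).
    rewrite /preimage /= => ->; last 3 first.
    - exact: ltn_ord.
    - exact: (@measurable_enorm_gt R _ (borel 'rV[R]_d.+1) _ id _ (@measurable_id _ _ _)).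
    - by left.
    rewrite pr_X_gt ler_wpM2l ?(ltW (G_gt0 _))//.
    by apply: h4; rewrite ltn_ord.
  rewrite sumr_const card_ord -[leLHS]mulr_natl mulrA.
  apply: le_trans (ler_wpM2r _ h3) _; first exact: ltW.
  by rewrite mulrC mulrA divfK ?gt_eqF.
have hB := pr_big_jump n (x * lam n).
have hB2 : n%:R * G (x * lam n) <= c3 * tau n.
  by rewrite /tau [leRHS]mulrCA ler_wpM2l.
have hUI := prU_le P mU mI.
have : c = c3 + e1 + e1 by rewrite /e1; field.
by move=> ->; rewrite !mulrDl; move: h2 hU hB hB2 hUI; lra.
Unshelve. all: by end_near. Qed.

End walk_estimates.

(** * Polar coordinates and paths with one jump *)

Section sup_norm.
Context {R : realType} {d : nat}.
Local Notation D := (@skorokhod R d).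
Implicit Types x z : D.

Lemma unit_itv0 : 0 <= (0 : R) <= 1. Proof. by rewrite lexx ler01. Qed.
Lemma unit_itv1 : 0 <= (1 : R) <= 1. Proof. by rewrite lexx ler01. Qed.

Lemma supnorm_ge x t : enorm (x t) <= supnorm x.
Proof.
apply: ub_le_sup; last by exists t.
have [M HM] := cadlag_bounded (path_cadlag x).
by exists M => _ [s _ <-]; exact: HM.
Qed.

Lemma supnorm_le x M : (forall t, enorm (x t) <= M) -> supnorm x <= M.
Proof.
move=> xM; apply: ge_sup => [|_ [t _ <-]//].
by exists (enorm (x (mk_unit_itv unit_itv0))), (mk_unit_itv unit_itv0).
Qed.

Lemma supnorm_gtP x r : reflect (exists t, r < enorm (x t)) (r < supnorm x).
Proof.
apply: (iffP idP) => [rx|[t rt]]; last exact: lt_le_trans (supnorm_ge x t).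
apply: contrapT => nt; suff : supnorm x <= r by rewrite leNgt rx.
by apply: supnorm_le => t; rewrite leNgt; apply/negP => h; apply: nt; exists t.
Qed.

Lemma supnormZ a x : 0 < a -> supnorm (path_scale a x) = a * supnorm x.
Proof.
move=> a0; apply/eqP; rewrite eq_le; apply/andP; split.
  apply: supnorm_le => t /=; rewrite enormZ gtr0_norm// ler_pM2l//.
  exact: supnorm_ge.
rewrite mulrC -ler_pdivlMr//; apply: supnorm_le => t.
rewrite ler_pdivlMr// mulrC.
by have := supnorm_ge (path_scale a x) t; rewrite /= enormZ gtr0_norm.
Qed.

Lemma path_scaleK a x : a != 0 -> path_scale a (path_scale a^-1 x) = x.
Proof.
move=> a0; apply/skorokhod_eqP => t /=.
by rewrite scalerA divff// scale1r.
Qed.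

Lemma to_polar_norm x : 0 < supnorm x ->
  supnorm (path_scale (supnorm x)^-1 x) = 1.
Proof. by move=> x0; rewrite supnormZ ?invr_gt0// mulVf ?gt_eqF. Qed.

Definition to_polar x (x0 : 0 < supnorm x) : polar R d :=
  @Polar R d (supnorm x)%:E (path_scale (supnorm x)^-1 x) (x0 : (0 < (supnorm x)%:E)%E)
    (to_polar_norm x0).

Lemma cartesian_to_polar x (x0 : 0 < supnorm x) : cartesian (to_polar x0) = x.
Proof. by rewrite /cartesian /= path_scaleK ?gt_eqF. Qed.

Lemma polar_eqP (z w : polar R d) : Defs.radius z = Defs.radius w ->
  direction z = direction w -> z = w.
Proof.
case: z w => [r x r0 x1] [s y s0 y1]/= rs xy; subst.
by congr Polar; exact: Prop_irrelevance.
Qed.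

Lemma supnorm_cartesian (z : polar R d) : ~ infinite_radius z ->
  (supnorm (cartesian z))%:E = Defs.radius z /\ 0 < supnorm (cartesian z).
Proof.
move=> fz; have := radius_gt0 z; have := direction_norm1 z.
rewrite /infinite_radius /= in fz; rewrite /cartesian.
case: (Defs.radius z) fz => [r||]//= _ d1 r0.
by rewrite supnormZ// d1 mulr1.
Qed.

Lemma path_setP (B : set (polar R d)) x :
  path_set B x <-> exists x0 : 0 < supnorm x, B (to_polar x0).
Proof.
split=> [[z [Bz fz] ->]|[x0 Bx]]; last first.
  exists (to_polar x0); last by rewrite cartesian_to_polar.
  by split => //; rewrite /infinite_radius /=.
have [rz z0] := supnorm_cartesian fz; exists z0.
rewrite (_ : to_polar z0 = z)//; apply: polar_eqP => //=.
move: rz z0; rewrite /cartesian; case: (Defs.radius z) => [r||]//= [->] r0.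
apply/skorokhod_eqP => t /=.
by rewrite scalerA mulVf ?gt_eqF// scale1r.
Qed.

Lemma to_polar_irr x (h h' : 0 < supnorm x) : to_polar h = to_polar h'.
Proof. by congr to_polar; exact: bool_irrelevance. Qed.

Lemma open_polarP (G : set (polar R d)) (z : polar R d) : open G -> G z ->
  exists2 e : R, 0 < e & forall w, polar_dist z w < e -> G w.
Proof.
move=> oG Gz; have /nbhs_ballP[e /= e0 eG] := open_nbhs_nbhs (conj oG Gz : open_nbhs z G).
by exists e => // w zw; apply: eG; rewrite ballEmdist.
Qed.

Lemma supnorm_skdist_set x z e : skdist_set x z e -> `|supnorm x - supnorm z| <= e.
Proof.
move=> [l [[_ ls] _ xz]].
have h1 : supnorm x <= supnorm z + e.
  apply: supnorm_le => t; rewrite -(subrK (z (l t)) (x t)) addrC.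
  apply: le_trans (enorm_triangle _ _) _.
  by apply: lerD => //; exact: supnorm_ge.
have h2 : supnorm z <= supnorm x + e.
  apply: supnorm_le => t; have [s <-] := ls t; rewrite -(subrK (x s) (z _)) addrC.
  apply: le_trans (enorm_triangle _ _) _; rewrite (enormB (z _)).
  by apply: lerD => //; exact: supnorm_ge.
by rewrite ler_norml; apply/andP; split; lra.
Qed.

(* The map to polar coordinates is continuous away from the zero path. *)
Lemma path_set_nbhs (G : set (polar R d)) z : open G -> path_set G z ->
  exists2 e : R, 0 < e & forall x, skdist_set x z e -> path_set G x.
Proof.
move=> oG /path_setP[z0 Gz]; have [r r0 hr] := open_polarP oG Gz.
pose k := Num.min (r / 2) 1.
have k0 : 0 < k by rewrite lt_min ltr01 andbT divr_gt0.
have k1 : k <= 1 by rewrite ge_min lexx orbT.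
have kr : k < r by rewrite gt_min; apply/orP; left; lra.
set s := supnorm z in z0 Gz hr.
pose e := Num.min (k / 4) (Num.min (k * s / 4) (k * s ^+ 2 / 4)).
have e0 : 0 < e by rewrite !lt_min !divr_gt0 ?mulr_gt0 ?exprn_gt0.
have [e1 e3 e4] : [/\ e <= k / 4, e <= k * s / 4 & e <= k * s ^+ 2 / 4].
  by rewrite /e !ge_min !lexx ?orbT.
exists e => // x xz.
have hsx : `|supnorm x - s| <= e by exact: supnorm_skdist_set xz.
have ks : k * s <= s by rewrite ler_piMl// ltW.
have /andP[sx1 sx2] : s - e <= supnorm x <= s + e by move: hsx; rewrite ler_distl.
have x0 : 0 < supnorm x by lra.
apply/path_setP; exists x0; apply: hr.
rewrite /polar_dist gt_max; apply/andP; split.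
  rewrite /inv_radius /= /inve !gt_eqF//= -/s.
  rewrite (_ : s^-1 - (supnorm x)^-1 = (supnorm x - s) / (s * supnorm x));
    last by field; rewrite !gt_eqF.
  rewrite normrM [X in _ * X]gtr0_norm ?invr_gt0 ?mulr_gt0//.
  rewrite ltr_pdivrMr ?mulr_gt0//; apply: le_lt_trans hsx _.
  apply: (@le_lt_trans _ _ (k * (s * supnorm x))); last first.
    by rewrite ltr_pM2r// mulr_gt0.
  have := ler_wpM2l (ltW z0) sx1.
  have q1 : s * (s - e) >= s ^+ 2 / 2.
    rewrite expr2 -mulrA ler_pM2l//; lra.
  move=> q2; apply: le_trans (ler_wpM2l (ltW k0) (le_trans q1 q2)); lra.
change (skdist (path_scale s^-1 z) (path_scale (supnorm x)^-1 x) < r).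
rewrite skdist_sym; apply: le_lt_trans kr; apply: skdist_le.
have [l [cl le xzl]] := xz; exists l; split => // [a b ab|t].
  by apply: le_trans (le _ _ ab) _; lra.
have -> : path_scale (supnorm x)^-1 x t - path_scale s^-1 z (l t) =
    ((supnorm x)^-1 - s^-1) *: x t + s^-1 *: (x t - z (l t)).
  by rewrite /= scalerBl scalerBr addrA subrK.
apply: le_trans (enorm_triangle _ _) _; rewrite !enormZ.
rewrite (_ : (supnorm x)^-1 - s^-1 = - ((supnorm x - s) / (s * supnorm x)));
  last by field; rewrite !gt_eqF.
rewrite normrN normrM [X in _ * X * _]gtr0_norm ?invr_gt0 ?mulr_gt0//.
rewrite [X in _ + X * _]gtr0_norm ?invr_gt0//.
have xs := supnorm_ge x t.
have p1 : `|supnorm x - s| / (s * supnorm x) * enorm (x t) <= e / s.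
  apply: (@le_trans _ _ (e / (s * supnorm x) * supnorm x)).
    apply: ler_pM => //; rewrite ?enorm_ge0//; first by rewrite divr_ge0// mulr_ge0// ltW.
    by rewrite ler_pM2r// invr_gt0 mulr_gt0.
  by rewrite le_eqVlt; apply/orP; left; apply/eqP; field; rewrite !gt_eqF.
have p2 : s^-1 * enorm (x t - z (l t)) <= e / s.
  by rewrite mulrC ler_pM2r// invr_gt0.
apply: le_trans (lerD p1 p2) _.
rewrite -mulrDl ler_pdivrMr//; lra.
Qed.

Lemma path_set_sup_nbhs (G : set (polar R d)) z : open G -> path_set G z ->
  exists2 e : R, 0 < e &
    forall x, (forall t, enorm (x t - z t) <= e) -> path_set G x.
Proof.
move=> oG Gz; have [e e0 he] := path_set_nbhs oG Gz; exists e => // x xz.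
apply: he; exists id; split=> //; first exact: time_change_id.
by apply: log_slope_id; exact: ltW.
Qed.

End sup_norm.

Section jump_paths.
Context {R : realType} {d : nat}.
Local Notation I := (unit_itv R).
Local Notation D := (@skorokhod R d).
Implicit Types (v e : R) (y : 'rV[R]_d) (x : D).

Lemma cadlag_jump v y : cadlag (fun t : I => if v <= \val t then y else 0).
Proof.
move=> t; split.
  have [vt|tv] := leP v (\val t).
    apply: cvg_near_cst; apply/right_nbhsP; exists 1 => // s /andP[ts _].
    by rewrite (le_trans vt ts).
  apply: cvg_near_cst; apply/right_nbhsP; exists (v - \val t); first by rewrite subr_gt0.
  by move=> s /andP[_]; rewrite addrC subrK leNgt => ->.
have [vt|tv] := ltP v (\val t).
  exists y; apply: cvg_near_cst; apply/left_nbhsP; exists (\val t - v).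
    by rewrite subr_gt0.
  by move=> s /andP[+ _]; rewrite opprB addrC subrK => /ltW ->.
exists 0; apply: cvg_near_cst; apply/left_nbhsP; exists 1 => // s /andP[_ st].
by rewrite leNgt (lt_le_trans st tv).
Qed.

Definition jump v y : D := Skorokhod (cadlag_jump v y).

Lemma supnorm_jump v y : v <= 1 -> supnorm (jump v y) = enorm y.
Proof.
move=> v1; apply/eqP; rewrite eq_le; apply/andP; split.
  apply: supnorm_le => t /=; case: ifP => // _; rewrite enorm0; exact: enorm_ge0.
have := supnorm_ge (jump v y) (mk_unit_itv unit_itv1).
by rewrite /= v1.
Qed.

(* The piecewise linear time change with vertex (v', v). *)
Let bent v v' t : R := if t <= v' then t * (v / v') else 1 - (1 - t) * ((1 - v) / (1 - v')).

Let bent_unit v v' t : 0 < v < 1 -> 0 < v' < 1 -> 0 <= t <= 1 -> 0 <= bent v v' t <= 1.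
Proof.
move=> /andP[v0 v1] /andP[v'0 v'1] /andP[t0 t1]; rewrite /bent; case: (leP t v') => tv.
  have q0 : 0 < v / v' by rewrite divr_gt0.
  rewrite mulr_ge0 ?(ltW q0)//=; apply: (@le_trans _ _ (v' * (v / v'))).
    by rewrite ler_pM2r.
  by rewrite mulrC divfK ?gt_eqF// ltW.
have w0 : 0 < 1 - v' by rewrite subr_gt0.
have q0 : 0 < (1 - v) / (1 - v') by rewrite divr_gt0// subr_gt0.
have h : (1 - t) * ((1 - v) / (1 - v')) <= (1 - v') * ((1 - v) / (1 - v')).
  by rewrite ler_pM2r//; lra.
rewrite [X in _ <= X]mulrC divfK ?gt_eqF// in h.
have : 0 <= (1 - t) * ((1 - v) / (1 - v')) by rewrite mulr_ge0 ?(ltW q0)//; lra.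
by move=> h'; apply/andP; split; lra.
Qed.

Let bentK v v' t : 0 < v < 1 -> 0 < v' < 1 -> bent v v' (bent v' v t) = t.
Proof.
move=> /andP[v0 v1] /andP[v'0 v'1]; rewrite /bent.
have w0 : 0 < 1 - v by rewrite subr_gt0.
have w0' : 0 < 1 - v' by rewrite subr_gt0.
have [tv|vt] := leP t v.
  have -> : t * (v' / v) <= v' by rewrite mulrA ler_pdivrMr// mulrC ler_pM2l.
  by field; rewrite !gt_eqF.
have h : v' < 1 - (1 - t) * ((1 - v') / (1 - v)).
  rewrite ltrBrDr -ltrBrDl mulrA ltr_pdivrMr// mulrC ltr_pM2l//; lra.
rewrite leNgt h /=.
by field; rewrite !gt_eqF.
Qed.

Let bent_slope v v' e s t : 0 < v < 1 -> 0 < v' < 1 -> 0 < e ->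
  v <= (1 + e) * v' -> v' <= (1 + e) * v ->
  1 - v <= (1 + e) * (1 - v') -> 1 - v' <= (1 + e) * (1 - v) ->
  0 <= s -> s < t -> t <= 1 ->
  (t - s) / (1 + e) <= bent v v' t - bent v v' s <= (t - s) * (1 + e).
Proof.
move=> /andP[v0 v1] /andP[v'0 v'1] e0 h1 h2 h3 h4 s0 st t1.
have w0 : 0 < 1 - v by rewrite subr_gt0.
have w0' : 0 < 1 - v' by rewrite subr_gt0.
have e1 : 0 < 1 + e by lra.
rewrite ler_pdivrMr//.
pose a := v / v'; pose b := (1 - v) / (1 - v').
have a1 : a <= 1 + e by rewrite /a ler_pdivrMr.
have a2 : 1 <= a * (1 + e) by rewrite /a mulrAC ler_pdivlMr// mul1r mulrC.
have b1 : b <= 1 + e by rewrite /b ler_pdivrMr.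
have b2 : 1 <= b * (1 + e) by rewrite /b mulrAC ler_pdivlMr// mul1r mulrC.
have av : v' * a = v by rewrite /a mulrC divfK ?gt_eqF.
have bv : (1 - v') * b = 1 - v by rewrite /b mulrC divfK ?gt_eqF.
rewrite /bent -/a -/b; case: (leP t v') => tv; case: (leP s v') => sv.
- have -> : t * a - s * a = (t - s) * a by ring.
  have ts : 0 < t - s by rewrite subr_gt0.
  rewrite -mulrA ler_peMr ?(ltW ts)//= ler_pM2l//.
- by exfalso; move: st tv sv; lra.
- have -> : 1 - (1 - t) * b - s * a = (t - v') * b + (v' - s) * a.
    have hb : v' * b = b - (1 - v) by rewrite -bv; ring.
    by move: av hb; lra.
  have q1 : 0 <= t - v' by lra.
  have q2 : 0 <= v' - s by lra.
  have := ler_wpM2l q1 b1; have := ler_wpM2l q2 a1.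
  have := ler_wpM2l q1 b2; have := ler_wpM2l q2 a2.
  by move=> *; apply/andP; split; lra.
- have -> : 1 - (1 - t) * b - (1 - (1 - s) * b) = (t - s) * b by ring.
  have ts : 0 < t - s by rewrite subr_gt0.
  by rewrite -mulrA ler_peMr ?(ltW ts)//= ler_pM2l.
Qed.

Lemma skdist_set_jump v v' y e : 0 < v < 1 -> 0 < v' < 1 -> 0 < e ->
  v <= (1 + e) * v' -> v' <= (1 + e) * v ->
  1 - v <= (1 + e) * (1 - v') -> 1 - v' <= (1 + e) * (1 - v) ->
  forall x, (forall t, enorm (x t - jump v' y t) <= e) -> skdist_set x (jump v y) e.
Proof.
move=> v01 v'01 e0 h1 h2 h3 h4 x hx.
pose l (t : I) : I := mk_unit_itv (bent_unit v01 v'01 (unit_itvP t)).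
exists l; split.
- split=> [s t st|t].
    have /andP[s0 _] := unit_itvP s; have /andP[_ t1] := unit_itvP t.
    have /andP[+ _] := bent_slope v01 v'01 e0 h1 h2 h3 h4 s0 st t1.
    rewrite /= -subr_gt0; apply: lt_le_trans; rewrite divr_gt0 ?subr_gt0//; lra.
  exists (mk_unit_itv (bent_unit v'01 v01 (unit_itvP t))); apply: val_inj => /=.
  exact: bentK.
- move=> s t st.
  have /andP[s0 _] := unit_itvP s; have /andP[_ t1] := unit_itvP t.
  have /andP[] := bent_slope v01 v'01 e0 h1 h2 h3 h4 s0 st t1.
  have ts : 0 < \val t - \val s by rewrite subr_gt0.
  have e1 : 0 < 1 + e by lra.
  have le1 : ln (1 + e) <= e.
    by rewrite -[leRHS]expRK ler_ln ?posrE ?expR_gt0// expR_ge1Dx.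
  rewrite mulrC -ler_pdivlMr// => q1; rewrite mulrC -ler_pdivrMr// => q2.
  change (\val (l t)) with (bent v v' (\val t)).
  change (\val (l s)) with (bent v v' (\val s)).
  set r := (_ / _) in q1 q2 *.
  have r0 : 0 < r by apply: lt_le_trans q1; rewrite invr_gt0.
  rewrite ler_norml; apply/andP; split; last first.
    by apply: le_trans le1; rewrite ler_ln ?posrE.
  rewrite lerNl; apply: le_trans le1; rewrite -lnV ?posrE// ler_ln ?posrE ?invr_gt0//.
  by rewrite invf_ple ?posrE.
move=> t; apply: le_trans (hx t); rewrite le_eqVlt; apply/orP; left; apply/eqP.
congr (enorm (_ - _)) => /=; rewrite /bent.
have /andP[v0 v1] := v01; have /andP[v'0 v'1] := v'01.
have w0 : 0 < 1 - v by rewrite subr_gt0.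
have w0' : 0 < 1 - v' by rewrite subr_gt0.
case: (ltgtP (\val t) v') => [tv|vt|->].
- rewrite leNgt (_ : _ < v)//.
  by rewrite mulrA ltr_pdivrMr// mulrC ltr_pM2l.
- rewrite (_ : v <= _)// lerBrDr -lerBrDl mulrA ler_pdivrMr// mulrC ler_pM2l//.
  by rewrite lerD2l lerN2 ltW.
- by rewrite mulrC divfK ?gt_eqF// !lexx.
Qed.

Lemma jump_nbhs (G : set (polar R d)) v y : open G -> 0 < v < 1 ->
  path_set G (jump v y) -> exists2 e : R, 0 < e &
  forall v' y' x, `|v' - v| < e -> enorm (y' - y) < e ->
    (forall t, enorm (x t - jump v' y' t) <= e) -> path_set G x.
Proof.
move=> oG v01 Gj; have /andP[v0 v1] := v01.
have [r r0 hr] := path_set_nbhs oG Gj.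
have w0 : 0 < 1 - v by rewrite subr_gt0.
pose k := Num.min (r / 2) 1.
have k0 : 0 < k by rewrite lt_min ltr01 andbT divr_gt0.
have k1 : k <= 1 by rewrite ge_min lexx orbT.
have kr : k < r by rewrite gt_min; apply/orP; left; lra.
pose e := Num.min (k * v / 4) (k * (1 - v) / 4).
have e0 : 0 < e by rewrite !lt_min !divr_gt0 ?mulr_gt0.
have [e1 e2] : e <= k * v / 4 /\ e <= k * (1 - v) / 4.
  by rewrite /e !ge_min !lexx ?orbT.
exists e => // v' y' x hv hy hx.
have hv2 : v - e < v' < v + e.
  by move: hv; rewrite ltr_distl => /andP[q1 q2]; apply/andP; split.
have /andP[hv3 hv4] := hv2.
have kv : k * v <= v by rewrite ler_piMl// ltW.
have kw : k * (1 - v) <= 1 - v by rewrite ler_piMl// ltW.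
have v'01 : 0 < v' < 1 by apply/andP; split; lra.
have hxy t : enorm (x t - jump v' y t) <= 2 * e.
  apply: le_trans (enorm_distD (jump v' y' t) _ _) _.
  have : enorm (jump v' y' t - jump v' y t) <= e.
    rewrite /=; case: ifP => _; first exact: ltW.
    by rewrite subrr enorm0 ltW.
  by have := hx t; lra.
have ek : 2 * e <= k by nra.
have [q1 q2] : v <= (1 + k) * v' /\ v' <= (1 + k) * v by split; nra.
have [q3 q4] : 1 - v <= (1 + k) * (1 - v') /\ 1 - v' <= (1 + k) * (1 - v) by split; nra.
apply: hr; have [l [cl ls xl]] : skdist_set x (jump v y) k.
  apply: (@skdist_set_jump v v') => // t; exact: le_trans (hxy t) ek.
exists l; split => // [a b ab|t].
  by apply: le_trans (ls _ _ ab) _; exact: ltW.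
by apply: le_trans (xl t) _; exact: ltW.
Qed.

End jump_paths.

(** * The limit measure *)

Section unit_lebesgue.
Context {R : realType}.

Definition unit_lebesgue : {measure set (measurableTypeR R) -> \bar R} :=
  mrestr lebesgue_measure (measurable_itv `]0:R, 1[).

Lemma unit_lebesgue_le (A : set R) : measurable A ->
  (unit_lebesgue A <= lebesgue_measure A)%E.
Proof.
move=> mA; apply: le_measure; rewrite ?inE//.
by apply: measurableI => //; exact: measurable_itv.
Qed.

Lemma unit_lebesgueC : unit_lebesgue (~` `]0:R, 1[%classic) = 0%E.
Proof. by rewrite /unit_lebesgue /= /mrestr setICl measure0. Qed.

Lemma unit_lebesgue_initial (t : R) : 0 <= t <= 1 ->
  unit_lebesgue `]-oo, t]%classic = t%:E.
Proof.
move=> /andP[t0 t1]; rewrite /unit_lebesgue /= /mrestr.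
have [t1'|t1'] := ltP t 1.
  rewrite (_ : _ `&` _ = `]0:R, t]%classic); last first.
    apply/seteqP; split=> x /=; rewrite !in_itv/=; first by move=> [-> /andP[->]].
    by move=> /andP[-> xt]; rewrite xt (le_lt_trans xt t1').
  rewrite lebesgue_measure_itv/= lte_fin; case: ltP => [_|t0']; first by rewrite oppr0 adde0.
  by congr EFin; apply/eqP; rewrite eq_le t0 t0'.
rewrite setIidr; last first.
  by move=> x /=; rewrite !in_itv/= => /andP[_ x1]; exact: le_trans (ltW x1) t1'.
rewrite lebesgue_measure_itv/= lte_fin ltr01 oppr0 adde0; congr EFin.
by apply/eqP; rewrite eq_le t1 t1'.
Qed.

End unit_lebesgue.

Section jump_measure.
Context {R : realType} {d : nat}.
Local Notation V := 'rV[R]_d.+1.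
Local Notation D := (@skorokhod R d.+1).
Local Notation W := (measurableTypeR R * borel V)%type.
Implicit Types (p : W) (A : set (polar R d.+1)).

Definition proper_jumps : set W := `]0:R, 1[%classic `*` [set y : V | y != 0].

Lemma measurable_vec0 : measurable ([set 0] : set (borel V)).
Proof.
rewrite (_ : [set 0] = ~` [set y : V | y != 0]).
  by apply: measurableC; apply: borel_open; exact: open_neq0.
by apply/seteqP; split=> y /=; [move=> ->; apply/negP; rewrite negbK|move=> /negP; rewrite negbK => /eqP].
Qed.

Lemma measurable_proper_jumps : measurable proper_jumps.
Proof.
apply: measurableX; first exact: measurable_itv.
by apply: borel_open; exact: open_neq0.
Qed.

Let e1 : V := delta_mx ord0 ord0.

Let e1_neq0 : e1 != 0.
Proof.
by apply/eqP => /matrixP/(_ ord0 ord0); rewrite !mxE !eqxx => /eqP; rewrite oner_eq0.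
Qed.

(* Outside [proper_jumps], which has full measure, an arbitrary single-jump path
   is used. *)
Definition jump_path p : D :=
  if `[< proper_jumps p >] then jump p.1 p.2 else jump 0 e1.

Lemma jump_path_gt0 p : 0 < supnorm (jump_path p).
Proof.
rewrite /jump_path; case: asboolP => [[/=]|_].
  by rewrite in_itv/= => /andP[_ p1] p0; rewrite supnorm_jump ?(ltW p1)//; exact: enorm_gt0.
by rewrite supnorm_jump//; exact: enorm_gt0.
Qed.

Definition polar_jump p : polar R d.+1 := to_polar (jump_path_gt0 p).

Lemma path_set_jump A p : path_set A (jump_path p) <-> A (polar_jump p).
Proof.
rewrite path_setP; split=> [[h]|h]; first by rewrite (to_polar_irr _ (jump_path_gt0 p)).
by exists (jump_path_gt0 p).
Qed.

Lemma polar_jump_single p : polar_set single_jump (polar_jump p).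
Proof.
split => //; rewrite cartesian_to_polar /jump_path; case: asboolP => [[/=]|_].
  rewrite in_itv/= => /andP[p0 p1] py; exists p.1, p.2; split=> //.
  by rewrite (ltW p0).
by exists 0, e1; split => //; rewrite lexx ltr01.
Qed.

Definition jumps_in A : set W :=
  [set p | proper_jumps p /\ path_set A (jump p.1 p.2)].

Lemma polar_jump_preimage A : polar_jump @^-1` A =
  jumps_in A `|` (~` proper_jumps `&` [set _ | path_set A (jump 0 e1)]).
Proof.
apply/seteqP; split=> p /=; rewrite -path_set_jump /jump_path /jumps_in /=;
  case: asboolP => h.
- by left.
- by right.
- by case=> [[]|[]].
- by case=> [[]|[]].
Qed.

Lemma jumps_in_preimage A : jumps_in A = polar_jump @^-1` A `&` proper_jumps.
Proof.
rewrite polar_jump_preimage setIUl setIAC setICl set0I setU0.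
by apply/seteqP; split=> p [] // h; split => //; case: h.
Qed.

Lemma measurable_preimage_jump A : measurable (jumps_in A) ->
  measurable (polar_jump @^-1` A).
Proof.
move=> mA; rewrite polar_jump_preimage; apply: measurableU => //.
have [h|h] := pselect (path_set A (jump 0 e1)).
  rewrite (_ : [set _ | _] = setT); last by apply/seteqP; split.
  by rewrite setIT; apply: measurableC; exact: measurable_proper_jumps.
rewrite (_ : [set _ | _] = set0); last by apply/seteqP; split.
by rewrite setI0.
Qed.

Let row2 p : 'rV[R]_(1 + d.+1) := row_mx (const_mx p.1) (p.2 : V).

Lemma measurable_jumps_in_open A : open A -> measurable (jumps_in A).
Proof.
move=> oA.
rewrite (_ : jumps_in A = row2 @^-1`
    [set u : 'rV[R]_(1 + d.+1) | jumps_in A (u ord0 (lshift d.+1 ord0), rsubmx u)]); last first.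
  apply/seteqP; split=> -[v y] /=; rewrite /row2 row_mxEl mxE row_mxKr //.
apply: measurable_mx_open => [i j|].
  rewrite -(splitK j); case: (fintype.split j) => k; rewrite /row2 /=.
    rewrite (_ : (fun _ => _) = fst); last by apply/funext => p; rewrite row_mxEl mxE.
    exact: measurable_fst.
  rewrite (_ : (fun _ => _) = (fun p => (p.2 : V) i k)); last first.
    by apply/funext => p; rewrite row_mxEr.
  apply: (@measurable_coordE R _ W _ (fun p => p.2)); exact: measurable_snd.
rewrite openE => u /= [[/=]]; rewrite in_itv/= => v01 y0 Au.
have [e e0 he] := jump_nbhs oA v01 Au; have /andP[v0 v1] := v01.
set v := u _ _ in v01 y0 Au he v0 v1 *; set y := rsubmx u in y0 Au he *.
pose r := Num.min (Num.min e (enorm y)) (Num.min v (1 - v)).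
have r0 : 0 < r by rewrite !lt_min e0 v0 subr_gt0 v1 enorm_gt0.
have [re ry rv r1] : [/\ r <= e, r <= enorm y, r <= v & r <= 1 - v].
  by rewrite /r !ge_min !lexx !orbT.
apply/nbhs_enormP; exists r => // u' uu'.
have hv : `|u' ord0 (lshift d.+1 ord0) - v| < r.
  apply: le_lt_trans uu'; have := coord_le_enorm (u' - u) (lshift d.+1 ord0).
  by rewrite !mxE.
have hy : enorm (rsubmx u' - y) < r.
  apply: le_lt_trans uu'; rewrite /y -linearB /=; rewrite /enorm ler_sqrt; last first.
    by apply: sumr_ge0 => i _; exact: sqr_ge0.
  rewrite [leRHS]big_split_ord/= -[leLHS]add0r; apply: lerD.
    by apply: sumr_ge0 => i _; exact: sqr_ge0.
  by apply: ler_sum => i _; rewrite mxE.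
split; last first.
  apply: (he _ (rsubmx u')); [exact: lt_le_trans hv re|exact: lt_le_trans hy re|].
  by move=> t; rewrite subrr enorm0 ltW.
split=> /=.
  move: hv; rewrite ltr_distl in_itv/= => /andP[h1 h2]; apply/andP; split; lra.
apply/eqP => h; move: hy; rewrite h sub0r enormN ltNge ry //.
Qed.

Lemma measurable_polar_jump :
  measurable_fun setT (polar_jump : W -> borel (polar R d.+1)).
Proof.
apply: measurable_borel => U oU; apply: measurable_preimage_jump.
exact: measurable_jumps_in_open.
Qed.

Variable nu : {sigma_finite_measure set (borel V) -> \bar R}.
Hypothesis nu0 : nu [set 0] = 0%E.

Definition jump_measure : {measure set (borel (polar R d.+1)) -> \bar R} :=
  image_measure (unit_lebesgue \x nu)%E measurable_polar_jump.

Lemma proper_jumps_full : (unit_lebesgue \x nu)%E (~` proper_jumps) = 0%E.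
Proof.
have m0 := measurable_vec0.
pose A := (~` `]0:R, 1[%classic `*` [set: V]) : set W.
pose B := ([set: R] `*` [set 0 : V]) : set W.
have mA : measurable A.
  by apply: measurableX => //; apply: measurableC; exact: measurable_itv.
have mB : measurable B by apply: measurableX.
apply/eqP; rewrite eq_le measure_ge0 andbT.
apply: (@le_trans _ _ ((unit_lebesgue \x nu)%E (A `|` B))).
  apply: le_measure; rewrite ?inE//.
  - by apply: measurableC; exact: measurable_proper_jumps.
  - by apply: measurableU.
  move=> [v y] /= h; have [v01|v01] := pselect (`]0:R, 1[%classic v); last by left.
  by right; split => //=; apply: contrapT => /eqP y0; apply: h.
apply: le_trans (measureU2 _ mA mB) _.
have hA : (unit_lebesgue \x nu)%E A = 0%E.
  rewrite product_measure1E//; last by apply: measurableC; exact: measurable_itv.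
  by rewrite unit_lebesgueC mul0e.
have hB : (unit_lebesgue \x nu)%E B = 0%E.
  by rewrite product_measure1E// nu0 mule0.
apply: (@le_trans _ _ (0 + 0)%E); last by rewrite adde0.
by apply: leeD; rewrite le_eqVlt; apply/orP; left; apply/eqP; [exact: hA|exact: hB].
Qed.

Lemma jump_measureE A : measurable (jumps_in A) ->
  jump_measure A = (unit_lebesgue \x nu)%E (jumps_in A).
Proof.
move=> mA; have mA' := measurable_preimage_jump mA.
rewrite jumps_in_preimage in mA *.
change ((unit_lebesgue \x nu)%E (polar_jump @^-1` A) =
  (unit_lebesgue \x nu)%E (polar_jump @^-1` A `&` proper_jumps)).
rewrite [LHS](measureDI _ mA' measurable_proper_jumps).
rewrite [X in (X + _)%E](_ : _ = 0%E) ?add0e//.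
apply/eqP; rewrite eq_le measure_ge0 andbT -proper_jumps_full.
apply: le_measure; rewrite ?inE; last by move=> p [].
  by apply: measurableD => //; exact: measurable_proper_jumps.
by apply: measurableC; exact: measurable_proper_jumps.
Qed.

Lemma jump_measure_infinite : jump_measure infinite_radius = 0%E.
Proof.
change ((unit_lebesgue \x nu)%E (polar_jump @^-1` infinite_radius) = 0%E).
by rewrite (_ : _ @^-1` _ = set0) ?measure0//; apply/seteqP; split.
Qed.

Lemma jump_measure_single : jump_measure (~` polar_set single_jump) = 0%E.
Proof.
change ((unit_lebesgue \x nu)%E (polar_jump @^-1` (~` polar_set single_jump)) = 0%E).
rewrite (_ : _ @^-1` _ = set0) ?measure0//; apply/seteqP; split=> // p /=.
by have := polar_jump_single p.
Qed.

Lemma jump_measure_rectangle A (t : R) (C : set (borel V)) : 0 <= t <= 1 ->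
  measurable C -> ~ C 0 ->
  (forall v y, 0 < v < 1 -> y != 0 -> path_set A (jump v y) <-> v <= t /\ C y) ->
  jump_measure A = (t%:E * nu C)%E.
Proof.
move=> t01 mC C0 AC.
have jA : jumps_in A = (`]-oo, t]%classic `&` `]0:R, 1[%classic) `*` C.
  apply/seteqP; split=> -[v y]; rewrite /jumps_in /proper_jumps /= !in_itv/=.
    by move=> [[v01 y0]] /(AC _ _ v01 y0)[].
  move=> [[vt v01] Cy]; have y0 : y != 0 by apply: contra_notN C0 => /eqP <-.
  by split => //; apply/AC.
have mt : measurable (`]-oo, t]%classic `&` `]0:R, 1[%classic : set (measurableTypeR R)).
  by apply: measurableI; exact: measurable_itv.
rewrite jump_measureE; last by rewrite jA; exact: measurableX.
rewrite jA product_measure1E//; congr (_ * _)%E.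
rewrite -(unit_lebesgue_initial t01) /unit_lebesgue /= /mrestr.
by rewrite -setIA setIid.
Qed.

End jump_measure.

Section polar_balls.
Context {R : realType} {d : nat}.
Implicit Types (r : R) (B : set (polar R d)).

Definition far_paths r : set (polar R d) := [set z | (r%:E < Defs.radius z)%E].

Lemma inv_radius_gt0 r (z : polar R d) : 0 < r ->
  (r%:E < Defs.radius z)%E = (inv_radius z < r^-1).
Proof.
move=> r0; have := radius_gt0 z; rewrite /inv_radius.
case: (Defs.radius z) => [s||]//; rewrite ?lte_fin => s0.
  by rewrite /inve gt_eqF//= ltf_pV2 ?posrE.
by rewrite /= ltry invr_gt0 r0.
Qed.

Lemma metric_bounded_far B : metric_bounded B -> exists2 r, 0 < r & B `<=` far_paths r.
Proof.
move=> [K BK]; have [[z Bz]|B0] := pselect (B !=set0); last first.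
  by exists 1 => // z Bz; exfalso; apply: B0; exists z.
pose M := `|inv_radius z| + `|K| + 1.
have M0 : 0 < M by rewrite ltr_wpDl// addr_ge0.
exists M^-1 => [|w Bw]; rewrite ?invr_gt0//.
rewrite /far_paths /= inv_radius_gt0 ?invr_gt0// invrK.
have := BK _ _ Bz Bw; rewrite /mdist /= /polar_dist ge_max => /andP[+ _].
rewrite ler_distl => /andP[h1 h2].
have := ler_norm (inv_radius z); have := ler_norm K.
by rewrite /M; lra.
Qed.

Lemma open_far r : 0 < r -> open (far_paths r).
Proof.
move=> r0; rewrite openE => z; rewrite /far_paths /= inv_radius_gt0// => zr.
apply/nbhs_ballP; exists (r^-1 - inv_radius z) => /=; first by rewrite subr_gt0.
move=> w; rewrite ballEmdist /= => h; rewrite inv_radius_gt0//.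
have : `|inv_radius z - inv_radius w| < r^-1 - inv_radius z.
  by apply: le_lt_trans h; rewrite /mdist /= /polar_dist le_max lexx.
by rewrite ltr_distl => /andP[h1 h2]; lra.
Qed.

Lemma path_set_far r x : 0 < r -> path_set (far_paths r) x <-> r < supnorm x.
Proof.
move=> r0; rewrite path_setP /far_paths /=.
split=> [[x0]|rx]; first by rewrite lte_fin.
by exists (lt_trans r0 rx); rewrite lte_fin.
Qed.

End polar_balls.

(* [mu] with the proof of sigma-finiteness as an argument, so that the structure
   can be inferred. *)
Section sigma_finite_alias.
Context {R : realType} {dX} {X : measurableType dX}.
Variable mu : {measure set X -> \bar R}.

Definition sigma_finite_alias of sigma_finite setT mu : set X -> \bar R := mu.

Variable h : sigma_finite setT mu.

HB.instance Definition _ := Measure.copy (sigma_finite_alias h) mu.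
HB.instance Definition _ := Measure_isSigmaFinite.Build _ _ _ (sigma_finite_alias h) h.

End sigma_finite_alias.

Lemma path_set_polar {R : realType} {d : nat} (Q : set (@skorokhod R d)) x :
  path_set (polar_set Q) x <-> 0 < supnorm x /\ Q x.
Proof.
rewrite path_setP /polar_set /=; split=> [[x0 [_]]|[x0 Qx]].
  by rewrite cartesian_to_polar.
by exists x0; rewrite cartesian_to_polar.
Qed.

Section jump_measure_tail.
Context {R : realType} {d : nat}.
Local Notation V := 'rV[R]_d.+1.
Variables (nu : {sigma_finite_measure set (borel V) -> \bar R}) (alpha : R).
Hypothesis nu0 : nu [set 0] = 0%E.
Hypothesis nu_far : forall r, 0 < r -> nu [set x | r < enorm x] = (r `^ (- alpha))%:E.

Lemma jump_measure_far r : 0 < r ->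
  jump_measure nu (far_paths r) = (r `^ (- alpha))%:E.
Proof.
move=> r0; rewrite (@jump_measure_rectangle _ _ _ nu0 _ 1 [set x | r < enorm x]).
- by rewrite mul1e nu_far.
- by rewrite ler01 lexx.
- by apply: borel_open; exact: open_enorm_gt.
- by rewrite /= enorm0 ltNge (ltW r0).
move=> v y /andP[_ v1] y0; rewrite path_set_far// supnorm_jump ?(ltW v1)//.
by split=> [|[]].
Qed.

Lemma jump_measure_bounded : boundedly_finite (jump_measure nu).
Proof.
move=> B mB /metric_bounded_far[r r0 Br].
apply: (@le_lt_trans _ _ (jump_measure nu (far_paths r))).
  by apply: le_measure; rewrite ?inE//; apply: borel_open; exact: open_far.
by rewrite jump_measure_far// ltry.
Qed.

Lemma jump_measure_neq0 : jump_measure nu setT != 0%E.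
Proof.
rewrite gt_eqF//; apply: (@lt_le_trans _ _ (jump_measure nu (far_paths 1))).
  by rewrite jump_measure_far// lte_fin powR_gt0.
by apply: le_measure; rewrite ?inE//; apply: borel_open; exact: open_far.
Qed.

End jump_measure_tail.

Section flat_sigma_finite.
Context {R : realType} {d : nat}.
Local Notation E := (punctured_space R d).
Local Notation V := 'rV[R]_d.+1.
Variables (mu : {measure set (borel E) -> \bar R}) (alpha : R).
Hypothesis mu_infinite : mu infinite_points = 0%E.
Hypothesis mu_far : forall r, 0 < r ->
  flat mu [set x | r < enorm x] = (r `^ (- alpha))%:E.

Lemma flat0 : flat mu [set 0] = 0%E.
Proof.
have m0 : measurable ([set 0] : set (borel V)) by exact: measurable_vec0.
rewrite -mu_embed// (_ : embed _ = set0) ?measure0//.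
by apply/seteqP; split=> // y [fy /= y0]; have := retract_neq0 fy; rewrite y0 eqxx.
Qed.

Lemma flat_sigma_finite : sigma_finite setT (flat mu).
Proof.
have m0 : measurable ([set 0] : set (borel V)) by exact: measurable_vec0.
have mf n : measurable ([set x | n.+1%:R^-1 < enorm x] : set (borel V)).
  by apply: borel_open; exact: open_enorm_gt.
exists (fun n => [set 0] `|` [set x : V | n.+1%:R^-1 < enorm x]).
  apply/esym/seteqP; split=> // x _.
  have [->|x0] := eqVneq x 0; first by exists 0%N => //; left.
  have [k] := ltr_add_invr (enorm_gt0 x0); rewrite add0r => kx.
  by exists k => //; right.
move=> n; split; first exact: measurableU.
apply: le_lt_trans (measureU2 _ m0 (mf n)) _.
apply: (@le_lt_trans _ _ (0 + (n.+1%:R^-1 `^ (- alpha))%:E)%E); last by rewrite add0e ltry.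
apply: leeD; first by rewrite le_eqVlt; apply/orP; left; apply/eqP; exact: flat0.
by rewrite le_eqVlt; apply/orP; left; apply/eqP; apply: mu_far; rewrite invr_gt0.
Qed.

Lemma marginal_jump_measure (h : sigma_finite setT (flat mu)) (t : unit_itv R)
    (B : set (borel E)) : measurable B ->
  marginal (jump_measure (sigma_finite_alias h)) t B = ((\val t)%:E * mu B)%E.
Proof.
move=> mB; rewrite muE//.
rewrite /marginal (@jump_measure_rectangle _ _ (sigma_finite_alias h) flat0 _ (\val t) (finite_part B))//.
- exact: unit_itvP.
- exact: measurable_finite_part.
- by move=> [y _ /EFin_finite[fy y0]]; have := retract_neq0 fy; rewrite y0 eqxx.
move=> v y /andP[v0 v1] y0; rewrite path_set_polar supnorm_jump ?(ltW v1)//=.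
have fp0 : ~ finite_part B 0.
  by move=> [z _ /EFin_finite[fz z0]]; have := retract_neq0 fz; rewrite z0 eqxx.
by case: ifP => _; split=> [[]|[]]//; split=> //; exact: enorm_gt0.
Qed.

End flat_sigma_finite.

(** * Convergence of the path laws *)

Section path_events.
Context {R : realType} {dT} {T : measurableType dT} {d : nat}.
Local Notation D := (@skorokhod R d.+1).
Variable X : nat -> T -> borel 'rV[R]_d.+1.
Hypothesis mX : forall k, measurable_fun setT (X k).

Definition path_event (a : R) (n : nat) (B : set (polar R d.+1)) : set T :=
  [set w | path_set B (path_scale a (walk_path X n w))].

Let step_path (a : R) (n : nat) (M : 'M[R]_(n.+1, d.+1)) : D :=
  path_scale a (Skorokhod (cadlag_step n (fun k => row (inord k) M))).

Let step_index n (t : unit_itv R) : (Num.truncn (n%:R * \val t) < n.+1)%N.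
Proof.
have /andP[t0 t1] := unit_itvP t.
rewrite ltnS -(ler_nat R).
apply: (@le_trans _ _ (n%:R * \val t)); first by rewrite truncn_le mulr_ge0.
by rewrite ler_piMr.
Qed.

Lemma measurable_path_event_open a n U : open U -> measurable (path_event a n U).
Proof.
move=> oU.
pose f w : 'M[R]_(n.+1, d.+1) := \matrix_(i, j) walk X i w ord0 j.
rewrite (_ : path_event a n U = f @^-1` [set M | path_set U (step_path a M)]); last first.
  apply/seteqP; split=> w; rewrite /path_event /=; congr (path_set U _);
  apply/skorokhod_eqP => t /=; congr (_ *: _); apply/matrixP => i j;
  by rewrite !mxE (ord1 i) inordK ?step_index.
apply: measurable_mx_open => [i j|].
  rewrite (_ : (fun w => f w i j) = (fun w => walk X i w ord0 j)); last first.
    by apply/funext => w; rewrite mxE.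
  apply: (@measurable_coordE R _ T _ (walk X i)).
  exact: measurable_S.
rewrite openE => M /= UM; have [e e0 he] := path_set_sup_nbhs oU UM.
have e1 : 0 < e / (`|a| + 1) by rewrite divr_gt0// ltr_wpDl.
have rows : \forall M' \near M, forall i : 'I_n.+1, enorm (row i M' - row i M) < e / (`|a| + 1).
  suff h i : \forall M' \near M, enorm (row i M' - row i M) < e / (`|a| + 1).
    exact: (@filter_forall _ _ _ (nbhs M) _ h).
  refine (@cvg_enorm R _ _ (nbhs M) _ (row i) (row i M) _ _ e1).
  move=> A [Q nQ QA].
  exists (fun i' j => if i' == i then Q ord0 j else setT).
    by move=> i' j; case: eqP => [->|_]; [have := nQ ord0 j; rewrite mxE|exact: filterT].
  move=> M' hM'; apply: QA => i' j; rewrite (ord1 i') mxE.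
  by have := hM' i j; rewrite eqxx.
apply: filterS rows => M' hM'; apply: he => t /=.
rewrite -scalerBr enormZ.
apply: (@le_trans _ _ (`|a| * (e / (`|a| + 1)))).
  by rewrite ler_wpM2l// ltW.
by rewrite mulrCA ler_piMr ?(ltW e0)// ler_pdivrMr ?mul1r ?lerDl// ltr_wpDl.
Qed.

Lemma measurable_path_event a n (B : set (borel (polar R d.+1))) :
  measurable B -> measurable (path_event a n B).
Proof.
pose F := [set B : set (polar R d.+1) | measurable (path_event a n B)].
suff : <<s open >> `<=` F by move=> h mB; exact: h.
apply: smallest_sub; last by move=> U oU; exact: measurable_path_event_open.
have nonzero : measurable (path_event a n setT) by apply: measurable_path_event_open; exact: openT.
split=> [|A FA|A FA]; rewrite /F /=.
- rewrite (_ : path_event a n set0 = set0)//.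
  by apply/seteqP; split=> // w [z [[]]].
- rewrite (_ : path_event _ _ _ = path_event a n setT `\` path_event a n A).
    exact: measurableD.
  apply/seteqP; split=> w; rewrite /path_event /=.
    move=> /(path_setP _ _).1[x0 [_ nA]]; split; first by apply/path_setP; exists x0.
    by move=> /(path_setP _ _).1[x0' Ax0]; apply: nA; rewrite (to_polar_irr _ x0').
  move=> [/(path_setP _ _).1[x0 _] nA]; apply/path_setP; exists x0; split=> // Ax.
  by apply: nA; apply/path_setP; exists x0.
- rewrite (_ : path_event _ _ _ = \bigcup_i path_event a n (A i)).
    exact: bigcupT_measurable.
  apply/seteqP; split=> w; rewrite /path_event /=.
    by move=> /path_setP[x0 [i _ Ai]]; exists i => //; apply/path_setP; exists x0.
  by move=> [i _ /path_setP[x0 Ai]]; apply/path_setP; exists x0; exists i.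
Qed.

Lemma path_event_sub a n (A B : set (polar R d.+1)) : A `<=` B ->
  path_event a n A `<=` path_event a n B.
Proof. by move=> AB w /path_setP[x0 Ax]; apply/path_setP; exists x0; exact: AB. Qed.

Lemma path_event_far a n r w : 0 < r -> 0 < a ->
  path_event a n (far_paths r) w <-> max_gt X n (r / a) w.
Proof.
move=> r0 a0; rewrite /path_event /= path_set_far//; split.
  move=> /supnorm_gtP[t /=]; rewrite enormZ gtr0_norm// => h.
  exists (Num.truncn (n%:R * \val t)); first by rewrite -ltnS step_index.
  by rewrite ltr_pdivrMr// mulrC.
move=> [k kn h]; apply/supnorm_gtP.
have [n0|n0] := posnP n.
  exists (mk_unit_itv unit_itv0); rewrite /= enormZ gtr0_norm// mulr0 truncn0 mulrC -ltr_pdivrMr//.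
  by move: kn h; rewrite n0 leqn0 => /eqP ->.
have kn01 : 0 <= (k%:R / n%:R : R) <= 1.
  apply/andP; split; first exact: divr_ge0.
  by rewrite ler_pdivrMr ?ltr0n// mul1r ler_nat.
exists (mk_unit_itv kn01); rewrite /= enormZ gtr0_norm// mulrC -ltr_pdivrMr//.
by rewrite [n%:R * _]mulrC divfK ?pnatr_eq0 -?lt0n// natrK.
Qed.

End path_events.

Section lower_limits.
Context {R : realType}.

Lemma limn_einf_ge (u : (\bar R)^nat) (c : \bar R) :
  (\forall n \near \oo, c <= u n)%E -> (c <= limn_einf u)%E.
Proof.
move=> [N _ cu]; rewrite limn_einf_lim; apply: lime_ge; first exact: is_cvg_einfs.
exists N => // n /= Nn; apply: le_ereal_inf_tmp => _ [k /= nk <-].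
by apply: cu => /=; exact: leq_trans nk.
Qed.

Lemma limn_einf_gt (u : (\bar R)^nat) (c : \bar R) :
  (c < limn_einf u)%E -> (\forall n \near \oo, c < u n)%E.
Proof.
move=> cu; apply: contrapT => nc.
suff : (limn_einf u <= c)%E by rewrite leNgt cu.
rewrite limn_einf_lim; apply: lime_le; first exact: is_cvg_einfs.
apply: nearW => n; rewrite leNgt; apply/negP => h; apply: nc.
exists n => // k /= nk; apply: lt_le_trans h _.
by apply: ereal_inf_lbound; exists k.
Qed.

Lemma lt_fin_between (c : R) (x : \bar R) : (c%:E < x)%E ->
  exists2 c' : R, c < c' & (c'%:E < x)%E.
Proof.
case: x => [x||]//.
  rewrite lte_fin => cx; exists ((c + x) / 2); first lra.
  by rewrite lte_fin; lra.
by move=> _; exists (c + 1); [lra|exact: ltry].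
Qed.

End lower_limits.

Section path_lower.
Context {R : realType} {dT} {T : measurableType dT} (P : probability T R).
Context {d : nat} (X : nat -> T -> borel 'rV[R]_d.+1).
Local Notation V := 'rV[R]_d.+1.
Hypothesis mX : forall k, measurable_fun setT (X k).
Hypothesis indX : independent_family P X.
Hypothesis idX : identically_distributed P X.
Variables (alpha : R) (lam : nat -> R).
Let G u := pr P [set w | u < enorm (X 0%N w)].
Let tau n := n%:R * G (lam n).
Hypothesis lam_oo : lam @ \oo --> +oo.
Hypothesis drop_small : forall e del, 0 < e -> 0 < del -> \forall n \near \oo,
  forall k, (0 < k <= n)%N -> pr P (drop_gt X k n (e * lam n)) <= del.
Variable nu : {sigma_finite_measure set (borel V) -> \bar R}.
Hypothesis nu_open : forall r (O : set V) c, 0 < r -> open O ->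
  O `<=` [set x | r < enorm x] -> (c%:E < nu O)%E ->
  \forall u \near +oo, c * G u <= pr P [set w | O (u^-1 *: X 0%N w)].

Lemma walk_path_near_jump n k a e w t : (0 < k <= n)%N -> 0 < a ->
  ~ drop_gt X k n (e * a) w ->
  enorm (path_scale a^-1 (walk_path X n w) t -
         jump (k%:R / n%:R) (a^-1 *: (X k w : V)) t) <= e.
Proof.
move=> /andP[k0 kn] a0 nd; have n0 : (0 < n)%N by exact: leq_trans kn.
have /andP[t0 t1] := unit_itvP t.
set j := Num.truncn (n%:R * \val t).
have jn : (j <= n)%N.
  rewrite -(ler_nat R); apply: (@le_trans _ _ (n%:R * \val t)); first by rewrite truncn_le mulr_ge0.
  by rewrite ler_piMr.
have kj : (k <= j)%N = (k%:R / n%:R <= \val t :> R).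
  by rewrite truncn_ge_nat ?mulr_ge0// ler_pdivrMr ?ltr0n// mulrC.
have -> : path_scale a^-1 (walk_path X n w) t - jump (k%:R / n%:R) (a^-1 *: (X k w : V)) t =
    a^-1 *: drop_step X k j w.
  rewrite /= -/j /walk (drop_stepE X j w k0) -kj.
  by case: (k <= j)%N; rewrite ?subr0 ?addr0// scalerDr addrK.
rewrite enormZ gtr0_norm ?invr_gt0// mulrC ler_pdivrMr// leNgt.
by apply/negP => h; apply: nd; exists j.
Qed.

Variables (U : set (polar R d.+1)) (r : R).
Hypothesis r0 : 0 < r.
Hypothesis oU : open U.
Hypothesis Ur : U `<=` far_paths r.

Let ball_jump v e : set V := [set y : V | forall v' (x : @skorokhod R d.+1), `|v' - v| < e ->
  (forall t, enorm (x t - jump v' y t) <= e) -> path_set U x].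

Let core v e : set V := interior (ball_jump v e) `&` [set y | r < enorm y].

Let core_open v e : open (core v e).
Proof. by apply: openI; [exact: open_interior|exact: open_enorm_gt]. Qed.

Let core_le v e e' : e' <= e -> core v e `<=` core v e'.
Proof.
move=> ee y [iy ry]; split => //; apply: filterS iy => z hz v' x hv hx.
apply: (hz v') => //; first exact: lt_le_trans ee.
by move=> t; apply: le_trans ee.
Qed.

Let core_jump v y : 0 < v < 1 -> path_set U (jump v y) -> exists j : nat, core v j.+1%:R^-1 y.
Proof.
move=> v01 Uy; have [e e0 he] := jump_nbhs oU v01 Uy.
have [j] := ltr_add_invr e0; rewrite add0r => je; exists j; split; last first.
  have /andP[_ /ltW v1] := v01; rewrite /= -(supnorm_jump y v1); apply/path_set_far => //.
  by have /path_setP[x0 Ux] := Uy; apply/path_setP; exists x0; exact: Ur.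
apply/nbhs_enormP; exists e => // z zy v' x hv hx.
apply: (he v' z) => //; first exact: lt_trans je.
by move=> t; apply: le_trans (hx t) (ltW je).
Qed.

Definition jump_section v : set (borel V) := xsection (jumps_in U) v.

Lemma measurable_jump_section v : measurable (jump_section v).
Proof. by apply: measurable_xsection; exact: measurable_jumps_in_open. Qed.

Lemma jump_sectionE v y : jump_section v y ->
  0 < v < 1 /\ path_set U (jump v y).
Proof. by rewrite /jump_section /xsection /= inE => -[[/=]]; rewrite in_itv. Qed.

(* Discarding the paths with a second large step makes these events disjoint
   for distinct [k]. *)
Definition jump_event n k : set T := path_event X (lam n)^-1 n U `&`
  ([set w | r * lam n < enorm (X k w)] `&` ~` drop_gt X k n (r / 4 * lam n)).

Lemma measurable_jump_event n k : measurable (jump_event n k).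
Proof.
apply: measurableI; first exact: measurable_path_event_open.
apply: measurableI; first exact: measurable_enorm_gt.
by apply: measurableC; exact: measurable_drop_gt.
Qed.

Lemma jump_event_disjoint n k l w : (0 < l <= n)%N -> k != l ->
  jump_event n k w -> jump_event n l w -> False.
Proof.
case: l => // l ln kl [_ [_ nd]] [_ [/= rX _]].
have hd j : (j <= n)%N -> enorm (drop_step X k j w) <= r / 4 * lam n.
  by move=> jn; rewrite leNgt; apply/negP => h; apply: nd; exists j.
have hX : drop_step X k l.+1 w = drop_step X k l w + (X l.+1 w : V).
  by rewrite /drop_step big_mkcond big_nat_recr//= -big_mkcond eq_sym kl.
have XE : (X l.+1 w : V) = - drop_step X k l w + drop_step X k l.+1 w.
  by rewrite hX addKr.
have h1 := hd _ ln; have h2 := hd _ (ltnW ln).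
have := enorm_triangle (- drop_step X k l w) (drop_step X k l.+1 w).
rewrite -XE enormN; have := enorm_ge0 (X l.+1 w : V).
by move: rX; lra.
Qed.

Lemma sum_jump_event n : \sum_(j < n) pr P (jump_event n j.+1) <=
  pr P (path_event X (lam n)^-1 n U).
Proof.
pose A j := if (j < n)%N then jump_event n j.+1 else set0.
have mA j : measurable (A j).
  by rewrite /A; case: ifP => // _; exact: measurable_jump_event.
have -> : \sum_(j < n) pr P (jump_event n j.+1) = \sum_(j < n) pr P (A j).
  by apply: eq_bigr => j _; rewrite /A ltn_ord.
rewrite -pr_bigcup//.
  apply: le_pr; first exact: bigsetU_measurable.
    exact: measurable_path_event_open.
  by rewrite -bigcup_mkord => w [j /= jn]; rewrite /A jn => -[].
apply/trivIsetP => i j _ _ ij; apply/seteqP; split=> // w; rewrite /A.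
case: ifP => [_|_ []//]; case: ifP => [jn|_ []//] [h1 h2].
by apply: (@jump_event_disjoint n i.+1 j.+1 w); rewrite ?jn// eqSS.
Qed.

Lemma jump_event_lower v c : 0 < v < 1 -> (c%:E < nu (jump_section v))%E ->
  \forall n \near \oo, c * G (lam n) <= pr P (jump_event n (Num.truncn (n%:R * v)).+1).
Proof.
move=> v01 cnu; have /andP[v0 v1] := v01.
have [c0|c0] := leP c 0.
  apply: nearW => n; apply: (@le_trans _ _ 0); last exact: pr_ge0.
  by rewrite mulr_le0_ge0// pr_ge0.
have [c1 cc1 c1nu] := lt_fin_between cnu.
have c10 : 0 < c1 by exact: lt_trans cc1.
have [j cj] : exists j : nat, (c1%:E < nu (core v j.+1%:R^-1%R))%E.
  apply: contrapT => nj.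
  pose F j := core v j.+1%:R^-1 : set (borel V).
  have mF j : measurable (F j) by apply: borel_open; exact: core_open.
  have mUF : measurable (\bigcup_j F j) by exact: bigcupT_measurable.
  have F_le : {homo F : n m / (n <= m)%N >-> (n <= m)%O}.
    move=> n m nm; apply/subsetPset; apply: core_le.
    by rewrite lef_pV2 ?posrE// ler_nat.
  have cF := nondecreasing_cvg_mu (mu := nu) mF mUF F_le.
  have : (nu (\bigcup_j F j) <= c1%:E)%E.
    rewrite -(cvg_lim (@ereal_hausdorff R) cF); apply: lime_le.
      by apply/cvg_ex; exists (nu (\bigcup_j F j)).
    by apply: nearW => j; rewrite leNgt; apply/negP => h; apply: nj; exists j.
  rewrite leNgt => /negP; apply; apply: lt_le_trans c1nu _.
  apply: le_measure; rewrite ?inE//; first exact: measurable_jump_section.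
  by move=> y /jump_sectionE[_ /(core_jump v01)[j Fj]]; exists j.
pose e := Num.min j.+1%:R^-1 (r / 4).
have e0 : 0 < e by rewrite lt_min invr_gt0 ltr0n divr_gt0.
have er : e <= r / 4 by rewrite ge_min lexx orbT.
have {}cj : (c1%:E < nu (core v e))%E.
  apply: lt_le_trans cj _; apply: le_measure; rewrite ?inE.
  - by apply: borel_open; exact: core_open.
  - by apply: borel_open; exact: core_open.
  - by apply: core_le; rewrite ge_min lexx.
have del0 : 0 < 1 - c / c1 by rewrite subr_gt0 ltr_pdivrMr// mul1r.
have core_r : core v e `<=` [set x | r < enorm x] by move=> y [].
near=> n.
set k := (Num.truncn (n%:R * v)).+1.
have n0 : (0 < n)%N by near: n; exact: nbhs_infty_gt.
have kn : (0 < k <= n)%N by rewrite /k /= truncn_lt_nat ?mulr_ge0 ?(ltW v0)// gtr_pMr ?ltr0n.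
have ln0 : 0 < lam n by near: n; move/cvgryPgt : lam_oo; exact.
have h1 : c1 * G (lam n) <= pr P [set w | core v e ((lam n)^-1 *: X 0%N w)].
    by near: n; exact: (lam_oo (nu_open r0 (@core_open v e) core_r cj)).
have h2 : pr P (drop_gt X k n (e * lam n)) <= 1 - c / c1.
  apply: (near (drop_small e0 del0) n) => //.
have kv : `|k%:R / n%:R - v| < e.
  have nR : 0 < n%:R :> R by rewrite ltr0n.
  have nv : 0 <= n%:R * v by rewrite mulr_ge0 ?(ltW v0).
  have /andP[q1 q2] := truncn_itv nv.
  have q3 : e^-1 < n%:R by near: n; exact: nbhs_infty_gtr.
  have q4 : n%:R^-1 < e by rewrite invf_plt ?posrE.
  apply: le_lt_trans q4; rewrite ger0_norm ?subr_ge0; last first.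
    by rewrite ler_pdivlMr// mulrC ltW.
  rewrite lerBlDr ler_pdivrMr// mulrDl mulVf ?gt_eqF// /k -natr1 addrC lerD2l.
  by rewrite [leRHS]mulrC.
pose B := [set y : V | core v e ((lam n)^-1 *: y)].
have mB : measurable (B : set (borel V)).
  have := @measurable_vecZ R _ (borel V) _ id (lam n)^-1 (@measurable_id _ _ _).
  move=> /(_ measurableT _ (borel_open (@core_open v e))); rewrite setTI; exact.
apply: (@le_trans _ _ (pr P (X k @^-1` B `&` ~` drop_gt X k n (e * lam n)))); last first.
  apply: le_pr; last 1 first.
  - move=> w [[Bw rw] nd]; split; last split => /=; last first.
    - by move=> [i ni h]; apply: nd; exists i => //; apply: le_lt_trans h; rewrite ler_pM2r.
    - by move: rw; rewrite /= enormZ gtr0_norm ?invr_gt0// mulrC ltr_pdivlMr.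
      have bj : ball_jump v e ((lam n)^-1 *: (X k w : V)) by exact: interior_subset Bw.
      apply: (bj _ _ kv) => t; exact: walk_path_near_jump.
  - apply: measurableI; last by apply: measurableC; exact: measurable_drop_gt.
    by rewrite -[X in measurable X]setTI; exact: mX.
  - exact: measurable_jump_event.
have -> : pr P (X k @^-1` B `&` ~` drop_gt X k n (e * lam n)) =
    pr P (X 0%N @^-1` B) * pr P (~` drop_gt X k n (e * lam n)).
  have [_ kn'] := andP kn.
  by apply: (pr_indep_drop mX indX idX kn' mB); right.
rewrite prC; last exact: measurable_drop_gt.
apply: (@le_trans _ _ (c1 * G (lam n) * (c / c1))).
  by rewrite mulrAC [c1 * _]mulrC divfK ?gt_eqF.
apply: ler_pM => //; last lra.
- by rewrite mulr_ge0 ?(ltW c10)// pr_ge0.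
- by rewrite divr_ge0// ltW.
Unshelve. all: by end_near. Qed.

Hypothesis G_gt0 : forall u, 0 < G u.
Hypothesis nu0 : nu [set 0] = 0%E.

Let cell n j : set R := `[(j%:R / n%:R), (j.+1%:R / n%:R)[%classic.

Let density n v : \bar R :=
  (\sum_(j < n) (pr P (jump_event n j.+1) / G (lam n) * \1_(cell n j) v)%:E)%E.

Let density_ge0 n v : (0 <= density n v)%E.
Proof.
by apply: sume_ge0 => j _; rewrite lee_fin mulr_ge0 ?divr_ge0 ?pr_ge0 ?(ltW (G_gt0 _)).
Qed.

Let measurable_cell n j : measurable (cell n j).
Proof. exact: measurable_itv. Qed.

Let measurable_density n : measurable_fun setT (density n : measurableTypeR R -> \bar R).
Proof.
apply: emeasurable_sum => j; apply/measurable_EFinP; apply: measurable_funM => //.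
by apply: measurable_indic; exact: measurable_cell.
Qed.

Let integral_density n : (0 < n)%N ->
  (\int[unit_lebesgue]_v density n v <=
   (pr P (path_event X (lam n)^-1 n U) / (n%:R * G (lam n)))%:E)%E.
Proof.
move=> n0; rewrite ge0_integral_sum//; last 2 first.
- move=> j; apply/measurable_EFinP; apply: measurable_funM => //.
  by apply: measurable_indic; exact: measurable_cell.
- by move=> j v _; rewrite lee_fin mulr_ge0 ?divr_ge0 ?pr_ge0 ?(ltW (G_gt0 _)).
apply: (@le_trans _ _ (\sum_(j < n) (pr P (jump_event n j.+1) / G (lam n) / n%:R)%:E)%E).
  apply: lee_sum => j _.
  under eq_integral do rewrite EFinM.
  rewrite ge0_integralZl//; last 2 first.
  - by apply/measurable_EFinP; apply: measurable_indic; exact: measurable_cell.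
  - by rewrite lee_fin divr_ge0 ?pr_ge0 ?(ltW (G_gt0 _)).
  rewrite integral_indic; last exact: measurable_cell.
  rewrite setIT [leRHS]EFinM; apply: lee_wpmul2l.
    by rewrite lee_fin divr_ge0 ?pr_ge0 ?(ltW (G_gt0 _)).
  apply: le_trans (unit_lebesgue_le (measurable_cell n j)) _.
  rewrite lebesgue_measure_itv/= lte_fin ltr_pM2r ?invr_gt0 ?ltr0n// ltr_nat ltnSn.
  by rewrite -EFinB lee_fin -mulrBl -natrB ?leqnSn// subSnn mul1r.
  exact: measurableT.
rewrite sumEFin lee_fin -!mulr_suml -mulrA -invfM.
rewrite [n%:R * _]mulrC ler_pM2r; first exact: sum_jump_event.
by rewrite invr_gt0 mulr_gt0 ?ltr0n.
Qed.

Let nu_le_density v : (nu (jump_section v) <= limn_einf (density^~ v))%E.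
Proof.
have l0 : (0 <= limn_einf (density^~ v))%E.
  by apply: limn_einf_ge; apply: nearW => n; exact: density_ge0.
have [v01|nv] := boolP (0 < v < 1); last first.
  rewrite (_ : jump_section v = set0) ?measure0//.
  by apply/seteqP; split=> // y /jump_sectionE[v01]; rewrite v01 in nv.
rewrite leNgt; apply/negP => h.
have lf : limn_einf (density^~ v) \is a fin_num.
  by rewrite ge0_fin_numE//; apply: lt_le_trans h (leey _).
have [c lc ch] : exists2 c : R, fine (limn_einf (density^~ v)) < c &
    (c%:E < nu (jump_section v))%E.
  by apply: lt_fin_between; rewrite fineK.
suff : (c%:E <= limn_einf (density^~ v))%E.
  by rewrite -(fineK lf) lee_fin leNgt lc.
apply: limn_einf_ge; near=> n.
have hn : c * G (lam n) <= pr P (jump_event n (Num.truncn (n%:R * v)).+1).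
  by near: n; exact: jump_event_lower.
have n0 : (0 < n)%N by near: n; exact: nbhs_infty_gt.
have /andP[v0 v1] := v01.
have jn : (Num.truncn (n%:R * v) < n)%N.
  by rewrite truncn_lt_nat ?mulr_ge0 ?(ltW v0)// gtr_pMr ?ltr0n.
rewrite /density (bigD1 (Ordinal jn))//= -[c%:E]adde0; apply: leeD; last first.
  by apply: sume_ge0 => j _; rewrite lee_fin mulr_ge0 ?divr_ge0 ?pr_ge0 ?(ltW (G_gt0 _)).
rewrite indicE mem_set ?mulr1; first by rewrite lee_fin ler_pdivlMr.
have nR : 0 < n%:R :> R by rewrite ltr0n.
have nv : 0 <= n%:R * v by rewrite mulr_ge0 ?(ltW v0).
have /andP[q1 q2] := truncn_itv nv.
by rewrite /cell /= in_itv/= ler_pdivrMr// ltr_pdivlMr// [v * _]mulrC q1 q2.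
Unshelve. all: by end_near. Qed.

(* Fatou's lemma over the position [v] of the jump. *)
Lemma path_event_lower c : (c%:E < jump_measure nu U)%E ->
  \forall n \near \oo, c * tau n <= pr P (path_event X (lam n)^-1 n U).
Proof.
rewrite jump_measureE//; last exact: measurable_jumps_in_open.
move=> h; have cU : (c%:E < \int[unit_lebesgue]_v nu (jump_section v))%E by exact: h.
have : (c%:E < limn_einf (fun n => \int[unit_lebesgue]_v density n v))%E.
  apply: lt_le_trans cU _.
  apply: (@le_trans _ _ (\int[unit_lebesgue]_v limn_einf (density^~ v))%E).
    apply: ge0_le_integral => //.
    - apply: (measurable_fun_xsection nu); exact: measurable_jumps_in_open.
    - apply: (measurableT_comp (@oppe_measurable R setT)).
      apply: (measurable_fun_limn_esup (f := fun n v => (- density n v)%E)) => n.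
      apply: (measurableT_comp (@oppe_measurable R setT)); exact: measurable_density.
  by apply: fatou.
move=> /limn_einf_gt hU; near=> n.
have n0 : (0 < n)%N by near: n; exact: nbhs_infty_gt.
have : (c%:E < \int[unit_lebesgue]_v density n v)%E by near: n.
move=> /lt_le_trans/(_ (integral_density n0)); rewrite lte_fin => /ltW.
by rewrite ler_pdivlMr// mulr_gt0// ltr0n.
Unshelve. all: by end_near. Qed.

End path_lower.

Section path_cvg.
Context {R : realType} {dT} {T : measurableType dT} (P : probability T R).
Context {d : nat} (X : nat -> T -> borel 'rV[R]_d.+1).
Hypothesis mX : forall k, measurable_fun setT (X k).
Variables (alpha : R) (lam tau : nat -> R).
Hypothesis lam_oo : lam @ \oo --> +oo.
Hypothesis tau_gt0 : forall n, (0 < n)%N -> 0 < tau n.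
Variable m : {measure set (borel (polar R d.+1)) -> \bar R}.
Hypothesis m_far : forall r, 0 < r -> m (far_paths r) = (r `^ (- alpha))%:E.
Hypothesis lower : forall r U c, 0 < r -> open U -> U `<=` far_paths r ->
  (c%:E < m U)%E ->
  \forall n \near \oo, c * tau n <= pr P (path_event X (lam n)^-1 n U).
Hypothesis upper : forall r c, 0 < r -> r `^ (- alpha) < c ->
  \forall n \near \oo, pr P (max_gt X n (r * lam n)) <= c * tau n.

Lemma pr_disjoint_le (A B C : set T) : measurable A -> measurable B -> measurable C ->
  A `&` B = set0 -> A `<=` C -> B `<=` C -> pr P A + pr P B <= pr P C.
Proof.
move=> mA mB mC AB0 AC BC; rewrite -lee_fin EFinD -!prE//.
rewrite -measureU//; apply: le_measure; rewrite ?inE//.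
  exact: measurableU.
by move=> w [/AC|/BC].
Qed.

Lemma path_event_disjoint a n (A B : set (polar R d.+1)) : A `&` B = set0 ->
  path_event X a n A `&` path_event X a n B = set0.
Proof.
move=> AB; apply/seteqP; split=> // w [/(path_setP _ _).1[x0 Ax] /(path_setP _ _).1[x1 Bx]].
by rewrite (to_polar_irr _ x0) in Bx; suff : (A `&` B) (to_polar x0) by rewrite AB.
Qed.

Lemma path_event_cvg : hat_cvg (fun n B => ((tau n)^-1%:E *
  P [set w | path_set B (path_scale (lam n)^-1%R (walk_path X n w))])%E) m.
Proof.
move=> B mB bB mbd; have [r r0 Br] := metric_bounded_far bB.
have oI : open (interior B) by exact: open_interior.
have oF := @open_far R d.+1 r r0.
have oC : open (far_paths r `\` closure B).
  by rewrite setDE; apply: openI => //; apply: closed_openC; exact: closed_closure.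
have mI : measurable (interior B : set (borel (polar R d.+1))) by exact: borel_open.
have mF : measurable (far_paths r : set (borel (polar R d.+1))) by exact: borel_open.
have mC : measurable (closure B : set (borel (polar R d.+1))).
  by apply: borel_closed; exact: closed_closure.
have mFC : measurable (far_paths r `\` closure B : set (borel (polar R d.+1))).
  by exact: borel_open.
have mbdB : measurable (boundary B : set (borel (polar R d.+1))) by exact: measurableD.
have clB : (m (closure B) <= m (interior B))%E.
  apply: (@le_trans _ _ (m (interior B) + m (boundary B))%E); last by rewrite mbd adde0.
  apply: le_trans (measureU2 _ mI mbdB); apply: le_measure; rewrite ?inE//.
    exact: measurableU.
  move=> z cz; have [iz|iz] := pselect (interior B z); first by left.
  by right.
have mBI : m B = m (interior B).
  apply/eqP; rewrite eq_le; apply/andP; split.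
    apply: le_trans clB; apply: le_measure; rewrite ?inE//; exact: subset_closure.
  by apply: le_measure; rewrite ?inE//; exact: interior_subset.
have mBF : (m B <= (r `^ (- alpha))%:E)%E.
  by rewrite -m_far//; apply: le_measure; rewrite ?inE.
have fB : m B \is a fin_num by rewrite ge0_fin_numE// (le_lt_trans mBF)// ltry.
rewrite -(fineK fB); set b := fine (m B).
have mBb : m B = b%:E by rewrite /b fineK.
have mEv n (A : set (borel (polar R d.+1))) : measurable A ->
    measurable (path_event X (lam n)^-1 n A).
  exact: measurable_path_event.
suff cb : (tau n)^-1 * pr P (path_event X (lam n)^-1 n B) @[n --> \oo] --> b.
  apply: cvg_trans (_ : ((tau n)^-1 * pr P (path_event X (lam n)^-1 n B))%:E @[n --> \oo] --> _).
    apply: near_eq_cvg; apply: nearW => n; rewrite EFinM -prE//; exact: mEv.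
  by apply: cvg_EFin; [exact: nearW|exact: cb].
have FCm e : 0 < e -> ((r `^ (- alpha) - b - e)%:E < m (far_paths r `\` closure B))%E.
  move=> e0; have h : ((r `^ (- alpha))%:E <= m (far_paths r `\` closure B) + b%:E)%E.
    rewrite -mBb mBI -m_far//.
    apply: (@le_trans _ _ (m (far_paths r `\` closure B) + m (closure B))%E); last exact: leeD.
    apply: le_trans (measureU2 _ mFC mC); apply: le_measure; rewrite ?inE//.
      exact: measurableU.
    move=> z fz; have [cz|cz] := pselect (closure B z); first by right.
    by left.
  move: h; case: (m _) => [x||]; rewrite ?ltry//.
    by rewrite -EFinD !lee_fin lte_fin; lra.
apply/cvgrPdist_le => e e0.
have e2 : 0 < e / 2 by rewrite divr_gt0.
have I_b : ((b - e)%:E < m (interior B))%E by rewrite -mBI mBb lte_fin gtrBl.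
have IF : interior B `<=` far_paths r by apply: subset_trans Br; exact: interior_subset.
have FCF : far_paths r `\` closure B `<=` far_paths r by move=> z [].
have rc : r `^ (- alpha) < r `^ (- alpha) + e / 2 by rewrite ltrDl.
near=> n.
have n0 : (0 < n)%N by near: n; exact: nbhs_infty_gt.
have t0 := tau_gt0 n0.
have l0 : 0 < lam n by near: n; move/cvgryPgt : lam_oo; exact.
have h1 : (b - e) * tau n <= pr P (path_event X (lam n)^-1 n (interior B)).
  by near: n; exact: (lower r0 oI IF I_b).
have h2 : (r `^ (- alpha) - b - e / 2) * tau n <=
    pr P (path_event X (lam n)^-1 n (far_paths r `\` closure B)).
  by near: n; exact: (lower r0 oC FCF (FCm _ e2)).
have h3 : pr P (max_gt X n (r * lam n)) <= (r `^ (- alpha) + e / 2) * tau n.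
  by near: n; exact: upper.
have h4 : pr P (path_event X (lam n)^-1 n (interior B)) <= pr P (path_event X (lam n)^-1 n B).
  apply: le_pr; [exact: mEv|exact: mEv|].
  by apply: path_event_sub; exact: interior_subset.
have h5 : pr P (path_event X (lam n)^-1 n B) +
    pr P (path_event X (lam n)^-1 n (far_paths r `\` closure B)) <=
    pr P (path_event X (lam n)^-1 n (far_paths r)).
  apply: pr_disjoint_le; [exact: mEv..| | |].
  - apply: path_event_disjoint; apply/seteqP; split=> // z [Bz [_]].
    by apply; exact: subset_closure.
  - exact: path_event_sub.
  - exact: path_event_sub.
have h6 : path_event X (lam n)^-1 n (far_paths r) = max_gt X n (r * lam n).
  apply/seteqP; split=> w; rewrite path_event_far ?invr_gt0// invrK//.
rewrite h6 in h5.
have v1 : b - e <= (tau n)^-1 * pr P (path_event X (lam n)^-1 n B).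
  by rewrite mulrC ler_pdivlMr//; exact: le_trans h1 h4.
have v2 : (tau n)^-1 * pr P (path_event X (lam n)^-1 n B) <= b + e.
  by rewrite mulrC ler_pdivrMr//; move: h2 h3 h5; lra.
by rewrite ler_distl; apply/andP; split; [move: v2|move: v1]; lra.
Unshelve. all: by end_near. Qed.

End path_cvg.

Theorem theorem2p1 (R : realType) (d : nat) (dT : measure_display)
    (T : measurableType dT) (P : probability T R)
    (Z : {RV P >-> borel 'rV[R]_d.+1})
    (Z_ : nat -> {RV P >-> borel 'rV[R]_d.+1})
    (alpha : R) (mu : {measure set (borel (punctured_space R d)) -> \bar R})
    (lam : nat -> R) :
  (* Z, Z_1, Z_2, ... are i.i.d.; Z_ 0 is not used *)
  let ZZ := fun n : nat => if n == 0%N then Z else Z_ n in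
  independent_family P ZZ ->
  identically_distributed P ZZ ->
  0 < alpha ->
  regularly_varying P Z alpha mu ->
  (forall n, (0 < n)%N -> 0 < lam n) ->
  (forall k n, (0 < k <= n)%N -> lam k <= lam n) ->
  lam n @[n --> \oo] --> +oo ->
  (alpha < 2 -> cvg_probability0 P (fun n w => (lam n)^-1 *: walk Z_ n w)) ->
  (alpha = 2 ->
    cvg_probability0 P (fun n w => (lam n)^-1 *: walk Z_ n w) /\
    exists2 g : R, 0 < g &
      lam n / Num.sqrt (n%:R `^ (1 + g)) @[n --> \oo] --> +oo) ->
  (2 < alpha ->
    cvg_probability0 P (fun n w => (lam n)^-1 *: walk Z_ n w) /\
    lam n / Num.sqrt (n%:R * ln n%:R) @[n --> \oo] --> +oo) ->
  exists m : {measure set (borel (polar R d.+1)) -> \bar R},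
    [/\ large_deviations P (walk_path Z_)
          (fun n => (n%:R * fine (tail_prob P Z (lam n)))^-1) lam m,
        m (~` polar_set single_jump) = 0%E &
        forall (t : unit_itv R) (B : set (punctured_space R d)),
          <<s open >> B -> marginal m t B = ((\val t)%:E * mu B)%E].
Proof.
move=> ZZ indZ idZ alpha0 rv lam_gt0 lam_mono lam_oo slow crit fast.
pose X n : T -> borel 'rV[R]_d.+1 := ZZ n.
have mX k : measurable_fun setT (X k) by exact: measurable_funPT.
have indX : independent_family P X by exact: indZ.
have idX : identically_distributed P X by exact: idZ.
have walkE n w : walk Z_ n w = walk X n w.
  by apply: eq_big_nat => -[|k].
have S_small : cvg_probability0 P (fun n w => (lam n)^-1 *: walk X n w).
  have : cvg_probability0 P (fun n w => (lam n)^-1 *: walk Z_ n w).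
    by case: (ltgtP alpha 2) => [/slow|/fast[]|/crit[]].
  by move=> h e e0; have := h e e0; under eq_fun do under eq_set do rewrite walkE.
have mZ := mX 0%N.
pose G u := pr P [set w | u < enorm (X 0%N w)].
have G_gt0 u : 0 < G u by exact: (rv_tail_gt0 mZ rv).
have G_ge := rv_tail_ge mZ alpha0 rv.
have G_le := rv_tail_le mZ alpha0 rv.
have lam2 : alpha = 2 -> exists2 g : R, 0 < g &
    lam n / Num.sqrt (n%:R `^ (1 + g)) @[n --> \oo] --> +oo by move=> /crit[].
have lam_gt2 : 2 < alpha -> lam n / Num.sqrt (n%:R * ln n%:R) @[n --> \oo] --> +oo.
  by move=> /fast[].
have mu_infinite : mu infinite_points = 0%E by case: rv.
have mu_far r : 0 < r -> flat mu [set x | r < enorm x] = (r `^ (- alpha))%:E.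
  by move=> r0; exact: (rv_flat_far mZ rv r0).
have sf := flat_sigma_finite mu_infinite mu_far.
pose nu : {sigma_finite_measure set (borel 'rV[R]_d.+1) -> \bar R} :=
  sigma_finite_alias sf.
have nu0 : nu [set 0] = 0%E := flat0 mu_infinite.
have nu_far r : 0 < r -> nu [set x | r < enorm x] = (r `^ (- alpha))%:E := @mu_far r.
pose tau n := n%:R * G (lam n).
have tau_gt0 n : (0 < n)%N -> 0 < tau n by move=> n0; rewrite mulr_gt0// ltr0n.
have tau0 : tau @ \oo --> (0 : R) := tau_cvg0 mX indX idX G_gt0 lam_mono lam_oo S_small.
have gamE n : (n%:R * fine (tail_prob P Z (lam n)))^-1 = (tau n)^-1 by [].
exists (jump_measure nu); split; last first.
- by move=> t B mB; exact: marginal_jump_measure.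
- exact: jump_measure_single.
split=> //.
- split=> [n n0|]; first by rewrite gamE invr_gt0 tau_gt0.
  by apply/cvgrVy => //; near=> n; apply: tau_gt0; near: n; exact: nbhs_infty_gt.
- split; [exact: (jump_measure_neq0 nu0 nu_far)|exact: (jump_measure_bounded nu0 nu_far)|].
  exact: jump_measure_infinite.
have hc : hat_cvg (fun n B => ((tau n)^-1%:E *
    P [set w | path_set B (path_scale (lam n)^-1%R (walk_path X n w))])%E) (jump_measure nu).
  apply: (@path_event_cvg _ _ _ P d X mX alpha lam tau lam_oo tau_gt0).
  - exact: (jump_measure_far nu0 nu_far).
  - move=> r U c r0 oU Ur cU.
    apply: (@path_event_lower _ _ _ P d X mX indX idX lam lam_oo _ nu _ U r r0 oU Ur G_gt0 nu0 c cU).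
    + move=> e del; exact: (drop_small mX indX lam_mono lam_oo S_small).
    + move=> r' V' c'; exact: (rv_open_ge mZ alpha0 rv).
  - move=> r c; exact: (max_upper mX indX idX alpha0 G_gt0 G_ge G_le lam_mono lam_oo S_small lam2 lam_gt2).
have pathE n w : walk_path Z_ n w = walk_path X n w.
  by apply/skorokhod_eqP => t; exact: walkE.
by under eq_fun do under eq_fun do under eq_set do rewrite pathE.
Unshelve. all: by end_near. Qed.
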